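(* Let $n\ge1$, $\alpha\in(0,1)$ and let $\Omega\subset\mathbb R^n$ be an open set. If a measurable set $E\subset\mathbb R^n$ satisfies $P_\alpha(E;\Omega)<+\infty$, then $E$ is a set with finite fractional Caccioppoli $\alpha$-perimeter in $\Omega$, with $$|D^\alpha\chi_E|(\Omega)\le\mu_{n,\alpha}P_\alpha(E;\Omega)$$ and $$\int_E\mathrm{div}^\alpha\varphi\,dx=-\int_\Omega\varphi\cdot\nabla^\alpha\chi_E\,dx$$ for all $\varphi\in\mathrm{Lip}_c(\Omega;\mathbb R^n)$, so that $D^\alpha\chi_E=\nu^\alpha_E\,|D^\alpha\chi_E|=\nabla^\alpha\chi_E\,\mathscr L^n$ as measures on $\Omega$. Moreover, if $E$ is such that $|E|<+\infty$ and $P(E)<+\infty$, then $\chi_E\in W^{\alpha,1}(\mathbb R^n)$ for every $\alpha\in(0,1)$, and $$\nabla^\alpha\chi_E(x)=\frac{\mu_{n,\alpha}}{n+\alpha-1}\int_{\mathbb R^n}\frac{\nu_E(y)}{|y-x|^{n+\alpha-1}}\,d|D\chi_E|(y)$$ for $\mathscr L^n$-a.e. $x\in\mathbb R^n$.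
   Context: $\mathscr L^n$ (or $|\cdot|$) is Lebesgue measure; $\mathrm{Lip}_c(\Omega;\mathbb R^n)$ is the space of Lipschitz vector fields on $\mathbb R^n$ with compact support in $\Omega$. For $\alpha\in(0,1)$ let $\mu_{n,\alpha}:=2^\alpha\pi^{-n/2}\,\Gamma\big(\tfrac{n+\alpha+1}{2}\big)/\Gamma\big(\tfrac{1-\alpha}{2}\big)$. For $\varphi\in\mathrm{Lip}_c(\mathbb R^n;\mathbb R^n)$, $$\mathrm{div}^\alpha\varphi(x):=\mu_{n,\alpha}\int_{\mathbb R^n}\frac{(y-x)\cdot(\varphi(y)-\varphi(x))}{|y-x|^{n+\alpha+1}}\,dy,$$ a function in $L^1(\mathbb R^n)\cap L^\infty(\mathbb R^n)$, and $$\nabla^\alpha\chi_E(x):=\mu_{n,\alpha}\int_{\mathbb R^n}\frac{(y-x)(\chi_E(y)-\chi_E(x))}{|y-x|^{n+\alpha+1}}\,dy$$ at points $x$ where this integral converges absolutely. The fractional $\alpha$-perimeter of $E$ in $\Omega$ is $$P_\alpha(E;\Omega):=\int_\Omega\int_\Omega\frac{|\chi_E(x)-\chi_E(y)|}{|x-y|^{n+\alpha}}\,dx\,dy+2\int_\Omega\int_{\mathbb R^n\setminus\Omega}\frac{|\chi_E(x)-\chi_E(y)|}{|x-y|^{n+\alpha}}\,dx\,dy.$$ The fractional Caccioppoli $\alpha$-perimeter of $E$ in $\Omega$ is $$|D^\alpha\chi_E|(\Omega):=\sup\Big\{\int_E\mathrm{div}^\alpha\varphi\,dx:\ \varphi\in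 C^\infty_c(\Omega;\mathbb R^n),\ \|\varphi\|_{L^\infty}\le1\Big\}.$$ If it is finite, $D^\alpha\chi_E$ denotes the unique finite $\mathbb R^n$-valued Radon measure on $\Omega$ with $\int_E\mathrm{div}^\alpha\varphi\,dx=-\int_\Omega\varphi\cdot dD^\alpha\chi_E$ for all $\varphi\in C^\infty_c(\Omega;\mathbb R^n)$, $|D^\alpha\chi_E|$ its total variation, and $\nu^\alpha_E(x):=\lim_{r\to0}\frac{D^\alpha\chi_E(B_r(x))}{|D^\alpha\chi_E|(B_r(x))}$ at those $x\in\Omega\cap\mathrm{supp}(D^\alpha\chi_E)$ where the limit exists and belongs to $\mathbb S^{n-1}$ (this is $|D^\alpha\chi_E|$-a.e. point of $\Omega$). $W^{\alpha,1}(\mathbb R^n)$ is the space of $f\in L^1(\mathbb R^n)$ with $\int_{\mathbb R^n}\int_{\mathbb R^n}\frac{|f(x)-f(y)|}{|x-y|^{n+\alpha}}\,dx\,dy<+\infty$. $P(E)=|D\chi_E|(\mathbb R^n)$ is the classical (De Giorgi) perimeter, and $\nu_E$ the measure-theoretic inner unit normal, i.e. $D\chi_E=\nu_E|D\chi_E|$. *)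

(* Defs.v *)
From HB Require Import structures.
From mathcomp Require Import all_boot all_order all_algebra.
From mathcomp Require Import all_classical all_reals all_analysis.
From mathcomp Require Import measurable_realfun.

Set Implicit Arguments.
Unset Strict Implicit.
Unset Printing Implicit Defensive.

Import Order.TTheory GRing.Theory Num.Theory.
Import numFieldNormedType.Exports.

Local Open Scope classical_set_scope.
Local Open Scope ring_scope.

Notation borelRn R n := (g_sigma_algebraType (@open 'rV[R]_n)).

Section borelRn_theory.
Context {R : realType}.

Let ratball n (c : {ffun 'I_n -> rat} * nat) : set 'rV[R]_n :=
  [set x | forall i, `|ratr (c.1 i) - x ord0 i| < c.2.+1%:R^-1].

Let open_ratballs n (U : set 'rV[R]_n) : open U ->
  U = \bigcup_(c in [set c | ratball c `<=` U]) ratball c.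
Proof.
move=> oU; apply/seteqP; split=> [x Ux|x [c /= cU cx]]; last exact: cU.
have /nbhs_ballP[e /= e0 eU] : nbhs x U by exact: open_nbhs_nbhs.
have [k ke] : exists k : nat, k.+1%:R^-1 < e / 2.
  pose e2 : {posnum R} := PosNum (divr_gt0 e0 (ltr0n R 2)).
  by have [N _ /(_ N (leqnn N))] := near_infty_natSinv_lt e2; exists N.
have /choice[q qx] : forall i : 'I_n, exists q : rat,
    `|ratr q - x ord0 i| < k.+1%:R^-1.
  move=> i; have : x ord0 i < x ord0 i + k.+1%:R^-1 by rewrite ltrDl invr_gt0.
  move=> /rat_in_itvoo[q]; rewrite in_itv/= => /andP[q1 q2]; exists q.
  by rewrite gtr0_norm ?subr_gt0// ltrBlDl.
exists ([ffun i => q i], k) => /=; last by move=> i /=; rewrite ffunE.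
move=> y /= yq; apply: eU; split=> // i j; rewrite (ord1 i) /ball/=.
rewrite (splitr e) (le_lt_trans (ler_distD (ratr (q j)) _ _))// ltrD//.
  by rewrite distrC (lt_trans (qx j)).
by have := yq j; rewrite /= ffunE => /lt_trans; exact.
Qed.

Lemma measurable_coord n (i : 'I_n) :
  measurable_fun [set: borelRn R n] (fun x : borelRn R n => x ord0 i : R).
Proof.
apply: (measurability _ (RGenOpens.measurableE R)) => _ [_ [a [b ->]] <-].
rewrite setTI; apply: sub_sigma_algebra.
have := @coord_continuous R 1 n ord0 i.
by move/continuousP; apply; exact: interval_open.
Qed.

Lemma measurable_fun_rV d (T : measurableType d) n (f : T -> borelRn R n) :
  (forall i, measurable_fun [set: T] (fun x => f x ord0 i : R)) ->
  measurable_fun [set: T] f.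
Proof.
move=> mf; apply: (@measurability _ _ _ (borelRn R n) setT f (@open 'rV[R]_n)) => // _ [U oU <-].
rewrite (open_ratballs oU) setTI preimage_bigcup bigcup_mkcond.
apply: countable_bigcupT_measurable => // c; case: ifPn => // _.
rewrite (_ : _ @^-1` _ = \bigcap_(i in [set: 'I_n])
    ((fun x => f x ord0 i : R) @^-1` [set r | `|ratr (c.1 i) - r| < c.2.+1%:R^-1])).
  apply: fin_bigcap_measurable => // i _; rewrite -[X in measurable X]setTI.
  apply: mf => //; apply: open_measurable.
  exact: (@ball_open R R).
by apply/seteqP; split => x h i; [move=> _; exact: h|exact: h].
Qed.

Definition cons_rV n (p : R * borelRn R n) : borelRn R n.+1 :=
  row_mx (p.1)%:M (p.2 : 'rV[R]_n).

Definition uncons_rV n (v : borelRn R n.+1) : R * borelRn R n :=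
  (v ord0 ord0 : R, \row_i v ord0 (lift ord0 i)).

Lemma cons_rVK n : cancel (@cons_rV n) (@uncons_rV n).
Proof.
move=> [a v]; rewrite /cons_rV /uncons_rV/=; congr (_, _).
  rewrite mxE; case: splitP => // j _; by rewrite mxE (ord1 j) eqxx mulr1n.
apply/rowP => i; rewrite !mxE; case: splitP => [j|j /= /eqP].
  by rewrite (ord1 j).
by rewrite eqSS => /eqP ij; congr (v _ _); exact/val_inj.
Qed.

Lemma measurable_cons_rV n : measurable_fun [set: R * borelRn R n] (@cons_rV n).
Proof.
apply: measurable_fun_rV => i.
rewrite (_ : (fun x => _) = (fun p => match fintype.split (i : 'I_(1 + n)) with
   | inl _ => p.1 | inr j => (p.2 : 'rV[R]_n) ord0 j end)); last first.
  apply/funext => -[a v] /=; rewrite /cons_rV/= mxE.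
  by case: (fintype.split _) => j //; rewrite mxE (ord1 j) eqxx mulr1n.
case: (fintype.split _) => j; first exact: measurable_fst.
exact: (measurableT_comp (measurable_coord j) measurable_snd).
Qed.

Lemma measurable_uncons_rV n :
  measurable_fun [set: borelRn R n.+1] (@uncons_rV n).
Proof.
apply: measurable_fun_pair; first exact: measurable_coord.
apply: measurable_fun_rV => i.
rewrite (_ : (fun x => _) =
  (fun x : borelRn R n.+1 => x ord0 (lift ord0 i) : R)).
  exact: measurable_coord.
by apply/funext => x; rewrite mxE.
Qed.

End borelRn_theory.

Section lebesgue_borelRn_step.
Context {R : realType} (n : nat) (m : {sigma_finite_measure set borelRn R n -> \bar R}).
Local Open Scope ereal_scope.

Definition lebesgue_step : set (borelRn R n.+1) -> \bar R :=
  pushforward (@lebesgue_measure R \x m) (@cons_rV R n).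

Let lebesgue_step0 : lebesgue_step set0 = 0.
Proof. by rewrite /lebesgue_step /pushforward preimage_set0 measure0. Qed.

Let lebesgue_step_ge0 A : 0 <= lebesgue_step A.
Proof. by rewrite /lebesgue_step /pushforward measure_ge0. Qed.

Let lebesgue_step_sigma_additive : semi_sigma_additive lebesgue_step.
Proof.
move=> F mF tF mUF; rewrite /lebesgue_step /pushforward preimage_bigcup.
have mpre A : measurable A -> measurable (@cons_rV R n @^-1` A).
  by move=> mA; rewrite -[X in measurable X]setTI; exact: measurable_cons_rV.
apply: measure_semi_sigma_additive => [k||]; first exact: mpre.
  apply/trivIsetP => i j _ _ ij; rewrite -preimage_setI.
  by move/trivIsetP : tF => /(_ _ _ _ _ ij) ->//; rewrite preimage_set0.
by rewrite -preimage_bigcup; exact: mpre.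
Qed.

HB.instance Definition _ := isMeasure.Build _ _ _ lebesgue_step
  lebesgue_step0 lebesgue_step_ge0 lebesgue_step_sigma_additive.

Let lebesgue_step_sigma_finite : sigma_finite setT lebesgue_step.
Proof.
have /sigma_finiteP[F [TF ndF Foo]] := sigma_finiteT (@lebesgue_measure R).
have /sigma_finiteP[G [TG ndG Goo]] := sigma_finiteT m.
exists (fun k => @uncons_rV R n @^-1` (F k `*` G k)).
  rewrite -preimage_bigcup (_ : \bigcup_k _ = setT) ?preimage_setT//.
  rewrite -subTset => -[x y] _.
  have [i _ Fix] : (\bigcup_k F k) x by rewrite -TF.
  have [j _ Gjy] : (\bigcup_k G k) y by rewrite -TG.
  exists (maxn i j) => //; split.
    by move: x Fix; exact/subsetPset/ndF/leq_maxl.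
  by move: y Gjy; exact/subsetPset/ndG/leq_maxr.
move=> k; have [mFk Fk] := Foo k; have [mGk Gk] := Goo k; split.
  rewrite -[X in measurable X]setTI.
  by apply: measurable_uncons_rV => //; exact: measurableX.
rewrite /lebesgue_step /pushforward -comp_preimage.
rewrite (_ : _ \o _ = id); last by apply/funext => p /=; exact: cons_rVK.
by rewrite preimage_id product_measure1E// lte_mul_pinfty// ge0_fin_numE.
Qed.

HB.instance Definition _ := Measure_isSigmaFinite.Build _ _ _ lebesgue_step
  lebesgue_step_sigma_finite.

End lebesgue_borelRn_step.

Fixpoint lebesgue_borelRn (R : realType) (n : nat) :
    {sigma_finite_measure set borelRn R n -> \bar R} :=
  if n is n'.+1 then lebesgue_step (lebesgue_borelRn R n')
  else \d_(0 : borelRn R 0).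

(* The Lebesgue sigma-algebra and Lebesgue measure on R^n, as the completion
   of the n-fold product measure on Borel sets. *)
Notation lebRn R n :=
  (caratheodory_type (mu_ext (lebesgue_borelRn R n))).

Definition lebesgueRn (R : realType) (n : nat) : set (lebRn R n) -> \bar R :=
  @completed_measure_extension _ _ _ (lebesgue_borelRn R n).

Arguments lebesgueRn R n : clear implicits.

HB.instance Definition _ (R : realType) (n : nat) :=
  Measure.on (lebesgueRn R n).

Section euclidean.
Context {R : realType} {n : nat}.
Implicit Types x y : 'rV[R]_n.

Definition dotv x y : R := \sum_(i < n) x ord0 i * y ord0 i.

(* The library norm on 'rV[R]_n is the sup norm; it has the same topology,
   Lipschitz maps and derivatives as the Euclidean norm below. *)
Definition enorm x : R := Num.sqrt (dotv x x).

Definition eball x (r : R) : set 'rV[R]_n := [set y | enorm (y - x) < r].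

Definition basisv (i : 'I_n) : 'rV[R]_n := delta_mx ord0 i.

End euclidean.

Section vector_fields.
Context {R : realType} {n : nat}.
Implicit Types (phi : 'rV[R]_n -> 'rV[R]_n) (Omega : set 'rV[R]_n).

Fixpoint Ck (k : nat) phi : Prop :=
  continuous phi /\
  if k is k'.+1 then
    forall i : 'I_n, (forall x, derivable phi x (basisv i)) /\
                     Ck k' (fun x => 'D_(basisv i) phi x)
  else True.

Definition compactly_supported_in Omega phi : Prop :=
  compact (closure [set x | phi x != 0]) /\
  closure [set x | phi x != 0] `<=` Omega.

Definition Cinfty_c Omega phi : Prop :=
  (forall k, Ck k phi) /\ compactly_supported_in Omega phi.

Definition Lip_c Omega phi : Prop :=
  [lipschitz phi x | x in [set: 'rV[R]_n]] /\ compactly_supported_in Omega phi.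

Definition divergence phi (x : 'rV[R]_n) : R :=
  \sum_(i < n) ('D_(basisv i) phi x) ord0 i.

Definition Linfty_le1 phi : Prop :=
  (Lnorm (lebesgueRn R n) +oo%E (fun x : lebRn R n => (enorm (phi x))%:E)
    <= 1)%E.

End vector_fields.

(* For 0 < s the integrand is Lebesgue integrable on ]0, +oo[. *)
Definition GammaR {R : realType} (s : R) : R :=
  \int[@lebesgue_measure R]_(t in `]0, +oo[) (t `^ (s - 1) * expR (- t)).

Section fractional.
Context {R : realType}.

Definition mu_frac (n : nat) (alpha : R) : R :=
  2 `^ alpha * pi `^ (- (n%:R / 2)) *
  GammaR ((n%:R + alpha + 1) / 2) / GammaR ((1 - alpha) / 2).

Context {n : nat}.
Implicit Types (alpha : R) (E Omega : set 'rV[R]_n).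
Local Notation Leb := (lebesgueRn R n).

(* Here and below the quotients are 0 / 0 = 0 on the diagonal y = x, which is
   a null set. *)
Definition frac_div alpha (phi : 'rV[R]_n -> 'rV[R]_n) (x : 'rV[R]_n) : R :=
  mu_frac n alpha *
  \int[Leb]_y (dotv (y - x) (phi y - phi x) /
               enorm (y - x) `^ (n%:R + alpha + 1)).

Definition frac_grad_integrand alpha E (x y : 'rV[R]_n) : 'rV[R]_n :=
  ((\1_E y - \1_E x) / enorm (y - x) `^ (n%:R + alpha + 1)) *: (y - x).

Definition frac_grad_cvg alpha E (x : 'rV[R]_n) : Prop :=
  Leb.-integrable setT
    (fun y : lebRn R n => (enorm (frac_grad_integrand alpha E x y))%:E).

(* Meaningful only where [frac_grad_cvg alpha E x] holds. *)
Definition frac_grad alpha E (x : 'rV[R]_n) : 'rV[R]_n :=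
  \row_i (mu_frac n alpha *
          \int[Leb]_y (frac_grad_integrand alpha E x y) ord0 i).

Definition frac_kernel alpha (f : 'rV[R]_n -> R) (x y : 'rV[R]_n) : \bar R :=
  (`|f x - f y| / enorm (x - y) `^ (n%:R + alpha))%:E.

Definition frac_perimeter alpha E Omega : \bar R :=
  (\int[Leb]_(y in Omega) \int[Leb]_(x in Omega) frac_kernel alpha \1_E x y +
   2%:E * \int[Leb]_(y in Omega) \int[Leb]_(x in ~` Omega)
            frac_kernel alpha \1_E x y)%E.

Definition caccioppoli_perimeter alpha E Omega : \bar R :=
  ereal_sup [set (\int[Leb]_(x in E) frac_div alpha phi x)%:E
    | phi in [set phi | Cinfty_c Omega phi /\ Linfty_le1 phi]].

Definition W_alpha_1 alpha (f : 'rV[R]_n -> R) : Prop :=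
  Leb.-integrable setT (fun x : lebRn R n => (f x)%:E) /\
  (\int[Leb]_y \int[Leb]_x frac_kernel alpha f x y < +oo)%E.

Definition perimeter E : \bar R :=
  ereal_sup [set (\int[Leb]_(x in E) divergence phi x)%:E
    | phi in [set phi | Cinfty_c setT phi /\ Linfty_le1 phi]].

End fractional.

(* Finite R^n-valued Radon measures, given by their components. *)
Notation vmeasure R n := ('I_n -> {charge set borelRn R n -> \bar R}).

Section vector_measures.
Context {R : realType} {n : nat}.
Implicit Types (D : vmeasure R n) (A : set (borelRn R n)).

Definition vmeasure_val D A : 'rV[R]_n := \row_i fine (D i A).

Definition vtotal_variation D A : \bar R :=
  ereal_sup [set (\sum_(0 <= k <oo) (enorm (vmeasure_val D (F k)))%:E)%E
    | F in [set F : (set (borelRn R n))^nat |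
        [/\ forall k, measurable (F k), trivIset setT F
          & \bigcup_k F k = A]]].

(* Integral against the Jordan decomposition; it does not depend on the chosen
   Hahn decomposition. *)
Definition charge_integral (nu : {charge set borelRn R n -> \bar R})
    (f : 'rV[R]_n -> R) : R :=
  let hP := cid (Hahn_decomposition nu) in
  let hN := cid (projT2 hP) in
  \int[jordan_pos (projT2 hN)]_x f x - \int[jordan_neg (projT2 hN)]_x f x.

Definition vmeasure_integral D (phi : 'rV[R]_n -> 'rV[R]_n) : R :=
  \sum_(i < n) charge_integral (D i) (fun x => phi x ord0 i).

(* A measure on Omega is a measure on R^n vanishing on the Borel subsets of
   the complement of Omega. *)
Definition vmeasure_on (Omega : set 'rV[R]_n) D : Prop :=
  forall i A, measurable A -> A `<=` ~` Omega -> D i A = 0%E.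

(* D is the fractional variation measure of \1_E in Omega. *)
Definition frac_variation_measure (alpha : R) (E Omega : set 'rV[R]_n) D :=
  vmeasure_on Omega D /\
  forall phi, Cinfty_c Omega phi ->
    \int[lebesgueRn R n]_(x in E) frac_div alpha phi x =
    - vmeasure_integral D phi.

(* D is the distributional gradient of \1_E on R^n. *)
Definition variation_measure (E : set 'rV[R]_n) D :=
  forall phi, Cinfty_c setT phi ->
    \int[lebesgueRn R n]_(x in E) divergence phi x = - vmeasure_integral D phi.

(* D = nu |D| *)
Definition polar_density D (nu : 'rV[R]_n -> 'rV[R]_n) : Prop :=
  forall i : 'I_n,
    (vtotal_variation D).-integrable setT
      (fun x : borelRn R n => (nu x ord0 i)%:E) /\
    forall A, measurable A ->
      D i A = (\int[vtotal_variation D]_(x in A) (nu x ord0 i)%:E)%E.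

Definition ball_quotient D (x : 'rV[R]_n) (r : R) : 'rV[R]_n :=
  (fine (vtotal_variation D (eball x r)))^-1 *: vmeasure_val D (eball x r).

(* The points of Omega lying in the support of D where the limit of D(B_r(x)) /
   |D|(B_r(x)) as r -> 0+ exists and is a unit vector. *)
Definition vnormal_domain (Omega : set 'rV[R]_n) D : set 'rV[R]_n :=
  [set x | [/\ Omega x,
      forall r : R, 0 < r -> (0 < vtotal_variation D (eball x r))%E
    & exists2 v, enorm v = 1 & ball_quotient D x r @[r --> 0^'+] --> v]].

(* The value 0 outside the domain is arbitrary. *)
Definition vnormal (Omega : set 'rV[R]_n) D (x : 'rV[R]_n) : 'rV[R]_n :=
  if x \in vnormal_domain Omega D then
    lim (ball_quotient D x r @[r --> 0^'+])
  else 0.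

End vector_measures.

(* Main.v *)
(* Substituting y = x + z turns the fractional gradient and divergence into integrals of
   differences against the odd kernel z / |z|^(n+alpha+1). When the fractional perimeter is
   finite, the double integral pairing phi with the differences of chi_E converges absolutely,
   so Fubini and oddness give integration by parts without truncating the kernel. The variation
   bound follows from |phi| <= 1, and a measure with the same integrals against smooth bumps is
   determined, hence has density grad^alpha chi_E. The polar decomposition is the Lebesgue
   differentiation theorem along Euclidean balls.

   For E of finite perimeter, testing D chi_E on Riemann sums of translates of a test function
   gives || chi_E(. + z) - chi_E ||_1 <= n P(E) |z|; splitting at |z| = 1 gives membership in
   W^(alpha,1). The representation formula comes from
   d_i |z|^(-p) = - p z_i |z|^(-p-2) with p = n + alpha - 1, integrated by parts against a
   regularization of |z|^(-p), and from Fubini in z and |D chi_E|. *)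

Require Import Defs.
From HB Require Import structures.
From mathcomp Require Import all_boot all_order all_algebra.
From mathcomp Require Import all_classical all_reals all_analysis.
From mathcomp Require Import measurable_realfun ring lra.

Set Implicit Arguments.
Unset Strict Implicit.
Unset Printing Implicit Defensive.

Import Order.TTheory GRing.Theory Num.Theory.
Import numFieldNormedType.Exports.

Local Open Scope classical_set_scope.
Local Open Scope ring_scope.

(** * Densities and the Lebesgue completion *)

(** The statement uses the completed measure [lebesgueRn], while products, Fubini and charges live
    on Borel sets. A Lebesgue measurable [E] is therefore exchanged once for a Borel set [F] with
    the same indicator almost everywhere; estimates are made for [F], and integrals and null sets
    are carried back. Two objects need a representation before they can be integrated.
    [vtotal_variation D] is a bare supremum over partitions, and is shown to be a finite measure
    with density |g|. [vnormal] is a limit over a continuum of radii, and becomes measurable once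
    its domain is described by rational radii and rational vectors. Real integrals are [fine] of
    extended ones, so a divergent integral has value 0; for the sections that occur here, divergence
    is confined to null sets. Differentiation is proved first for sup-norm balls, which are cubes,
    and reaches Euclidean balls at the price of a factor n^n. The constant [mu_frac n alpha] in the
    variation bound is not spoiled by a dimensional factor because components are summed inside the
    integral before absolute values are taken. *)

Section set_function_integral.
Import HBNNSimple.
Local Open Scope ereal_scope.
Context d (T : measurableType d) (R : realType).

(** An integral sees a set function only through its values on level sets of simple functions. This
    makes it possible to replace the raw set function [vtotal_variation D] by a genuine measure that
    agrees with it on measurable sets. *)
Lemma eq_setfun_integral (m1 m2 : set T -> \bar R) (D : set T) (f : T -> \bar R) :
  (forall A, measurable A -> m1 A = m2 A) ->
  \int[m1]_(x in D) f x = \int[m2]_(x in D) f x.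
Proof.
move=> m12; rewrite /integral.
have E (h : {nnsfun T >-> R}) : sintegral m1 h = sintegral m2 h.
  rewrite !sintegralET; apply: eq_fsbigr => x _; congr (_ * _).
  by apply: m12; rewrite -[X in measurable X]setTI; exact: measurable_funP.
congr (ereal_sup _ - ereal_sup _).
  by apply/seteqP; split=> _ [h hf <-]; exists h => //=; rewrite E.
by apply/seteqP; split=> _ [h hf <-]; exists h => //=; rewrite E.
Qed.

Lemma eq_setfun_integrable (m1 m2 : set T -> \bar R) (D : set T) (f : T -> \bar R) :
  (forall A, measurable A -> m1 A = m2 A) ->
  m1.-integrable D f = m2.-integrable D f.
Proof.
move=> m12; rewrite !integrable.unlock.
by rewrite (eq_setfun_integral _ _ m12).
Qed.

Context (mu nu : {measure set T -> \bar R}) (g : T -> R).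
Hypotheses (mg : measurable_fun setT g) (g0 : forall x, (0 <= g x)%R).
Hypothesis nuE : forall A, measurable A -> nu A = \int[mu]_(x in A) (g x)%:E.

Let nnsfun_density (f : {nnsfun T >-> R}) :
  \int[nu]_x (f x)%:E = \int[mu]_x ((f x)%:E * (g x)%:E).
Proof.
rewrite [LHS]integralT_nnsfun sintegralE.
transitivity (\int[mu]_x (\sum_(k \in range f)
    (k%:E * (\1_(f @^-1` [set k]) x)%:E * (g x)%:E))); last first.
  apply: eq_integral => x _.
  rewrite [in RHS](fimfunE f) -fsumEFin// ge0_mule_fsuml//.
  by move=> i; rewrite EFinM; exact: nnfun_muleindic_ge0.
rewrite ge0_integral_fsum//; last 2 first.
- move=> k; apply: emeasurable_funM => //.
  by apply/measurable_EFinP; apply: measurable_funM.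
  exact/measurable_EFinP.
- by move=> k x _; apply: mule_ge0; [exact: nnfun_muleindic_ge0|by rewrite lee_fin].
apply: eq_fsbigr => k kf.
have mk : measurable (f @^-1` [set k]).
  by rewrite -[X in measurable X]setTI; exact: measurable_funP.
have k0 : (0 <= k)%R by move: kf; rewrite inE => -[x _ <-].
rewrite nuE//.
under [RHS]eq_integral do rewrite -muleA.
rewrite ge0_integralZl//; last 2 first.
- by apply: emeasurable_funM; exact/measurable_EFinP.
- by move=> x _; rewrite mule_ge0// lee_fin.
congr (_ * _); rewrite [LHS]integral_mkcond; apply: eq_integral => x _.
by rewrite epatch_indic muleC.
Qed.

(** The identity holds for simple functions by linearity and passes to [f] by monotone convergence
    on both sides, since multiplication by [g x] preserves monotone limits. *)
Lemma ge0_integral_density (f : T -> \bar R) :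
  measurable_fun setT f -> (forall x, 0 <= f x) ->
  \int[nu]_x f x = \int[mu]_x (f x * (g x)%:E).
Proof.
move=> mf f0; pose f_ := nnsfun_approx measurableT mf.
transitivity (limn (fun n => \int[nu]_x (f_ n x)%:E)).
  rewrite -monotone_convergence//.
  - by apply: eq_integral => y _; apply/esym/cvg_lim => //; exact: cvg_nnsfun_approx.
  - by move=> n; exact/measurable_EFinP/measurable_funP.
  - by move=> n y _; rewrite lee_fin.
  - by move=> y _ m n mn; rewrite lee_fin; exact/lefP/nd_nnsfun_approx.
rewrite [X in limn X](_ : _ =
    (fun n => \int[mu]_x ((f_ n x)%:E * (g x)%:E))); last first.
  by apply/funext => n; exact: nnsfun_density.
rewrite -monotone_convergence//.
- apply: eq_integral => x _; apply/cvg_lim => //.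
  apply: cvgeZr => //.
  by apply: cvg_nnsfun_approx => //.
- by move=> n; apply: emeasurable_funM; apply/measurable_EFinP => //; exact/measurable_funP.
- by move=> n y _; rewrite mule_ge0// lee_fin.
- move=> y _ m n mn; apply: lee_wpmul2r; first by rewrite lee_fin.
  by rewrite lee_fin; exact/lefP/nd_nnsfun_approx.
Qed.

End set_function_integral.

Lemma ge0_integral_image d1 d2 (X : measurableType d1) (Y : measurableType d2)
    (R : realType) (phi : X -> Y) (mphi : measurable_fun setT phi)
    (mu : {measure set X -> \bar R}) (nu : {measure set Y -> \bar R}) :
  (forall A, measurable A -> nu A = mu (phi @^-1` A)) ->
  forall f : Y -> \bar R, measurable_fun setT f -> (forall y, (0 <= f y)%E) ->
  (\int[nu]_y f y = \int[mu]_x f (phi x))%E.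
Proof.
move=> nuE f mf f0.
rewrite (eq_setfun_integral _ _ (m2 := pushforward mu phi))//.
by rewrite ge0_integral_pushforward.
Qed.

Lemma integral_image d1 d2 (X : measurableType d1) (Y : measurableType d2)
    (R : realType) (phi : X -> Y) (mphi : measurable_fun setT phi)
    (mu : {measure set X -> \bar R}) (nu : {measure set Y -> \bar R}) :
  (forall A, measurable A -> nu A = mu (phi @^-1` A)) ->
  forall f : Y -> \bar R, measurable_fun setT f ->
  (\int[nu]_y f y = \int[mu]_x f (phi x))%E.
Proof.
move=> nuE f mf; rewrite integralE [RHS]integralE.
congr (_ - _)%E.
  rewrite (ge0_integral_image mphi nuE)//; last exact: measurable_funepos.
  by apply: eq_integral => x _; rewrite !funeposE.
rewrite (ge0_integral_image mphi nuE)//; last exact: measurable_funeneg.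
by apply: eq_integral => x _; rewrite !funenegE.
Qed.

(* Stated for a raw set function, for which no filter instance is inferred. *)
Lemma ae_imply d (T : measurableType d) (R : realType) (mu : set T -> \bar R)
    (P Q : T -> Prop) :
  (forall x, P x -> Q x) -> {ae mu, forall x, P x} -> {ae mu, forall x, Q x}.
Proof.
move=> PQ [A [mA A0 NA]]; exists A; split => //.
by move=> x /= nQ; apply: NA => /= Px; exact/nQ/PQ.
Qed.

(** * Completion of a sigma-finite measure and Borel representatives *)

Section completion_theory.
Local Open Scope ereal_scope.
Context d (T : measurableType d) (R : realType).
Variable lam : {sigma_finite_measure set T -> \bar R}.
Local Notation cT := (caratheodory_type (mu_ext lam)).
Local Notation Leb := (@completed_measure_extension _ _ _ lam).

Lemma borel_completed (A : set T) :
  measurable (A : set T) -> measurable (A : set (cT)).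
Proof. by move=> mA; apply: sub_caratheodory; exact: sub_gen_smallest. Qed.

Lemma completed_borel (A : set T) :
  measurable (A : set T) -> Leb A = lam A.
Proof. by move=> mA; rewrite /completed_measure_extension measurable_mu_extE. Qed.

Lemma measurable_id_completed :
  measurable_fun [set: cT] (id : cT -> T).
Proof. by move=> _ A mA; rewrite setTI; exact: borel_completed. Qed.

Lemma measurable_fun_completed d' (U : measurableType d') (f : T -> U) :
  measurable_fun [set: T] f ->
  measurable_fun [set: cT] (f : cT -> U).
Proof.
by move=> mf _ A mA; rewrite setTI; apply: borel_completed; rewrite -[X in measurable X]setTI; exact: mf.
Qed.

Lemma completed_complete : measure_is_complete Leb.
Proof. exact: measure_is_complete_caratheodory. Qed.

(** The identity map from the completed to the Borel sigma-algebra is measurable and has image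
    measure [lam], so this is a change of variables. *)
Lemma integral_completed (f : T -> \bar R) : measurable_fun [set: T] f ->
  \int[Leb]_x f x = \int[lam]_x f x.
Proof.
move=> mf; apply/esym.
apply: (@integral_image _ _ cT T R id measurable_id_completed Leb lam _ f mf).
by move=> A mA; exact/esym/completed_borel.
Qed.

(** The outer measure is an infimum over countable Borel covers. Intersecting covers of excess at
    most 1/(k+1) gives a Borel hull of the same measure, and finiteness of [Leb E] turns equality of
    measures into a null difference. *)
Let cover_fin (E : set T) : measurable (E : set (cT)) ->
  Leb E < +oo ->
  exists G : set T, [/\ measurable (G : set T), E `<=` G
    & Leb (G `\` E) = 0].
Proof.
move=> mE Eoo.
have /choice[A HA] : forall k : nat, exists A : (set T)^nat,
   [/\ forall i, measurable (A i), E `<=` \bigcup_i A i &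
    \sum_(i <oo) lam (A i) < Leb E + (k.+1%:R^-1)%:E].
  move=> k; have : Leb E < Leb E + (k.+1%:R^-1)%:E.
    by rewrite lteDl ?ge0_fin_numE// lte_fin invr_gt0.
  rewrite {1}/completed_measure_extension /mu_ext.
  by move=> /ereal_inf_lt[_ [A [mA EA] <-] h]; exists A.
pose G := \bigcap_k \bigcup_i A k i.
have mG : measurable (G : set T).
  apply: bigcapT_measurable => k; apply: bigcupT_measurable => i.
  by have [] := HA k.
have EG : E `<=` G by move=> x Ex k _; have [_ + _] := HA k; exact.
exists G; split => //.
have GE : Leb G <= Leb E.
  apply/lee_addgt0Pr => e e0.
  have [k ke] : exists k : nat, (k.+1%:R^-1 < e)%R.
    by have [N _ /(_ N (leqnn N))] := near_infty_natSinv_lt (PosNum e0); exists N.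
  have [mA _ lA] := HA k.
  apply: (@le_trans _ _ (Leb E + (k.+1%:R^-1)%:E)); last first.
    by rewrite leeD2l// lee_fin ltW.
  apply: le_trans (ltW lA).
  rewrite completed_borel//.
  apply: (@le_trans _ _ (lam (\bigcup_i A k i))).
    apply: le_measure; rewrite ?inE//; first exact: bigcupT_measurable.
    by move=> x; exact.
  by apply: measure_sigma_subadditive => //; exact: bigcupT_measurable.
have mG' := borel_completed mG.
have GDE : Leb (G `\` E) = Leb G - Leb E.
  by rewrite measureD//= ?setIidr//; exact: (le_lt_trans GE).
by apply/eqP; rewrite eq_le measure_ge0 andbT GDE sube_le0.
Qed.

(** Hulls of the pieces [E] cut by a sigma-finite exhaustion are glued; the excess of the union lies
    in the union of the excesses. *)
Lemma completed_borel_cover (E : set T) : measurable (E : set (cT)) ->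
  exists G : set T, [/\ measurable (G : set T), E `<=` G
    & Leb (G `\` E) = 0].
Proof.
move=> mE; have /sigma_finiteP[F [TF ndF Foo]] := sigma_finiteT lam.
have mEF k : measurable ((E `&` F k) : set (cT)).
  by apply: measurableI => //; apply: borel_completed; have [] := Foo k.
have /choice[G HG] : forall k, exists G : set T,
   [/\ measurable (G : set T), (E `&` F k) `<=` G
    & Leb (G `\` (E `&` F k)) = 0].
  move=> k; apply: cover_fin => //.
  have [mF lF] := Foo k; apply: le_lt_trans lF.
  apply: (@le_trans _ _ (Leb (F k))); last by rewrite completed_borel.
  apply: le_measure; rewrite ?inE//.
  exact: borel_completed.
exists (\bigcup_k G k); split.
- by apply: bigcupT_measurable => k; have [] := HG k.
- move=> x Ex; have [k _ Fk] : (\bigcup_k F k) x by rewrite -TF.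
  by exists k => //; have [_ + _] := HG k; exact.
- apply/eqP; rewrite -measure_le0.
  apply: (@le_trans _ _ (Leb (\bigcup_k (G k `\` (E `&` F k))))).
    have mU k : measurable ((G k `\` (E `&` F k)) : set (cT)).
      by apply: measurableD => //; apply: borel_completed; have [] := HG k.
    apply: le_measure; rewrite ?inE//; last 2 first.
    + exact: bigcupT_measurable.
    + by move=> x [[k _ Gk] nE]; exists k => //; split => // -[].
    apply: measurableD => //; apply: bigcupT_measurable => k.
    by apply: borel_completed; have [] := HG k.
  apply: (@le_trans _ _ (\sum_(k <oo) Leb (G k `\` (E `&` F k)))).
    apply: measure_sigma_subadditive => //.
    + by move=> k; apply: measurableD => //; apply: borel_completed; have [] := HG k.
    + apply: bigcupT_measurable => k.
      by apply: measurableD => //; apply: borel_completed; have [] := HG k.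
  by rewrite eseries0// => k _ _; have [] := HG k.
Qed.

Lemma negligible_completed (N : set T) :
  lam.-negligible N <-> Leb.-negligible N.
Proof.
split=> -[A [mA A0 NA]].
  exists A; split => //; first exact: borel_completed.
  by rewrite -A0; exact: completed_borel.
have [G [mG AG G0]] := completed_borel_cover mA.
exists G; split => //; last exact: subset_trans AG.
transitivity (Leb G); first by rewrite completed_borel.
have -> : G = A `|` (G `\` A) by rewrite setDUK.
apply/eqP; rewrite -measure_le0; apply: le_trans (measureU2 _ _ _) _ => //.
  by apply: measurableD => //; exact: borel_completed.
by rewrite [X in X + _]A0 [X in _ + X]G0 adde0.
Qed.

Lemma ae_completed (P : T -> Prop) :
  {ae lam, forall x, P x} <-> {ae Leb, forall x, P x}.
Proof. exact: negligible_completed. Qed.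

(** This supplies the Borel set that stands for [E] in all later estimates. The exceptional set is
    null for the Borel measure too, because both measures have the same negligible sets. *)
Lemma completed_ae_borel (E : set T) : measurable (E : set cT) ->
  exists2 G : set T, measurable G & {ae lam, forall x, E x <-> G x}.
Proof.
move=> mE; have [G [mG EG G0]] := completed_borel_cover mE; exists G => //.
apply/ae_completed; exists (G `\` E); split => //.
  by apply: measurableD => //; exact: borel_completed.
move=> x /= nEG; split; apply: contrapT => h; apply: nEG.
  by split=> [/EG|] /h.
by split=> [/EG//|_]; exact: contrapT.
Qed.

(** Completeness of [Leb] gives measurability of [f] from that of [g]; this is how functions built
    from [E] become measurable. *)
Lemma ae_measurable_completed (f g : T -> \bar R) :
  measurable_fun [set: T] g -> {ae lam, forall x, f x = g x} ->
  measurable_fun [set: cT] f.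
Proof.
move=> mg /ae_completed fg.
apply: (ae_measurable_fun completed_complete _ (measurable_fun_completed mg)).
by apply: ae_imply fg => x ->.
Qed.

Lemma ae_integral_completed (f g : T -> \bar R) :
  measurable_fun [set: T] g -> {ae lam, forall x, f x = g x} ->
  \int[Leb]_x f x = \int[lam]_x g x.
Proof.
move=> mg fg; rewrite -integral_completed; last exact: mg.
apply: ae_eq_integral; first exact: measurableT.
- exact: ae_measurable_completed fg.
- exact: measurable_fun_completed.
- by move/ae_completed : fg; apply: ae_imply => x ->.
Qed.

Lemma ae_integrable_completed (f g : T -> \bar R) :
  measurable_fun [set: T] g -> {ae lam, forall x, f x = g x} ->
  Leb.-integrable setT f <-> lam.-integrable setT g.
Proof.
move=> mg fg.
have E : \int[Leb]_x `|f x| = \int[lam]_x `|g x|.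
  apply: ae_integral_completed; first exact: measurableT_comp.
  by apply: ae_imply fg => x ->.
split=> /integrableP[mf fi]; apply/integrableP; split.
- exact: mg.
- by rewrite -E.
- exact: ae_measurable_completed fg.
- by rewrite E.
Qed.

End completion_theory.

(** * Measurability of vector operations on Borel row vectors *)

Section borel_functions.
Context {R : realType}.

Lemma measurable_open_borelRn n (U : set 'rV[R]_n) :
  open U -> measurable (U : set (borelRn R n)).
Proof. by move=> oU; exact: sub_sigma_algebra. Qed.

Lemma measurable_closed_borelRn n (U : set 'rV[R]_n) :
  closed U -> measurable (U : set (borelRn R n)).
Proof.
by move=> cU; rewrite -(setCK U); apply: measurableC; apply: measurable_open_borelRn; exact: closed_openC.
Qed.

Lemma continuous_measurable_rV n (f : 'rV[R]_n -> R) :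
  continuous f -> measurable_fun [set: borelRn R n] (f : borelRn R n -> R).
Proof.
move=> cf; apply: (measurability _ (RGenOpens.measurableE R)) => _ [_ [a [b ->]] <-].
rewrite setTI; apply: measurable_open_borelRn.
by move/continuousP : cf; apply; exact: interval_open.
Qed.

Lemma measurable_addv d (T : measurableType d) n (f g : T -> borelRn R n) :
  measurable_fun setT f -> measurable_fun setT g ->
  measurable_fun setT (fun x => (f x : 'rV[R]_n) + g x : borelRn R n).
Proof.
move=> mf mg; apply: measurable_fun_rV => i.
under eq_fun do rewrite mxE.
by apply: measurable_funD; exact: (measurableT_comp (measurable_coord i)).
Qed.

Lemma measurable_scalev d (T : measurableType d) n (s : T -> R) (f : T -> borelRn R n) :
  measurable_fun setT s -> measurable_fun setT f ->
  measurable_fun setT (fun x => s x *: (f x : 'rV[R]_n) : borelRn R n).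
Proof.
move=> ms mf; apply: measurable_fun_rV => i.
under eq_fun do rewrite mxE.
by apply: measurable_funM => //; exact: (measurableT_comp (measurable_coord i)).
Qed.

Lemma measurable_oppv d (T : measurableType d) n (f : T -> borelRn R n) :
  measurable_fun setT f ->
  measurable_fun setT (fun x => - (f x : 'rV[R]_n) : borelRn R n).
Proof.
move=> mf; under eq_fun do rewrite -scaleN1r.
exact: measurable_scalev.
Qed.

Lemma measurable_subv d (T : measurableType d) n (f g : T -> borelRn R n) :
  measurable_fun setT f -> measurable_fun setT g ->
  measurable_fun setT (fun x => (f x : 'rV[R]_n) - g x : borelRn R n).
Proof. by move=> mf mg; apply: measurable_addv => //; exact: measurable_oppv. Qed.

Lemma measurable_dotv d (T : measurableType d) n (f g : T -> borelRn R n) :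
  measurable_fun setT f -> measurable_fun setT g ->
  measurable_fun setT (fun x => dotv (f x) (g x)).
Proof.
move=> mf mg; apply: measurable_sum => i.
by apply: measurable_funM; exact: (measurableT_comp (measurable_coord i)).
Qed.

Lemma measurable_sqrtr d (T : measurableType d) (f : T -> R) :
  measurable_fun setT f -> measurable_fun setT (fun x => Num.sqrt (f x)).
Proof.
by move=> mf; apply: (measurableT_comp (continuous_measurable_fun _)) mf; exact: sqrt_continuous.
Qed.

Lemma measurable_funpowR d (T : measurableType d) (f : T -> R) (s : R) :
  measurable_fun setT f -> measurable_fun setT (fun x => f x `^ s).
Proof. by move=> mf; exact: (measurableT_comp (@measurable_powR R s) mf). Qed.

Lemma measurable_invr d (T : measurableType d) (f : T -> R) :
  measurable_fun setT f -> measurable_fun setT (fun x => (f x)^-1).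
Proof.
move=> mf; rewrite (_ : (fun x => _) = (fun x => f x * (f x ^+ 2) `^ (-1))).
  by apply: measurable_funM => //; apply: measurable_funpowR; exact: measurable_funX.
apply/funext => x; rewrite powR_inv1 ?sqr_ge0//.
have [->|fx0] := eqVneq (f x) 0; first by rewrite invr0 mul0r.
by rewrite expr2 invfM mulrA divff// mul1r.
Qed.

Lemma measurable_enorm d (T : measurableType d) n (f : T -> borelRn R n) :
  measurable_fun setT f -> measurable_fun setT (fun x => enorm (f x)).
Proof. by move=> mf; apply: measurable_sqrtr; exact: measurable_dotv. Qed.

End borel_functions.

(** * Lebesgue measure and Euclidean balls on row vectors *)

Section lebesgue_invariance.
Local Open Scope ereal_scope.
Context {R : realType}.
Local Notation mu := (@lebesgue_measure R).

Lemma ge0_integral_lebesgue_step n (f : 'rV[R]_n.+1 -> \bar R) :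
  measurable_fun [set: borelRn R n.+1] f -> (forall x, 0 <= f x) ->
  \int[lebesgue_borelRn R n.+1]_x f x =
  \int[mu]_t \int[lebesgue_borelRn R n]_y f (cons_rV (t, y)).
Proof.
move=> mf f0.
rewrite (@ge0_integral_image _ _ (measurableTypeR R * borelRn R n)%type (borelRn R n.+1) R
  (@cons_rV R n) (@measurable_cons_rV R n) (mu \x lebesgue_borelRn R n))//.
by rewrite fubini_tonelli1//; exact: measurableT_comp mf (@measurable_cons_rV R n).
Qed.

Lemma measurable_lebesgue_step n (f : 'rV[R]_n.+1 -> \bar R) :
  measurable_fun [set: borelRn R n.+1] f -> (forall x, 0 <= f x) ->
  measurable_fun setT
    (fun t : R => \int[lebesgue_borelRn R n]_y f (cons_rV (t, y))).
Proof.
move=> mf f0.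
apply: (@measurable_fun_fubini_tonelli_F _ _ _ _ _ (lebesgue_borelRn R n)
  (f \o (@cons_rV R n))); last by move=> x; exact: f0.
exact: measurableT_comp mf (@measurable_cons_rV R n).
Qed.

(** The boolean covers translations and point reflections at once, both being needed later. By
    uniqueness of Lebesgue measure only half-open intervals have to be checked; a reflection
    exchanges which endpoint is included. *)
Lemma lebesgue_measure_affine (b : bool) (a : R) (A : set R) : measurable A ->
  mu ((fun t => (-1) ^+ b * t + a)%R @^-1` A) = mu A.
Proof.
have mfun : measurable_fun setT (fun t : R => (-1) ^+ b * t + a)%R.
  by apply: measurable_funD => //; exact: measurable_funM.
move=> mA; apply/esym.
apply: (@lebesgue_measure_unique R (pushforward mu (fun t : measurableTypeR R => (-1) ^+ b * t + a : measurableTypeR R)%R)) => //= _ [[x y]] _ <-.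
rewrite /pushforward; case: b mfun => mfun /=.
  have -> : (fun t => (-1) ^+ 1 * t + a)%R @^-1` `]x, y]%classic = `[(a - y)%R, (a - x)%R[%classic.
    apply/seteqP; split => t /=; rewrite !in_itv/= expr1 mulN1r; lra.
  by rewrite !lebesgue_measure_itv/= !lte_fin ltrD2l ltrN2; case: ifPn => // _;
    rewrite -!EFinB; congr EFin; ring.
have -> : (fun t => (-1) ^+ 0 * t + a)%R @^-1` `]x, y]%classic = `](x - a)%R, (y - a)%R]%classic.
  apply/seteqP; split => t /=; rewrite !in_itv/= expr0 mul1r; lra.
by rewrite !lebesgue_measure_itv/= !lte_fin ltrD2r; case: ifPn => // _;
    rewrite -!EFinB; congr EFin; ring.
Qed.

Lemma measurable_affine_rV n (b : bool) (v : 'rV[R]_n) :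
  measurable_fun [set: borelRn R n] (fun x : borelRn R n => (-1) ^+ b *: x + v : borelRn R n)%R.
Proof. by apply: measurable_addv => //; exact: measurable_scalev. Qed.

(** Induction on the dimension: Tonelli splits off the first coordinate, the induction hypothesis
    removes the affine map from the others, and one-dimensional invariance removes it from the
    first. *)
Let ge0_integral_affine n (b : bool) (v : 'rV[R]_n) (f : 'rV[R]_n -> \bar R) :
  measurable_fun [set: borelRn R n] f -> (forall x, 0 <= f x) ->
  \int[lebesgue_borelRn R n]_x f ((-1) ^+ b *: x + v)%R =
  \int[lebesgue_borelRn R n]_x f x.
Proof.
elim: n v f => [|n IH] v f mf f0.
  by apply: eq_integral => x _; congr f; rewrite (thinmx0 (_ + _)%R) (thinmx0 x).
have mfT := measurableT_comp mf (@measurable_affine_rV _ b v).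
rewrite (ge0_integral_lebesgue_step mfT (fun x => f0 _)).
rewrite (ge0_integral_lebesgue_step mf f0).
pose v0 := (uncons_rV v).1; pose v' : 'rV[R]_n := (uncons_rV v).2.
pose G (t : R) := \int[lebesgue_borelRn R n]_y f (cons_rV (t, y)).
have consE t (y : 'rV[R]_n) : ((-1) ^+ b *: cons_rV (t, y) + v =
    cons_rV ((-1) ^+ b * t + v0, ((-1) ^+ b *: y + v' : borelRn R n)))%R.
  apply/rowP => i; rewrite !mxE; case: splitP => j ij.
    by rewrite !mxE (ord1 j) !eqxx !mulr1n /v0 /=; congr (_ + v _ _)%R; apply/val_inj; rewrite /= ij (ord1 j).
  by rewrite /= !mxE; congr (_ + v _ _)%R; apply/val_inj; rewrite /= ij.
transitivity (\int[mu]_t G ((-1) ^+ b * t + v0)%R).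
  apply: eq_integral => t _; under eq_integral do rewrite /= consE.
  apply: (IH v' (fun y => f (cons_rV (((-1) ^+ b * t + v0)%R, y)))) => //.
  exact: (measurableT_comp (measurableT_comp mf (@measurable_cons_rV R n)) (pair1_measurable _)).
have mG : measurable_fun setT G by exact: measurable_lebesgue_step.
have G0 t : 0 <= G t by apply: integral_ge0 => y _; exact: f0.
apply/esym.
have mfun : measurable_fun setT (fun t : R => (-1) ^+ b * t + v0)%R.
  by apply: measurable_funD => //; exact: measurable_funM.
exact: (@ge0_integral_image _ _ (measurableTypeR R) (measurableTypeR R) R _ mfun
  mu mu (fun A mA => esym (lebesgue_measure_affine b v0 mA)) G mG G0).
Qed.

Lemma lebesgue_borelRn_affine n (b : bool) (v : 'rV[R]_n) (A : set 'rV[R]_n) :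
  measurable (A : set (borelRn R n)) ->
  lebesgue_borelRn R n ((fun x => (-1) ^+ b *: x + v)%R @^-1` A) = lebesgue_borelRn R n A.
Proof.
move=> mA; have := @ge0_integral_affine n b v (EFin \o \1_A).
move=> /(_ _ _)/=; rewrite [X in _ -> _ -> _ = X]integral_indic// setIT.
have mA' : measurable ((fun x : borelRn R n => (-1) ^+ b *: x + v : borelRn R n)%R @^-1` A).
  by rewrite -[X in measurable X]setTI; exact: measurable_affine_rV.
move=> <-; last 2 first.
- by apply/measurable_EFinP.
- by move=> x; rewrite lee_fin.
transitivity (\int[lebesgue_borelRn R n]_x
    (\1_((fun x => (-1) ^+ b *: x + v)%R @^-1` A) x)%:E) => //.
by rewrite integral_indic// setIT.
Qed.

Context n (f : 'rV[R]_n -> \bar R).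
Hypothesis mf : measurable_fun [set: borelRn R n] f.
Local Notation lam := (lebesgue_borelRn R n).

Lemma integral_affine (b : bool) (v : 'rV[R]_n) :
  \int[lam]_x f ((-1) ^+ b *: x + v)%R = \int[lam]_x f x.
Proof.
apply/esym; apply: (integral_image (@measurable_affine_rV n b v)) => //.
by move=> A mA; exact/esym/lebesgue_borelRn_affine.
Qed.

Lemma integral_translate (v : 'rV[R]_n) :
  \int[lam]_x f (x + v)%R = \int[lam]_x f x.
Proof.
by rewrite -(integral_affine false v); apply: eq_integral => x _; rewrite expr0 scale1r.
Qed.

Lemma integral_reflect : \int[lam]_x f (- x)%R = \int[lam]_x f x.
Proof.
by rewrite -(integral_affine true 0%R); apply: eq_integral => x _; rewrite expr1 scaleN1r addr0.
Qed.

End lebesgue_invariance.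

(** * Volume of sup-norm balls *)

Section ball_measure.
Context {R : realType}.

Lemma ball_rVE n (x : 'rV[R]_n) (r : R) : 0 < r ->
  ball x r = [set y | forall i, `|x ord0 i - y ord0 i| < r].
Proof.
move=> r0; apply/seteqP; split => y; rewrite /ball/=.
  by move=> [_ +] i; exact.
by move=> h; split => // i j; rewrite (ord1 i); exact: h.
Qed.

(** A ball of the library norm is a cube of side 2 r, that is, an interval times a ball of one
    dimension less. *)
Lemma lebesgue_ball n (x : 'rV[R]_n) (r : R) : 0 < r ->
  lebesgue_borelRn R n (ball x r) = ((r *+ 2) ^+ n)%:E.
Proof.
move=> r0; elim: n x => [|n IH] x.
  rewrite /= expr0 diracE mem_set// ball_rVE// => -[].
  by case.
have -> : lebesgue_borelRn R n.+1 (ball x r) =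
    (@lebesgue_measure R \x lebesgue_borelRn R n)%E (ball (uncons_rV x).1 r `*` ball (uncons_rV x).2 r).
  rewrite /= /lebesgue_step /pushforward; congr (product_measure1 _ _ _).
  rewrite !ball_rVE//; apply/seteqP; split => -[t y] /=.
    move=> h; split; first by have := h ord0; rewrite mxE; case: splitP => // j _; rewrite mxE (ord1 j) eqxx mulr1n.
    move=> i; have := h (lift ord0 i); rewrite !mxE; case: splitP => [j|j /= /eqP].
      by rewrite (ord1 j).
    by rewrite eqSS => /eqP ij; rewrite (_ : i = j)//; exact/val_inj.
  move=> [h1 h2] i; rewrite mxE; case: splitP => j ij.
    by rewrite mxE (ord1 j) eqxx mulr1n (_ : i = ord0)//; apply/val_inj; rewrite /= ij (ord1 j).
  have := h2 j; rewrite mxE (_ : lift ord0 j = i)//.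
  by apply/val_inj => /=; rewrite ij.
rewrite product_measure1E ?IH//; last 2 first.
- exact: measurable_ball.
- by apply: measurable_open_borelRn; exact: ball_open.
by rewrite [X in (X * _)%E](@lebesgue_measure_ball R _ _ (ltW r0)) -EFinM exprS.
Qed.

End ball_measure.

Lemma continuous_bigsum {R : realType} (T : topologicalType) I (r : seq I)
    (f : I -> T -> R) :
  (forall i, continuous (f i)) -> continuous (fun x => \sum_(i <- r) f i x).
Proof.
move=> cf; elim: r => [|i r IH].
  by under eq_fun do rewrite big_nil; exact: cst_continuous.
under eq_fun do rewrite big_cons.
by move=> x; apply: cvgD; [exact: cf|exact: IH].
Qed.

(** * The Euclidean norm and its comparison with the sup norm *)

Section euclidean_norm.
Context {R : realType} {n : nat}.
Implicit Types x y : 'rV[R]_n.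

Lemma dotvC x y : dotv x y = dotv y x.
Proof. by apply: eq_bigr => i _; rewrite mulrC. Qed.

Lemma dotvDl x y z : dotv (x + y) z = dotv x z + dotv y z.
Proof. by rewrite -big_split/=; apply: eq_bigr => i _; rewrite !mxE mulrDl. Qed.

Lemma dotvZl (a : R) x y : dotv (a *: x) y = a * dotv x y.
Proof. by rewrite /dotv big_distrr/=; apply: eq_bigr => i _; rewrite !mxE mulrA. Qed.

Lemma dotvNl x y : dotv (- x) y = - dotv x y.
Proof. by rewrite -scaleN1r dotvZl mulN1r. Qed.

Lemma dotvv_ge0 x : 0 <= dotv x x.
Proof. by apply: sumr_ge0 => i _; rewrite -expr2 sqr_ge0. Qed.

Lemma enorm_ge0 x : 0 <= enorm x. Proof. exact: sqrtr_ge0. Qed.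

Lemma sqr_enorm x : enorm x ^+ 2 = dotv x x.
Proof. by rewrite sqr_sqrtr// dotvv_ge0. Qed.

Lemma ler_coord_enorm x (i : 'I_n) : `|x ord0 i| <= enorm x.
Proof.
rewrite -sqrtr_sqr ler_wsqrtr// /dotv (bigD1 i)//= -expr2 lerDl.
by apply: sumr_ge0 => j _; rewrite -expr2 sqr_ge0.
Qed.

Lemma ler_norm_enorm x : `|x| <= enorm x.
Proof.
rewrite [leLHS](mx_normrE x); apply/bigmax_leP; split; first exact: enorm_ge0.
by move=> [i j] _ /=; rewrite (ord1 i); exact: ler_coord_enorm.
Qed.

Lemma ler_coord_norm x (i : 'I_n) : `|x ord0 i| <= `|x|.
Proof.
rewrite [leRHS](mx_normrE x).
exact: (le_bigmax _ (fun ij : 'I_1 * 'I_n => `|x ij.1 ij.2|) (ord0, i)).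
Qed.

Lemma enorm_eq0 x : (enorm x == 0) = (x == 0).
Proof.
apply/idP/eqP => [/eqP x0|->]; last first.
  by rewrite /enorm /dotv big1 ?sqrtr0// => i _; rewrite mxE mul0r.
by apply/normr0_eq0/eqP; rewrite eq_le normr_ge0 andbT -x0 ler_norm_enorm.
Qed.

Lemma enorm0 : enorm (0 : 'rV[R]_n) = 0.
Proof. by apply/eqP; rewrite enorm_eq0. Qed.

Lemma enorm_gt0 x : (0 < enorm x) = (x != 0).
Proof. by rewrite lt_neqAle enorm_ge0 andbT eq_sym enorm_eq0. Qed.

Lemma enormZ (a : R) x : enorm (a *: x) = `|a| * enorm x.
Proof.
by rewrite /enorm dotvZl dotvC dotvZl mulrA -expr2 sqrtrM ?sqr_ge0// sqrtr_sqr.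
Qed.

Lemma enormN x : enorm (- x) = enorm x.
Proof. by rewrite -scaleN1r enormZ normrN1 mul1r. Qed.

Lemma enormB x y : enorm (x - y) = enorm (y - x).
Proof. by rewrite -enormN opprB. Qed.

Lemma cauchy_schwarz x y : `|dotv x y| <= enorm x * enorm y.
Proof.
suff H (a b : 'rV[R]_n) : dotv a b <= enorm a * enorm b.
  by rewrite ler_norml H andbT lerNl -dotvNl -(enormN x) H.
have [->|a0] := eqVneq a 0.
  by rewrite enorm0 mul0r /dotv big1// => i _; rewrite mxE mul0r.
have na : 0 < enorm a by rewrite enorm_gt0.
have [->|b0] := eqVneq b 0.
  by rewrite enorm0 mulr0 /dotv big1// => i _; rewrite mxE mulr0.
have nb : 0 < enorm b by rewrite enorm_gt0.
have := dotvv_ge0 (enorm b *: a - enorm a *: b).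
rewrite !(dotvDl, dotvNl, dotvZl, dotvC _ (_ + _), dotvC _ (_ *: _), dotvC _ (- _)).
rewrite -!sqr_enorm (dotvC b a) => h.
have : 0 <= (enorm a * enorm b) * (enorm a * enorm b - dotv a b) by lra.
by rewrite pmulr_rge0 ?mulr_gt0// subr_ge0.
Qed.

Lemma ler_enormD x y : enorm (x + y) <= enorm x + enorm y.
Proof.
rewrite -(ler_pXn2r (n := 2)) ?nnegrE ?addr_ge0 ?enorm_ge0//.
rewrite sqr_enorm dotvDl !(dotvC _ (x + y)) !dotvDl -!sqr_enorm sqrrD.
have := le_trans (ler_norm _) (cauchy_schwarz x y); rewrite (dotvC y x); lra.
Qed.

(** The constant [n] is a convenient upper bound for the square root of [n]; it is the origin of the
    factors n^n in the differentiation theorem. *)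
Lemma ler_enorm_norm x : enorm x <= n%:R * `|x|.
Proof.
rewrite -(ler_pXn2r (n := 2)) ?nnegrE ?mulr_ge0 ?enorm_ge0//.
rewrite sqr_enorm /dotv; apply: (@le_trans _ _ (\sum_(i < n) `|x| ^+ 2)).
  apply: ler_sum => i _; rewrite -expr2 -real_normK ?num_real//.
  by rewrite ler_pXn2r ?nnegrE// ler_coord_norm.
rewrite sumr_const card_ord -[leLHS]mulr_natl exprMn ler_wpM2r ?sqr_ge0//.
by rewrite -natrX ler_nat; case: n => // k; rewrite expnS expn1 leq_pmulr.
Qed.

Lemma continuous_dotvv : continuous (fun x : 'rV[R]_n => dotv x x).
Proof.
apply: continuous_bigsum => i x.
have ci := @coord_continuous R 1 n ord0 i.
exact: (cvgM (ci x) (ci x)).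
Qed.

Lemma continuous_enorm : continuous (@enorm R n).
Proof.
move=> x; apply: continuous_comp; first exact: continuous_dotvv.
exact: sqrt_continuous.
Qed.

Lemma open_eball x (r : R) : open (eball x r).
Proof.
rewrite (_ : eball x r = (fun y => enorm (y - x)) @^-1` [set t | t < r])//.
have /continuousP : continuous (fun y : 'rV[R]_n => enorm (y - x)).
  move=> y; apply: (@continuous_comp _ _ _ (fun y => y - x)).
    by apply: continuousB; [exact: cvg_id|exact: cst_continuous].
  exact: continuous_enorm.
by apply; exact: open_lt.
Qed.

Lemma eball_ball x (r : R) : eball x r `<=` ball x r.
Proof.
move=> y /= h; rewrite -ball_normE/= distrC.
exact: le_lt_trans (ler_norm_enorm _) h.
Qed.

Lemma ball_eball x (r : R) : ball x (r / n%:R) `<=` eball x r.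
Proof.
move=> y; rewrite -ball_normE/= => h.
apply: le_lt_trans (ler_enorm_norm _) _; rewrite distrC.
(* In dimension 0 the radius [r / n%:R] is 0 by the convention on inverses, and the ball is
   empty. *)
have [n0|n0] := posnP n; last by rewrite mulrC -ltr_pdivlMr ?ltr0n.
have n0' : n%:R = 0 :> R by rewrite n0.
move: h; rewrite n0' invr0 mulr0 => h.
by have := le_lt_trans (normr_ge0 _) h; rewrite ltxx.
Qed.

End euclidean_norm.

(** * The integrable majorant of the fractional kernels *)

Section kernel.
Context {R : realType} (n : nat) (alpha : R).
Hypotheses (n1 : (1 <= n)%N) (a01 : 0 < alpha < 1).
Local Notation lam := (lebesgue_borelRn R n).

(** A bounded Lipschitz function has increments of size min(1, |z|) up to a constant, so this is the
    common majorant of every kernel integral with a Lipschitz factor. It behaves like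
    |z|^-(n+alpha-1) near 0 and like |z|^-(n+alpha) at infinity. *)
Definition fkernel (z : 'rV[R]_n) : R :=
  Num.min 1 (enorm z) / enorm z `^ (n%:R + alpha).

Lemma fkernel_ge0 z : 0 <= fkernel z.
Proof. by rewrite divr_ge0 ?powR_ge0// le_min ler01 enorm_ge0. Qed.

Lemma measurable_fkernel : measurable_fun [set: borelRn R n] fkernel.
Proof.
apply: measurable_funM.
  by apply: measurable_minr => //; exact: measurable_enorm.
by apply: measurable_invr; apply: measurable_funpowR; exact: measurable_enorm.
Qed.

Let p := n%:R + alpha - 1.
Let p_gt0 : 0 < p.
Proof.
have n1' : (1 : R) <= n%:R by rewrite ler1n.
by case/andP: a01 => a0 _; rewrite /p; lra.
Qed.

Let powR2_lt1 (s : R) : s < 0 -> 2 `^ s < 1.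
Proof.
move=> s0; rewrite -(opprK s) powRN invf_lt1 ?powR_gt0//.
have h : 0 < - s by rewrite oppr_gt0.
have := @gt0_ltr_powR R (- s) h 1 2; rewrite !nnegrE powR1; apply => //.
by rewrite ltr1n.
Qed.

Lemma dyadic_bracket (y : R) : 1 <= y -> exists m : nat, 2 ^+ m <= y < 2 ^+ m.+1.
Proof.
move=> y1; have ex : exists m : nat, y < 2 ^+ m.
  have [k ky] : exists k : nat, y < k%:R by exists (Num.truncn y).+1; exact: truncnS_gt.
  by exists k; apply: lt_le_trans ky _; rewrite -natrX ler_nat ltnW// ltn_expl.
have [m ym mmin] := ex_minnP ex.
case: m ym mmin => [|m] ym mmin; first by move: ym; rewrite expr0 ltNge y1.
exists m; rewrite ym andbT leNgt; apply/negP => /mmin; by rewrite ltnn.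
Qed.

Let powRX (k : nat) (s : R) : (2 ^+ k) `^ s = (2 `^ s) ^+ k :> R.
Proof.
by rewrite -(powR_mulrn k (ler0n R 2)) -(powR_mulrn k (powR_ge0 2 s)) powRAC.
Qed.

(** [c m] bounds [fkernel] on the shell where the sup norm of z lies between 2^-(m+1) and 2^-m, and
    [d m] on the shell between 2^m and 2^(m+1). The shells are enlarged below to the full cubes
    [B m] and [C m], whose volumes are explicit. *)
Let c (m : nat) : R := (2 `^ p) ^+ m.+1.
Let d (m : nat) : R := (2 `^ (- (n%:R + alpha))) ^+ m.

Let inner z m : 2 ^+ m <= `|z|^-1 < 2 ^+ m.+1 -> z != 0 -> fkernel z <= c m.
Proof.
move=> /andP[_ zm] z0.
have ez : 0 < enorm z by rewrite enorm_gt0.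
rewrite /c -powRX; apply: (@le_trans _ _ ((enorm z)^-1 `^ p)).
  rewrite /fkernel ler_pdivrMr ?powR_gt0// -(powR_inv1 (ltW ez)) -powRrM -powRD; last first.
    by rewrite (gt_eqF ez) implybT.
  rewrite (_ : _ + _ = 1); first by rewrite (powRr1 (ltW ez)) ge_min lexx orbT.
  by rewrite /p; ring.
apply: ge0_ler_powR; rewrite ?nnegrE ?invr_ge0 ?enorm_ge0 ?exprn_ge0 ?(ltW p_gt0)//.
rewrite ltW// (le_lt_trans _ zm)// lef_pV2 ?posrE// ?normr_gt0//.
exact: ler_norm_enorm.
Qed.

Let outer z m : 2 ^+ m <= `|z| < 2 ^+ m.+1 -> fkernel z <= d m.
Proof.
move=> /andP[zm _].
have nz : 0 < `|z| by apply: lt_le_trans zm; rewrite exprn_gt0.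
have ez : 0 < enorm z by apply: lt_le_trans (ler_norm_enorm _).
rewrite /d -powRX powRN /fkernel ler_pdivrMr ?powR_gt0//.
apply: (@le_trans _ _ 1); first by rewrite ge_min lexx.
rewrite -ler_pdivrMl ?invr_gt0 ?powR_gt0 ?exprn_gt0// invrK mulr1.
apply: ge0_ler_powR; rewrite ?nnegrE ?exprn_ge0//; last first.
  exact: le_trans (ler_norm_enorm _).
- exact: enorm_ge0.
- by case/andP: a01 => a0 _; rewrite addr_ge0// ltW.
Qed.

Let B (m : nat) : set 'rV[R]_n := ball 0 (2 * 2^-1 ^+ m).
Let C (m : nat) : set 'rV[R]_n := ball 0 (2 ^+ m.+1).

Let fkernel_series z : ((fkernel z)%:E <=
  \sum_(m <oo) ((c m * \1_(B m) z)%:E + (d m * \1_(C m) z)%:E))%E.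
Proof.
have c0 m : 0 <= c m by rewrite exprn_ge0// powR_ge0.
have d0 m : 0 <= d m by rewrite exprn_ge0// powR_ge0.
have t0 m : (0 <= (c m * \1_(B m) z)%:E + (d m * \1_(C m) z)%:E)%E.
  by rewrite -EFinD lee_fin addr_ge0// mulr_ge0.
have [z0|z0] := eqVneq z 0.
  have -> : fkernel z = 0 by rewrite z0 /fkernel enorm0 (min_idPr _) ?ler01// mul0r.
  by apply: nneseries_ge0 => m _ _; exact: t0.
have nz : 0 < `|z| by rewrite normr_gt0.
suff [m hm] : exists m, ((fkernel z)%:E <= (c m * \1_(B m) z)%:E + (d m * \1_(C m) z)%:E)%E.
  apply: le_trans hm _.
  rewrite (nneseriesD1 (n := m))//.
  by rewrite leeDl// nneseries_ge0.
have [z1|z1] := leP 1 `|z|.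
  have [m hm] := dyadic_bracket z1; exists m.
  rewrite -EFinD lee_fin; apply: le_trans (outer hm) _.
  rewrite [\1_(C m) z]indicE mem_set ?mulr1; last first.
    by rewrite /C -ball_normE/= sub0r normrN; case/andP: hm.
  by rewrite lerDr mulr_ge0.
have : 1 <= `|z|^-1 by rewrite invf_ge1// ltW.
move=> /dyadic_bracket[m hm]; exists m.
rewrite -EFinD lee_fin; apply: le_trans (inner hm z0) _.
rewrite [\1_(B m) z]indicE mem_set ?mulr1; last first.
  rewrite /B -ball_normE/= sub0r normrN; case/andP: hm => hm _.
  rewrite exprVn; apply: (@le_lt_trans _ _ (2 ^+ m)^-1).
    by rewrite -[leLHS]invrK lef_pV2 ?posrE ?invr_gt0 ?exprn_gt0.
  by rewrite ltr_pMl ?ltr1n// invr_gt0 exprn_gt0.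
by rewrite lerDl mulr_ge0.
Qed.

Let geo (q K : R) : 0 <= K -> 0 <= q < 1 -> (\sum_(m <oo) (K * q ^+ m)%:E < +oo)%E.
Proof.
move=> K0 /andP[q0 q1].
suff h : (fun N => \sum_(0 <= m < N) (K * q ^+ m)%:E)%E @ \oo --> (K / (1 - q))%:E.
  by rewrite (cvg_lim _ h)// ltry.
have q1' : `|q| < 1 by rewrite ger0_norm.
rewrite (_ : (fun N => _) = EFin \o (fun N => \sum_(0 <= m < N) K * q ^+ m)); last first.
  by apply/funext => N /=; rewrite sumEFin.
by apply: cvg_EFin; [exact: nearW|exact: cvg_geometric_series].
Qed.

(** The cubes have volumes (4 / 2^m)^n and (4 2^m)^n, so the two dyadic series are geometric with
    ratios 2^(alpha-1) and 2^-alpha. Convergence at the origin is [alpha < 1], convergence at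
    infinity is [0 < alpha]. *)
Lemma integrable_fkernel : lam.-integrable setT (EFin \o fkernel).
Proof.
have c0 m : 0 <= c m by rewrite exprn_ge0// powR_ge0.
have d0 m : 0 <= d m by rewrite exprn_ge0// powR_ge0.
have mB m : measurable (B m : set (borelRn R n)).
  by apply: measurable_open_borelRn; exact: ball_open.
have mC m : measurable (C m : set (borelRn R n)).
  by apply: measurable_open_borelRn; exact: ball_open.
have mcB m : measurable_fun [set: borelRn R n] (fun z => (c m * \1_(B m) z)%:E).
  by apply/measurable_EFinP; apply: measurable_funM => //; exact: measurable_indic.
have mdC m : measurable_fun [set: borelRn R n] (fun z => (d m * \1_(C m) z)%:E).
  by apply/measurable_EFinP; apply: measurable_funM => //; exact: measurable_indic.
have mfk : measurable_fun [set: borelRn R n] (EFin \o fkernel).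
  by apply/measurable_EFinP; exact: measurable_fkernel.
apply/integrableP; split => //.
under eq_integral do rewrite /= ger0_norm ?fkernel_ge0//.
apply: (@le_lt_trans _ _ (\int[lam]_z \sum_(m <oo)
    ((c m * \1_(B m) z)%:E + (d m * \1_(C m) z)%:E))%E).
  apply: ge0_le_integral => //.
  - by move=> z _; rewrite lee_fin fkernel_ge0.
  - apply: ge0_emeasurable_sum => [m z _ _|m _]; last exact: emeasurable_funD.
    by rewrite -EFinD lee_fin addr_ge0// mulr_ge0.
rewrite integral_nneseries//; last 2 first.
  by move=> m; exact: emeasurable_funD.
  by move=> m z _; rewrite -EFinD lee_fin addr_ge0// mulr_ge0.
pose K1 : R := 2 `^ p * (4 ^+ n); pose q1 : R := 2 `^ (alpha - 1).
pose K2 : R := 4 ^+ n; pose q2 : R := 2 `^ (- alpha).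
have int1 m : (\int[lam]_z (c m * \1_(B m) z)%:E = (K1 * q1 ^+ m)%:E)%E.
  under eq_integral do rewrite EFinM.
  rewrite ge0_integralZl//; last 2 first.
  - by apply/measurable_EFinP; exact: measurable_indic.
  - by rewrite lee_fin.
  rewrite (_ : \int[lam]_z (\1_(B m) z)%:E = ((2 * 2^-1 ^+ m *+ 2) ^+ n)%:E)%E; last first.
    rewrite integral_indic// setIT; apply: lebesgue_ball.
    by rewrite mulr_gt0 ?exprn_gt0 ?invr_gt0.
  rewrite -EFinM; congr EFin; rewrite /c /K1 /q1 exprS -!mulrA; congr (_ * _).
  rewrite (_ : (2 * _ *+ 2) = 4 * 2^-1 ^+ m); last by ring.
  rewrite exprMn mulrCA; congr (_ * _).
  rewrite -exprM mulnC exprM -exprMn; congr (_ ^+ _).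
  rewrite exprVn -powR_mulrn// -powRN -powRD; last by rewrite pnatr_eq0 implybT.
  by congr (_ `^ _); rewrite /p; ring.
have int2 m : (\int[lam]_z (d m * \1_(C m) z)%:E = (K2 * q2 ^+ m)%:E)%E.
  under eq_integral do rewrite EFinM.
  rewrite ge0_integralZl//; last 2 first.
  - by apply/measurable_EFinP; exact: measurable_indic.
  - by rewrite lee_fin.
  rewrite (_ : \int[lam]_z (\1_(C m) z)%:E = ((2 ^+ m.+1 *+ 2) ^+ n)%:E)%E; last first.
    by rewrite integral_indic// setIT; apply: lebesgue_ball; rewrite exprn_gt0.
  rewrite -EFinM; congr EFin; rewrite /d /K2 /q2.
  rewrite (_ : (2 ^+ m.+1 *+ 2) = 4 * 2 ^+ m); last by rewrite exprS; ring.
  rewrite exprMn mulrCA; congr (_ * _).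
  rewrite -exprM mulnC exprM -exprMn; congr (_ ^+ _).
  rewrite -powR_mulrn// -powRD; last by rewrite pnatr_eq0 implybT.
  by congr (_ `^ _); ring.
have q11 : 0 <= q1 < 1.
  by case/andP: a01 => ? ?; rewrite powR_ge0/= powR2_lt1//; lra.
have q21 : 0 <= q2 < 1.
  by case/andP: a01 => ? ?; rewrite powR_ge0/= powR2_lt1//; lra.
have cB0 m z : [set: 'rV[R]_n] z -> (0 <= (c m * \1_(B m) z)%:E)%E.
  by move=> _; rewrite lee_fin mulr_ge0.
have dC0 m z : [set: 'rV[R]_n] z -> (0 <= (d m * \1_(C m) z)%:E)%E.
  by move=> _; rewrite lee_fin mulr_ge0.
rewrite (eq_eseriesr (g := fun m => ((K1 * q1 ^+ m)%:E + (K2 * q2 ^+ m)%:E)%E)); last first.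
  by move=> m _; rewrite ge0_integralD//; [rewrite int1 int2|exact: cB0|exact: dC0].
have K10 : 0 <= K1 by rewrite mulr_ge0 ?powR_ge0 ?exprn_ge0.
have K20 : 0 <= K2 by rewrite exprn_ge0.
rewrite nneseriesD; last 2 first.
- by move=> m _ _; rewrite lee_fin mulr_ge0// exprn_ge0// powR_ge0.
- by move=> m _ _; rewrite lee_fin mulr_ge0// exprn_ge0// powR_ge0.
by rewrite lte_add_pinfty// geo.
Qed.

End kernel.

(** * Outer regularity of finite measures *)

Section rational_balls.
Context {R : realType} {n : nat}.

Definition ratrV (c : {ffun 'I_n -> rat}) : 'rV[R]_n := \row_i ratr (c i).

Lemma ratrV_dense (x : 'rV[R]_n) (e : R) : 0 < e ->
  exists c : {ffun 'I_n -> rat}, enorm (ratrV c - x) < e.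
Proof.
(* Dividing by [n.+1] keeps [n%:R * d] strictly below [e], also when [n] is 0. *)
move=> e0; pose d := e / n.+1%:R.
have d0 : 0 < d by rewrite divr_gt0.
have /choice[q qx] : forall i : 'I_n, exists q : rat, `|ratr q - x ord0 i| < d.
  move=> i; have : x ord0 i < x ord0 i + d by rewrite ltrDl.
  move=> /rat_in_itvoo[q]; rewrite in_itv/= => /andP[q1 q2]; exists q.
  by rewrite gtr0_norm ?subr_gt0// ltrBlDl.
exists [ffun i => q i]; apply: le_lt_trans (ler_enorm_norm _) _.
have : `|ratrV [ffun i => q i] - x| <= d.
  rewrite [leLHS]mx_normrE; apply/bigmax_leP; split; first exact: ltW.
  by move=> [i j] _ /=; rewrite (ord1 i) !mxE ffunE ltW.
move=> /(ler_wpM2l (ler0n R n)) /le_lt_trans; apply.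
rewrite /d mulrCA gtr_pMr// ltr_pdivrMr// mul1r ltr_nat//.
Qed.

(** Together with [rat_radius] this enumerates the balls with rational centre and radius 1/(j+1).
    Integers that decode to nothing give the unit ball at 0, which is harmless. *)
Definition rat_center (k : nat) : 'rV[R]_n :=
  if unpickle k is Some p then ratrV (p : {ffun 'I_n -> rat} * nat).1 else 0.

Definition rat_radius (k : nat) : R :=
  if unpickle k is Some p then (p : {ffun 'I_n -> rat} * nat).2.+1%:R^-1 else 1.

Definition rat_ball (k : nat) : set 'rV[R]_n :=
  [set y | enorm (y - rat_center k) < rat_radius k].

Definition rat_cball (k : nat) : set 'rV[R]_n :=
  [set y | enorm (y - rat_center k) <= rat_radius k].

Lemma closed_rat_cball k : closed (rat_cball k).
Proof.
rewrite (_ : rat_cball _ = (fun y => enorm (y - rat_center k)) @^-1` [set t | (t <= rat_radius k)%R])//.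
apply: closed_comp => [y _|]; last exact: closed_le.
apply: (@continuous_comp _ _ _ (fun y : 'rV[R]_n => y - rat_center k)%R).
  by apply: continuousB; [exact: cvg_id|exact: cst_continuous].
exact: continuous_enorm.
Qed.

(** The inclusion in [U] is part of the set, which is empty if it fails; unions may then run over
    all integers [k]. *)
Definition rat_inner (U : set 'rV[R]_n) k : set 'rV[R]_n :=
  [set y | rat_cball k `<=` U /\ rat_cball k y].

Lemma closed_rat_inner U k : closed (rat_inner U k).
Proof.
have [kU|nkU] := pselect (rat_cball k `<=` U).
  rewrite (_ : rat_inner U k = rat_cball k); first exact: closed_rat_cball.
  by apply/seteqP; split => [y []|].
rewrite (_ : rat_inner U k = set0); first exact: closed0.
by rewrite -subset0 => y [].
Qed.

Lemma rat_radius_gt0 k : 0 < rat_radius k.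
Proof. by rewrite /rat_radius; case: unpickle => // p; rewrite invr_gt0. Qed.

Lemma rat_ball_basis (x : 'rV[R]_n) (e : R) : 0 < e ->
  exists2 k, rat_ball k x & rat_cball k `<=` eball x e.
Proof.
move=> e0; have [j je] : exists j : nat, j.+1%:R^-1 < e / 2.
  have e20 : 0 < e / 2 by rewrite divr_gt0.
  by have [N _ /(_ N (leqnn N))] := near_infty_natSinv_lt (PosNum e20); exists N.
have j0 : 0 < j.+1%:R^-1 :> R by rewrite invr_gt0.
have [c cx] := ratrV_dense x j0.
exists (pickle (c, j)).
  by rewrite /rat_ball/= /rat_center /rat_radius pickleK/= enormB.
move=> y; rewrite /rat_cball /eball/= /rat_center /rat_radius pickleK/= => yc.
rewrite -(subrKA (ratrV c)) (le_lt_trans (ler_enormD _ _))//.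
by rewrite (splitr e) ltrD// ?(le_lt_trans yc)// (lt_trans cx).
Qed.

Lemma open_rat_ball (U : set 'rV[R]_n) (x : 'rV[R]_n) : open U -> U x ->
  exists2 k, rat_ball k x & rat_cball k `<=` U.
Proof.
move=> oU Ux; have /nbhs_ballP[e /= e0 eU] : nbhs x U by exact: open_nbhs_nbhs.
have [k kx ke] := rat_ball_basis x e0; exists k => //.
by apply: subset_trans ke _; apply: subset_trans eU; exact: eball_ball.
Qed.

End rational_balls.

Section outer_regularity.
Local Open Scope ereal_scope.
Context {R : realType} {n : nat} (mu : {finite_measure set (borelRn R n) -> \bar R}).
Local Notation T := (borelRn R n).

(** Requiring a closed set inside as well as an open set outside makes the class stable under
    complements; it is then a sigma-algebra containing the open sets. *)
Let approximable (A : set T) := forall e : R, (0 < e)%R ->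
  exists U C : set 'rV[R]_n, [/\ open U, closed C, C `<=` A, A `<=` U &
    mu (U `\` C) < e%:E].

Let approximable_open (U : set 'rV[R]_n) : open U -> approximable U.
Proof.
move=> oU e e0.
pose C (m : nat) : set 'rV[R]_n :=
  \big[setU/set0]_(k < m) rat_inner U k.
have cC m : closed (C m).
  by rewrite /C; apply: big_ind => [|A B|k _]; [exact: closed0|exact: closedU|exact: closed_rat_inner].
have CU m : C m `<=` U.
  by move=> y; rewrite /C -bigcup_mkord => -[k _ [kU]]; exact: kU.
have mU : measurable (U : set T) by exact: measurable_open_borelRn.
have mC m : measurable (C m : set T) by exact: measurable_closed_borelRn.
have : mu \o (fun m => U `\` C m) @ \oo --> mu (\bigcap_m (U `\` C m)).
  apply: nonincreasing_cvg_mu.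
  - by rewrite ltey_eq fin_num_measure//; exact: measurableD.
  - by move=> m; exact: measurableD.
  - by apply: bigcapT_measurable => m; exact: measurableD.
  - move=> m p mp; apply/subsetPset; apply: setDS.
    move=> y; rewrite /C -!bigcup_mkord => -[k /= km ky].
    by exists k => //=; exact: leq_trans km mp.
rewrite (_ : \bigcap_m _ = set0); last first.
  rewrite -subset0 => y h; have [Uy _] := h 0%N I.
  have [k ky kU] := open_rat_ball oU Uy.
  have [_] := h k.+1 I; apply; rewrite /C -bigcup_mkord; exists k => //=.
  by split => //; exact: ltW.
rewrite measure0 => /fine_cvgP[_ /cvgrPdist_lt /(_ _ e0)[N _ /(_ N (leqnn N))]].
rewrite /= sub0r normrN => h; exists U, (C N); split => //.
have mUC : measurable ((U `\` C N) : set T) by exact: measurableD.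
rewrite -(fineK (fin_num_measure mu _ mUC)) lte_fin.
by apply: le_lt_trans h; exact: ler_norm.
Qed.

Let approximableC A : approximable A -> approximable (~` A).
Proof.
move=> aA e /aA[U [C [oU cC CA AU UC]]]; exists (~` C), (~` U); split.
- exact: closed_openC.
- exact: open_closedC.
- exact: subsetC.
- exact: subsetC.
- rewrite (_ : _ `\` _ = U `\` C)//; apply/seteqP; split => y /=.
    by move=> [? /contrapT].
  by move=> [? ?]; split => //; apply/not_notP.
Qed.

Let approximable_bigcup (A : (set T)^nat) : (forall k, approximable (A k)) ->
  approximable (\bigcup_k A k).
Proof.
move=> aA e e0.
have ek k : (0 < e / 2 / (2 ^+ k.+1))%R by rewrite !divr_gt0 ?exprn_gt0.
have /choice[U /choice[C HUC]] : forall k, exists U : set 'rV[R]_n, exists C : set 'rV[R]_n,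
   [/\ open U, closed C, C `<=` A k, A k `<=` U & mu (U `\` C) < (e / 2 / (2 ^+ k.+1))%:E].
  by move=> k; exact: aA (ek k).
have oU k : open (U k) by have [] := HUC k.
have cC k : closed (C k) by have [] := HUC k.
have mU k : measurable (U k : set T) by exact: measurable_open_borelRn.
have mC k : measurable (C k : set T) by exact: measurable_closed_borelRn.
pose V := \bigcup_k U k; pose B := \bigcup_k C k.
have mV : measurable (V : set T) by exact: bigcupT_measurable.
have mB : measurable (B : set T) by exact: bigcupT_measurable.
have mVB : measurable ((V `\` B) : set T) by exact: measurableD.
have VB : mu (V `\` B) <= (e / 2)%:E.
  apply: (@le_trans _ _ (mu (\bigcup_k (U k `\` C k)))).
    apply: le_measure; rewrite ?inE//.
      by apply: bigcupT_measurable => k; exact: measurableD.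
    by move=> y [[k _ Uk] nB]; exists k => //; split => // Ck; apply: nB; exists k.
  apply: (@le_trans _ _ (\sum_(k <oo) mu (U k `\` C k))).
    apply: measure_sigma_subadditive => //.
      by move=> k; exact: measurableD.
    by apply: bigcupT_measurable => k; exact: measurableD.
  apply: (@le_trans _ _ (\sum_(k <oo) (e / 2 / (2 ^+ k.+1))%:E)).
    by apply: lee_nneseries => // k _; apply: ltW; have [] := HUC k.
  have := @epsilon_trick R (fun _ => 0) (e / 2)%R xpredT (fun _ => lexx 0) (ltW (divr_gt0 e0 (ltr0n R 2))).
  rewrite [X in _ <= X + _](_ : _ = 0); last by rewrite eseries0.
  rewrite add0e; apply: le_trans.
  by apply: lee_nneseries => k _; rewrite ?add0e lee_fin ?natrX// ltW.
(* The countable union [B] of closed sets need not be closed. A finite union is, and continuity from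
   above of the finite measure makes the remainder smaller than the second half of [e]. *)
pose Cm m : set 'rV[R]_n := \big[setU/set0]_(k < m) C k.
have cCm m : closed (Cm m).
  by apply: big_ind => [|A1 A2|k _]; [exact: closed0|exact: closedU|exact: cC].
have mCm m : measurable (Cm m : set T) by exact: measurable_closed_borelRn.
have : mu \o (fun m => B `\` Cm m) @ \oo --> mu (\bigcap_m (B `\` Cm m)).
  apply: nonincreasing_cvg_mu.
  - by rewrite ltey_eq fin_num_measure//; exact: measurableD.
  - by move=> m; exact: measurableD.
  - by apply: bigcapT_measurable => m; exact: measurableD.
  - move=> m p mp; apply/subsetPset; apply: setDS.
    move=> y; rewrite /Cm -!bigcup_mkord => -[k /= km ky].
    by exists k => //=; exact: leq_trans km mp.
rewrite (_ : \bigcap_m _ = set0); last first.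
  rewrite -subset0 => y h; have [[k _ Ck] _] := h 0%N I.
  by have [_] := h k.+1 I; apply; rewrite /Cm -bigcup_mkord; exists k => /=.
have e20 : (0 < e / 2)%R by rewrite divr_gt0.
rewrite measure0 => /fine_cvgP[_ /cvgrPdist_lt /(_ _ e20)[N _ /(_ N (leqnn N))]].
rewrite /= sub0r normrN => h; exists V, (Cm N); split => //.
- by apply: bigcup_open => k _; exact: oU.
- move=> y; rewrite /Cm -bigcup_mkord => -[k _ Ck]; exists k => //.
  by have [_ _ + _ _] := HUC k; apply.
- by apply: subset_bigcup => k _; have [] := HUC k.
have mBC : measurable ((B `\` Cm N) : set T) by exact: measurableD.
apply: (@le_lt_trans _ _ (mu ((V `\` B) `|` (B `\` Cm N)))).
  apply: le_measure; rewrite ?inE//; [exact: measurableD|exact: measurableU|].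
  by move=> y [Vy nC]; have [By|nBy] := pselect (B y); [right|left].
apply: le_lt_trans (measureU2 _ _ _) _ => //.
rewrite [ltRHS](_ : _ = (e / 2)%:E + (e / 2)%:E); last by rewrite -EFinD -splitr.
rewrite lee_ltD//; first exact: fin_num_measure.
rewrite -(fineK (fin_num_measure mu _ mBC)) lte_fin.
by apply: le_lt_trans h; exact: ler_norm.
Qed.

Lemma outer_regularity (A : set T) (e : R) : measurable A -> (0 < e)%R ->
  exists U : set 'rV[R]_n, [/\ open U, A `<=` U & mu (U `\` A) < e%:E].
Proof.
move=> mA e0.
suff [U [C [oU cC CA AU UC]]] : exists U C : set 'rV[R]_n,
   [/\ open U, closed C, C `<=` A, A `<=` U & mu (U `\` C) < e%:E].
  exists U; split => //; apply: le_lt_trans UC; apply: le_measure; rewrite ?inE.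
  - by apply: measurableD => //; exact: measurable_open_borelRn.
  - by apply: measurableD; [exact: measurable_open_borelRn|exact: measurable_closed_borelRn].
  - exact: setDS.
move: A mA e e0; suff : <<s @open 'rV[R]_n >> `<=` approximable by move=> h A /h.
apply: smallest_sub; last by move=> U; exact: approximable_open.
split.
- exact/approximable_open/open0.
- by move=> A; rewrite setTD; exact: approximableC.
- exact: approximable_bigcup.
Qed.

End outer_regularity.

(** * Real-valued integrals and measures with a density *)

Section real_integrals.
Context d (T : measurableType d) (R : realType) (mu : {measure set T -> \bar R}).
Variables (D : set T) (mD : measurable D).

Lemma integrable_bigsum I (s : seq I) (f : I -> T -> R) :
  (forall i, mu.-integrable D (EFin \o f i)) ->
  mu.-integrable D (EFin \o (fun x => \sum_(i <- s) f i x)).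
Proof.
move=> fi; elim: s => [|i s IH].
  by apply: eq_integrable (integrable0 _ _) => // x _; rewrite /= big_nil.
apply: eq_integrable (integrableD mD (fi i) IH) => // x _.
by rewrite /= big_cons.
Qed.

Lemma Rintegral_bigsum I (s : seq I) (f : I -> T -> R) :
  (forall i, mu.-integrable D (EFin \o f i)) ->
  \int[mu]_(x in D) (\sum_(i <- s) f i x) = \sum_(i <- s) \int[mu]_(x in D) f i x.
Proof.
move=> fi; elim: s => [|i s IH].
  under eq_Rintegral do rewrite big_nil.
  by rewrite big_nil /Rintegral integral0.
rewrite big_cons -IH -RintegralD//; last exact: integrable_bigsum.
by apply: eq_Rintegral => x _; rewrite big_cons.
Qed.

Lemma EFin_Rintegral (f : T -> R) : mu.-integrable D (EFin \o f) ->
  (\int[mu]_(x in D) f x)%:E = (\int[mu]_(x in D) (f x)%:E)%E.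
Proof. by move=> fi; rewrite fineK//; exact: integrable_fin_num. Qed.

Lemma integrable_bounded_mul (f h : T -> R) (M : R) : measurable_fun D h ->
  (forall x, `|h x| <= M) -> mu.-integrable D (EFin \o f) ->
  mu.-integrable D (EFin \o (fun x => h x * f x)).
Proof.
move=> mh hM fi; apply: (@le_integrable _ _ _ mu D mD _ (fun x => M%:E * (f x)%:E)%E).
- apply/measurable_EFinP; apply: measurable_funM => //.
  by apply/measurable_EFinP; exact: measurable_int fi.
- move=> x _ /=; rewrite lee_fin !normrM ler_wpM2r//.
  by rewrite (le_trans (hM x))// ler_norm.
- exact: integrableZl.
Qed.

End real_integrals.

Lemma finite_bounded_integrable d (T : measurableType d) (R : realType)
    (mu : {finite_measure set T -> \bar R}) (h : T -> R) (M : R) :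
  measurable_fun setT h -> (forall x, `|h x| <= M) ->
  mu.-integrable setT (EFin \o h).
Proof.
move=> mh hM.
have /(integrable_bounded_mul (mu := mu) measurableT mh hM) : mu.-integrable setT (EFin \o cst 1).
  exact: finite_measure_integrable_cst.
by apply: eq_integrable => // x _; rewrite /= mulr1.
Qed.

Section density.
Local Open Scope ereal_scope.
Context d (T : measurableType d) (R : realType) (mu : {measure set T -> \bar R}).
Variable g : T -> R.

(** The proofs of integrability and positivity are arguments so that the structure of finite measure
    can be attached to the definition itself. *)
Definition density of mu.-integrable setT (EFin \o g) & (forall x, (0 <= g x)%R) :=
  fun A : set T => \int[mu]_(x in A) (g x)%:E.

Hypotheses (ig : mu.-integrable setT (EFin \o g)) (g0 : forall x, (0 <= g x)%R).

Let density0 : density ig g0 set0 = 0. Proof. exact: integral_set0. Qed.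

Let density_ge0 A : 0 <= density ig g0 A.
Proof. by apply: integral_ge0 => x _; rewrite lee_fin. Qed.

Let density_sigma_additive : semi_sigma_additive (density ig g0).
Proof.
apply: (semi_sigma_additive_nng_induced (f := EFin \o g)).
  exact: measurable_int ig.
by move=> x; rewrite lee_fin.
Qed.

HB.instance Definition _ := isMeasure.Build _ _ _ (density ig g0)
  density0 density_ge0 density_sigma_additive.

Let density_fin : fin_num_fun (density ig g0).
Proof.
move=> A mA; apply: integrable_fin_num => //.
exact: integrableS ig.
Qed.

HB.instance Definition _ := @Measure_isFinite.Build _ _ _ (density ig g0) density_fin.

End density.

Section integral_density.
Local Open Scope ereal_scope.
Context d (T : measurableType d) (R : realType) (mu nu : {measure set T -> \bar R}).
Variable g : T -> R.
Hypotheses (mg : measurable_fun setT g) (g0 : forall x, (0 <= g x)%R).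
Hypothesis nuE : forall A, measurable A -> nu A = \int[mu]_(x in A) (g x)%:E.

Lemma integral_density (f : T -> R) : measurable_fun setT f ->
  \int[nu]_x (f x)%:E = \int[mu]_x (f x * g x)%:E.
Proof.
move=> mf; have mf' : measurable_fun setT (EFin \o f) by exact/measurable_EFinP.
rewrite integralE [RHS]integralE; congr (_ - _).
- rewrite (ge0_integral_density mg g0 nuE)//; last exact: measurable_funepos.
  apply: eq_integral => x _; rewrite !funeposE -!EFin_max -EFinM; congr EFin.
  by rewrite maxr_pMl// mul0r.
- rewrite (ge0_integral_density mg g0 nuE)//; last exact: measurable_funeneg.
  apply: eq_integral => x _; rewrite !funenegE -!EFin_max -EFinM; congr EFin.
  by rewrite maxr_pMl// mul0r mulNr.
Qed.

End integral_density.

(** * Vector measures and total variation *)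

Section charge_integral_theory.
Context {R : realType} {n : nat}.
Local Notation T := (borelRn R n).
Implicit Types (D : {charge set T -> \bar R}) (f : 'rV[R]_n -> R).

(** Any representation of [D] as a difference of finite measures computes the integral. Moving the
    negative parts across gives pos + m2 = neg + m1, an identity between positive measures, which
    can be integrated and rearranged since [f] is bounded. *)
Lemma charge_integral_diff D (m1 m2 : {finite_measure set T -> \bar R}) f (M : R) :
  (forall A, measurable A -> D A = (m1 A - m2 A)%E) ->
  measurable_fun [set: T] f -> (forall x, `|f x| <= M) ->
  charge_integral D f = \int[m1]_x f x - \int[m2]_x f x.
Proof.
move=> DE mf fM; rewrite /charge_integral.
set hN := projT2 (cid (projT2 (cid (Hahn_decomposition D)))).
set pos := jordan_pos hN; set neg := jordan_neg hN.
have fi (m : {finite_measure set T -> \bar R}) : m.-integrable setT (EFin \o f).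
  exact: (@finite_bounded_integrable _ T R m f M mf fM).
have E A : measurable A -> measure_add pos m2 A = measure_add neg m1 A.
  move=> mA; rewrite !measure_addE.
  have := jordan_decomp hN mA; rewrite DE//.
  rewrite /cadd/= /cscale -/pos -/neg.
  rewrite -(fineK (fin_num_measure m1 A mA)) -(fineK (fin_num_measure m2 A mA)).
  rewrite -[X in _ = (X + _)%E -> _](fineK (fin_num_measure pos A mA)).
  rewrite -[X in _ = (_ + _ * X)%E -> _](fineK (fin_num_measure neg A mA)).
  rewrite -[X in _ -> (X + _)%E = _](fineK (fin_num_measure pos A mA)).
  rewrite -[X in _ -> _ = (X + _)%E](fineK (fin_num_measure neg A mA)).
  rewrite -!EFinM -EFinB -!EFinD => -[h]; congr EFin.
  by move: h; clear; lra.
have := @eq_setfun_integral _ T R _ _ setT (EFin \o f) E.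
rewrite integral_measure_add//; [|exact: fi|exact: fi].
rewrite integral_measure_add//; [|exact: fi|exact: fi].
rewrite -!EFin_Rintegral//; [|exact: fi|exact: fi|exact: fi|exact: fi].
rewrite -!EFinD => -[].
move: (Rintegral pos _ _) (Rintegral neg _ _) (Rintegral m1 _ _) (Rintegral m2 _ _).
by clear; move=> a b c e h; lra.
Qed.

Lemma charge_integral_density D (mu : {measure set T -> \bar R}) (g : T -> R) f (M : R) :
  mu.-integrable setT (EFin \o g) ->
  (forall A, measurable A -> D A = (\int[mu]_(x in A) (g x)%:E)%E) ->
  measurable_fun [set: T] f -> (forall x, `|f x| <= M) ->
  charge_integral D f = \int[mu]_x (f x * g x).
Proof.
move=> ig DE mf fM.
have igp : mu.-integrable setT (EFin \o g^\+) by exact: integrable_funrpos.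
have ign : mu.-integrable setT (EFin \o g^\-) by exact: integrable_funrneg.
have mg : measurable_fun setT g by apply/measurable_EFinP; exact: measurable_int ig.
have mgp : measurable_fun setT g^\+ by exact: measurable_funrpos.
have mgn : measurable_fun setT g^\- by exact: measurable_funrneg.
have gp0 x : 0 <= g^\+ x by [].
have gn0 x : 0 <= g^\- x by [].
have DE' A : measurable A -> D A = (density igp gp0 A - density ign gn0 A)%E.
  move=> mA; rewrite DE// /density -integralB_EFin//; last 2 first.
  - exact: integrableS igp.
  - exact: integrableS ign.
  by apply: eq_integral => x _; rewrite -EFinB; congr EFin; rewrite -[in LHS](funrposBneg g).
rewrite (charge_integral_diff DE' mf fM).
transitivity (\int[mu]_x (f x * g^\+ x) - \int[mu]_x (f x * g^\- x)).
  congr (_ - _); congr fine.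
    exact: (@integral_density _ T R mu (density igp gp0) _ mgp gp0).
  exact: (@integral_density _ T R mu (density ign gn0) _ mgn gn0).
rewrite -RintegralB//; last 2 first.
- exact: (integrable_bounded_mul _ mf fM).
- exact: (integrable_bounded_mul _ mf fM).
by apply: eq_Rintegral => x _; rewrite -mulrBr; congr (_ * _); rewrite -[in RHS](funrposBneg g).
Qed.

End charge_integral_theory.

(** * Total variation of a vector measure with density *)

Section total_variation.
Context {R : realType} {n : nat} (mu : {measure set (borelRn R n) -> \bar R}).
Local Notation T := (borelRn R n).
Variables (D : vmeasure R n) (g : 'rV[R]_n -> 'rV[R]_n).
Hypothesis ig : forall i, mu.-integrable [set: T] (fun x => (g x ord0 i)%:E).
Hypothesis DE : forall i (A : set T), measurable A ->
  D i A = (\int[mu]_(x in A) (g x ord0 i)%:E)%E.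

Let mg : measurable_fun [set: T] (g : T -> T).
Proof.
by apply: measurable_fun_rV => i; apply/measurable_EFinP; exact: measurable_int (ig i).
Qed.

Lemma integrable_enorm : mu.-integrable [set: T] (fun x => (enorm (g x))%:E).
Proof.
apply: (@le_integrable _ _ _ mu setT measurableT _
  (EFin \o (fun x => n%:R * \sum_(i < n) `|g x ord0 i|))).
- by apply/measurable_EFinP; exact: measurable_enorm.
- move=> x _; rewrite lee_fin (ger0_norm (enorm_ge0 _)) ger0_norm; last first.
    by rewrite mulr_ge0// sumr_ge0.
  apply: le_trans (ler_enorm_norm _) _; rewrite ler_wpM2l//.
  rewrite [leLHS]mx_normrE; apply/bigmax_leP; split; first by rewrite sumr_ge0.
  by move=> [i j] _ /=; rewrite (ord1 i) (bigD1 j)//= lerDl sumr_ge0.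
- under [X in _.-integrable _ X]eq_fun do rewrite /= EFinM.
  apply: integrableZl => //; apply: integrable_bigsum => // i.
  exact: (@integrable_norm _ T R mu setT (fun x => g x ord0 i) (ig i)).
Qed.

Let igA i (A : set T) : measurable A -> mu.-integrable A (EFin \o (fun x => g x ord0 i)).
Proof. by move=> mA; exact: integrableS (ig i). Qed.

Let dotv_vmeasure (u : 'rV[R]_n) (A : set T) : measurable A ->
  dotv u (vmeasure_val D A) = \int[mu]_(x in A) dotv u (g x).
Proof.
move=> mA; rewrite /dotv Rintegral_bigsum//; last first.
  move=> i; under [X in _.-integrable _ X]eq_fun do rewrite /= EFinM.
  by apply: integrableZl => //; exact: igA.
apply: eq_bigr => i _; rewrite mxE DE// RintegralZl//; exact: igA.
Qed.

Let integrable_dotv (u : 'rV[R]_n) (A : set T) : measurable A ->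
  mu.-integrable A (EFin \o (fun x => dotv u (g x))).
Proof.
move=> mA; apply: integrable_bigsum => // i.
under [X in _.-integrable _ X]eq_fun do rewrite /= EFinM.
by apply: integrableZl => //; exact: igA.
Qed.

Let ieA (A : set T) : measurable A -> mu.-integrable A (EFin \o (fun x => enorm (g x))).
Proof. by move=> mA; exact: integrableS integrable_enorm. Qed.

Let enorm_vmeasure (A : set T) : measurable A ->
  enorm (vmeasure_val D A) <= \int[mu]_(x in A) enorm (g x).
Proof.
move=> mA; set v := vmeasure_val D A.
have [v0|v0] := eqVneq (enorm v) 0.
  by rewrite v0; apply: Rintegral_ge0 => x _; exact: enorm_ge0.
have v_gt0 : 0 < enorm v by rewrite lt_neqAle eq_sym v0 enorm_ge0.
(* Pairing [v] with itself gives |v|^2 as the integral of v . g, and Cauchy-Schwarz applies under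
   the integral. *)
rewrite -(ler_pM2l v_gt0) -expr2 sqr_enorm {2}/v dotv_vmeasure// -RintegralZl//; last exact: ieA.
apply: le_Rintegral => //; first exact: integrable_dotv.
  under [X in _.-integrable _ X]eq_fun do rewrite /= EFinM.
  by apply: integrableZl => //; exact: ieA.
by move=> x _; exact: le_trans (ler_norm _) (cauchy_schwarz _ _).
Qed.

(** The direction of [v] is shrunk by 1 - e/2 before rational approximation with error e/2: the
    approximant stays in the unit ball, and the two losses add up to e |v|. *)
Let dir (v : 'rV[R]_n) (e : R) : 0 < e < 1 -> exists c : {ffun 'I_n -> rat},
  enorm (ratrV c : 'rV[R]_n) <= 1 /\ (1 - e) * enorm v <= dotv (ratrV c) v.
Proof.
move=> /andP[e0 e1]; have [->|v0] := eqVneq v 0.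
  exists [ffun => 0]; rewrite (_ : ratrV _ = 0); last first.
    by apply/rowP => i; rewrite !mxE ffunE rmorph0.
  by rewrite enorm0 ler01 mulr0 /dotv big1// => i _; rewrite mxE mul0r.
have nv : 0 < enorm v by rewrite enorm_gt0.
have e20 : 0 < e / 2 by rewrite divr_gt0.
pose w := ((1 - e / 2) / enorm v) *: v.
have [c cw] := ratrV_dense w e20; exists c.
have nw : enorm w = 1 - e / 2.
  rewrite /w enormZ normrM normfV (ger0_norm (enorm_ge0 v)) divfK ?gt_eqF//.
  by rewrite ger0_norm//; lra.
have -> : ratrV c = (ratrV c - w) + w by rewrite subrK.
split; first by apply: le_trans (ler_enormD _ _) _; rewrite nw; lra.
have dw : dotv w v = (1 - e / 2) * enorm v.
  by rewrite /w dotvZl -sqr_enorm expr2 mulrA divfK ?gt_eqF.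
rewrite dotvDl dw.
have := cauchy_schwarz (ratrV c - w) v; rewrite ler_norml => /andP[h _].
have h2 : enorm (ratrV c - w) * enorm v <= e / 2 * enorm v by rewrite ler_pM2r// ltW.
set d := dotv (_ - _) v in h *.
set X := enorm (_ - _) * enorm v in h h2; set Y := enorm v in h2 *.
nra.
Qed.

Let ratseq (k : nat) : 'rV[R]_n :=
  if unpickle k is Some c then ratrV (c : {ffun 'I_n -> rat}) else 0.

(** The upper bound holds on each piece of each partition. For the lower bound, [A] is partitioned
    by the first rational vector of norm at most 1 that nearly realizes |g| by duality; on such a
    piece the vector can be taken out of the integral. *)
Lemma total_variation_density (A : set T) : measurable A ->
  vtotal_variation D A = (\int[mu]_(x in A) (enorm (g x))%:E)%E.
Proof.
move=> mA; apply/eqP; rewrite eq_le; apply/andP; split.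
  apply: ge_ereal_sup => _ [F [mF tF UF] <-].
  rewrite -UF ge0_integral_bigcup//; last 2 first.
  - by apply: measurable_funTS; exact: measurable_int integrable_enorm.
  - by move=> x _; rewrite lee_fin enorm_ge0.
  apply: lee_nneseries => k _; first by rewrite lee_fin enorm_ge0.
  by rewrite -EFin_Rintegral ?lee_fin//; [exact: enorm_vmeasure|exact: ieA].
set I := (X in (X <= _)%E).
have [r I0 IE] : exists2 r : R, 0 <= r & I = r%:E.
  exists (\int[mu]_(x in A) enorm (g x)).
    by apply: Rintegral_ge0 => x _; exact: enorm_ge0.
  by rewrite /I EFin_Rintegral//; exact: ieA.
suff H e : 0 < e < 1 -> (((1 - e) * r)%:E <= vtotal_variation D A)%E.
  rewrite IE; apply/lee_addgt0Pr => e e0.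
  (* Chosen so that e' r <= e with e' < 1, including the case r = 0. *)
  pose e' := Num.min (2^-1) (e / (r + 1)).
  have r1 : 0 < r + 1 by lra.
  have e'0 : 0 < e' by rewrite lt_min invr_gt0 ltr0n divr_gt0.
  have e'1 : e' < 1 by rewrite gt_min invf_lt1// ltr1n.
  have := H e'; rewrite e'0 e'1 => /(_ isT) h.
  rewrite -leeBlDr// -EFinB; apply: le_trans h; rewrite lee_fin mulrBl mul1r lerB//.
  apply: (@le_trans _ _ (e / (r + 1) * r)).
    by rewrite ler_wpM2r// ge_min lexx orbT.
  rewrite mulrAC ler_pdivrMr//; nra.
move=> e01; pose G k := A `&` [set x | enorm (ratseq k) <= 1 /\
  (1 - e) * enorm (g x) <= dotv (ratseq k) (g x)].
have mG k : measurable (G k : set T).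
  apply: measurableI => //.
  have [c1|c1] := pselect (enorm (ratseq k) <= 1); last first.
    rewrite (_ : [set _ | _] = set0)//; by rewrite -subset0 => x [].
  rewrite (_ : [set x | _] = [set x | (1 - e) * enorm (g x) <= dotv (ratseq k) (g x)]); last first.
    by apply/seteqP; split => [x []|x /= ->].
  rewrite -[X in measurable X]setTI; apply: measurable_fun_ler => //.
    by apply: measurable_funM => //; exact: measurable_enorm.
  exact: measurable_dotv.
pose F := seqDU G.
have mF k : measurable (F k : set T).
  by rewrite /F /seqDU; apply: measurableD => //; exact: bigsetU_measurable.
have UF : \bigcup_k F k = A.
  rewrite /F -seqDU_bigcup_eq; apply/seteqP; split => [x [k _ []]//|x Ax].
  have [c [c1 c2]] := dir (g x) e01; exists (pickle c) => //; split => //=.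
  by rewrite /ratseq pickleK.
apply: (@le_trans _ _ (\sum_(0 <= k <oo) (enorm (vmeasure_val D (F k)))%:E)%E); last first.
  by apply: ereal_sup_ubound; exists F => //; split => //; exact: trivIset_seqDU.
have -> : ((1 - e) * r)%:E = (\sum_(0 <= k <oo) ((1 - e)%:E * \int[mu]_(x in F k) (enorm (g x))%:E))%E.
  rewrite EFinM -IE /I -{1}UF ge0_integral_bigcup//; last 3 first.
  - by apply: measurable_funTS; exact: measurable_int integrable_enorm.
  - by move=> x _; rewrite lee_fin enorm_ge0.
  - exact: trivIset_seqDU.
  rewrite nneseriesZl// => k _.
  by apply: integral_ge0 => x _; rewrite lee_fin enorm_ge0.
case/andP: (e01) => e0 e1.
apply: lee_nneseries => k _.
  rewrite mule_ge0//; first by rewrite lee_fin subr_ge0 ltW.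
  by apply: integral_ge0 => x _; rewrite lee_fin enorm_ge0.
rewrite -EFin_Rintegral//; last exact: ieA.
rewrite -EFinM lee_fin.
have [c1|c1] := pselect (enorm (ratseq k) <= 1); last first.
  rewrite (_ : F k = set0) ?Rintegral_set0 ?mulr0 ?enorm_ge0//.
  by rewrite -subset0 => x [[_ []]].
apply: (@le_trans _ _ (dotv (ratseq k) (vmeasure_val D (F k)))).
  rewrite dotv_vmeasure// -RintegralZl//; last exact: ieA.
  apply: le_Rintegral => //; last by move=> x [[_ []]].
    under [X in _.-integrable _ X]eq_fun do rewrite /= EFinM.
    by apply: integrableZl => //; exact: ieA.
  exact: integrable_dotv.
apply: le_trans (ler_norm _) _; apply: le_trans (cauchy_schwarz _ _) _.
by rewrite ler_piMl// enorm_ge0.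
Qed.

End total_variation.

(** * Smooth test functions *)

Section directional_derivative.
Context {R : realType} {V : normedModType R}.
Implicit Types (f : V -> R) (x v : V).

(** Restriction to a line turns directional derivatives into ordinary ones, to which the
    one-variable chain rule and mean value theorem apply. *)
Lemma is_derive_line f x v (t df : R) :
  is_derive (t *: v + x) v f df <-> is_derive (t : R) 1 (fun h : R => f (h *: v + x)) df.
Proof.
pose q1 := fun h : R => h^-1 *: ((f \o shift (t *: v + x)) (h *: v) - f (t *: v + x)).
pose q2 := fun h : R => h^-1 *: (((fun h : R => f (h *: v + x)) \o shift t) (h *: 1) - f (t *: v + x)).
have E : q1 = q2.
  apply/funext => h; rewrite /q1 /q2 /=; congr (_ *: (f _ - _)).
  by rewrite addrA -scalerDl [h *: 1]mulr1.
split=> -[d1 d2]; apply: DeriveDef.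
- by move: d1; rewrite /derivable -/q1 E.
- by rewrite -d2 /derive -/q1 E.
- by move: d1; rewrite /derivable -/q2 -E.
- by rewrite -d2 /derive -/q2 -E.
Qed.

Lemma is_derive_chain f (h : R -> R) x v (df dh : R) :
  is_derive x v f df -> is_derive (f x) 1 h dh ->
  is_derive x v (fun y => h (f y)) (dh * df).
Proof.
move=> fx hx; have x0 : 0 *: v + x = x by rewrite scale0r add0r.
rewrite -x0; apply/(is_derive_line (fun y => h (f y))).
rewrite -x0 in fx; move/is_derive_line : fx => fx.
apply: (@is_derive1_comp _ h (fun h : R => f (h *: v + x))).
by rewrite x0.
Qed.

End directional_derivative.

(** * Flat functions and smooth bumps *)

Section flat_functions.
Context {R : realType}.

(** The negative power is carried along because the derivative of t^-k exp(-1/t) is a combination of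
    the same functions of indices k+1 and k+2. The family is thus closed under differentiation, also
    across 0. *)
Definition flat (k : nat) (t : R) : R :=
  if 0 < t then t^-1 ^+ k * expR (- t^-1) else 0.

Lemma flat_ge0 k t : 0 <= flat k t.
Proof.
by rewrite /flat; case: ifPn => // t0; rewrite mulr_ge0 ?expR_ge0// exprn_ge0// invr_ge0 ltW.
Qed.

Lemma flat0_gt0 t : (0 < flat 0 t) = (0 < t).
Proof. by rewrite /flat; case: ifPn; rewrite ?ltxx// expr0 mul1r expR_gt0. Qed.

(** One term of the exponential series, exp(s) >= s^(k+1)/(k+1)! at s = 1/t, already beats t^-k with
    a factor t to spare. *)
Let flat_ub k (t : R) : 0 < t -> flat k t <= k.+1`!%:R * t.
Proof.
move=> t0; rewrite /flat t0 expRN.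
have ti : 0 < t^-1 by rewrite invr_gt0.
have := @expR_ge1Dxn R t^-1 k (ltW ti) => h.
have h' : t^-1 ^+ k.+1 / k.+1`!%:R <= expR t^-1 by apply: le_trans h; rewrite lerDr.
rewrite ler_pdivrMr ?expR_gt0//.
have f0 : 0 < k.+1`!%:R :> R by rewrite ltr0n fact_gt0.
move: h'; rewrite ler_pdivrMr// exprS => h'.
rewrite -(ler_pM2l ti); apply: le_trans h' _.
rewrite (_ : t^-1 * _ = (t^-1 * t) * (expR t^-1 * k.+1`!%:R)); last by ring.
by rewrite mulVf ?gt_eqF// mul1r.
Qed.

Let is_derive_flat_gt0 k (t : R) : 0 < t ->
  is_derive t 1 (fun s : R => s^-1 ^+ k * expR (- s^-1))
    (t^-1 ^+ k.+2 * expR (- t^-1) - k%:R * (t^-1 ^+ k.+1 * expR (- t^-1))).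
Proof.
move=> t0; have tn0 : t != 0 by rewrite gt_eqF.
have dV : is_derive t 1 (fun s : R => s^-1) (- t^-1 ^+ 2).
  apply: is_derive_eq (is_deriveV tn0 (is_derive_id t 1)) _.
  by rewrite [_ *: _]mulr1 exprVn.
elim: k => [|k IH].
  have dE : is_derive t 1 (fun s : R => expR (- s^-1)) (expR (- t^-1) * (t^-1 ^+ 2)).
    apply: is_derive_eq (@is_derive1_comp R expR (fun s : R => - s^-1) t _ _
      (is_derive_expR _) (is_deriveN dV)) _.
    by rewrite opprK.
  rewrite (_ : (fun s : R => _) = (fun s => expR (- s^-1))); last first.
    by apply/funext => s; rewrite expr0 mul1r.
  by apply: is_derive_eq dE _; rewrite mul0r subr0 mulrC.
rewrite (_ : (fun s : R => _) = (fun s : R => s^-1) * (fun s => s^-1 ^+ k * expR (- s^-1))); last first.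
  by apply/funext => s /=; rewrite exprS -mulrA.
apply: is_derive_eq (is_deriveM dV IH) _.
rewrite /GRing.scale/= -natr1 !exprS; ring.
Qed.

Lemma is_derive_flat k (t : R) :
  is_derive t 1 (flat k) (flat k.+2 t - k%:R * flat k.+1 t).
Proof.
have [t0|t0|->] := ltgtP t 0.
- rewrite /flat (lt_gtF t0) mulr0 subr0.
  apply: near_eq_is_derive (is_derive_cst 0 t 1).
  near=> s; rewrite ifN// -leNgt; apply: ltW.
  by near: s; exact: lt_nbhsl.
- rewrite /flat t0; apply: near_eq_is_derive (is_derive_flat_gt0 k t0).
  near=> s; rewrite (_ : 0 < s)//.
  by near: s; exact: lt_nbhsr.
have E m : flat m 0 = 0 by rewrite /flat ltxx.
rewrite !E mulr0 subr0.
suff h : (fun h : R => h^-1 *: ((flat k \o shift 0) (h *: 1) - flat k 0)) @ 0^' --> (0 : R).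
  by apply: DeriveDef; [apply/cvg_ex; exists 0|exact/cvg_lim].
apply/cvgrPdist_lt => e e0.
have c0 : 0 < k.+2`!%:R :> R by rewrite ltr0n fact_gt0.
near=> h; rewrite /= addr0 E subr0 sub0r normrN [h *: 1]mulr1.
have hn0 : h != 0 by near: h; exact: nbhs_dnbhs_neq.
have [h0|h0] := ltP 0 h; last by rewrite /flat (le_gtF h0) scaler0 normr0.
(* The difference quotient at 0 is itself a flat function of the next index, so the linear bound on
   [flat k.+1] sends it to 0. *)
have -> : h^-1 *: flat k h = flat k.+1 h by rewrite /flat h0 exprS -mulrA.
rewrite ger0_norm ?flat_ge0//; apply: le_lt_trans (flat_ub _ h0) _.
rewrite mulrC -ltr_pdivlMr// -[ltLHS]ger0_norm ?ltW//.
near: h; apply: dnbhs0_lt.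
by rewrite divr_gt0.
Unshelve. all: by end_near. Qed.

Lemma continuous_flat k : continuous (flat k).
Proof.
move=> t; apply: differentiable_continuous; apply/derivable1_diffP.
by have [] := is_derive_flat k t.
Qed.

End flat_functions.

Section smooth_functions.
Context {R : realType} {n : nat}.

(* A class of smooth functions rich enough for bumps and stable under partial
   derivatives. *)
Inductive smooth : ('rV[R]_n -> R) -> Prop :=
| smooth_cst c : smooth (fun _ => c)
| smooth_coord i : smooth (fun x => x ord0 i)
| smooth_add f g : smooth f -> smooth g -> smooth (fun x => f x + g x)
| smooth_mul f g : smooth f -> smooth g -> smooth (fun x => f x * g x)
| smooth_exp f : smooth f -> smooth (fun x => expR (f x))
| smooth_flat k f : smooth f -> smooth (fun x => flat k (f x)).

Lemma smooth_sum I (s : seq I) (f : I -> 'rV[R]_n -> R) :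
  (forall i, smooth (f i)) -> smooth (fun x => \sum_(i <- s) f i x).
Proof.
move=> sf; elim: s => [|i s IH].
  by under eq_fun do rewrite big_nil; exact: smooth_cst.
by under eq_fun do rewrite big_cons; exact: smooth_add.
Qed.

Lemma smooth_translate f v : smooth f -> smooth (fun x => f (x + v)).
Proof.
elim => {f}[c|i|f g _ sf _ sg|f g _ sf _ sg|f _ sf|k f _ sf].
- exact: smooth_cst.
- rewrite (_ : (fun x => _) = (fun x : 'rV[R]_n => x ord0 i + v ord0 i)).
    by apply: smooth_add; [exact: smooth_coord|exact: smooth_cst].
  by apply/funext => x; rewrite mxE.
- exact: smooth_add.
- exact: smooth_mul.
- exact: (smooth_exp sf).
- exact: (smooth_flat k sf).
Qed.

Lemma smooth_derive f : smooth f -> continuous f /\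
  forall i : 'I_n, exists2 g, smooth g & forall x, is_derive x (basisv i) f (g x).
Proof.
elim => {f}[c|j|f g sf [cf df] sg [cg dg]|f g sf [cf df] sg [cg dg]|f sf [cf df]|k f sf [cf df]].
- split; first exact: cst_continuous.
  by move=> i; exists (fun _ => 0) => [|x]; [exact: smooth_cst|exact: is_derive_cst].
- split; first exact: coord_continuous.
  move=> i; exists (fun _ => (basisv i : 'rV[R]_n) ord0 j) => [|x]; first exact: smooth_cst.
  have x0 : 0 *: basisv i + x = x by rewrite scale0r add0r.
  rewrite -x0; apply/(is_derive_line (fun x : 'rV[R]_n => x ord0 j)).
  rewrite (_ : (fun h : R => _) = (fun h => h * (basisv i : 'rV[R]_n) ord0 j) + cst (x ord0 j)); last first.
    by apply/funext => h; rewrite !mxE.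
  rewrite -[X in is_derive _ _ _ X]addr0; apply: is_deriveD.
  rewrite (_ : (fun h : R => _) = (id : R -> R) * cst ((basisv i : 'rV[R]_n) ord0 j)); last first.
    by apply/funext.
  apply: is_derive_eq (is_deriveM (is_derive_id (0 : R) 1) (is_derive_cst _ _ _)) _.
  by rewrite scaler0 add0r [_ *: 1]mulr1.
- split; first by move=> x; exact: (cvgD (cf x) (cg x)).
  move=> i; have [f' sf' df'] := df i; have [g' sg' dg'] := dg i.
  by exists (fun x => f' x + g' x) => [|x]; [exact: smooth_add|exact: is_deriveD].
- split; first by move=> x; exact: (cvgM (cf x) (cg x)).
  move=> i; have [f' sf' df'] := df i; have [g' sg' dg'] := dg i.
  exists (fun x => f x * g' x + g x * f' x) => [|x].
    by apply: smooth_add; exact: smooth_mul.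
  exact: is_deriveM (df' x) (dg' x).
- split.
    by move=> x; apply: (@continuous_comp _ _ _ f expR); [exact: cf|exact: continuous_expR].
  move=> i; have [f' sf' df'] := df i.
  exists (fun x => expR (f x) * f' x) => [|x].
    by apply: smooth_mul => //; exact: smooth_exp.
  exact: is_derive_chain (df' x) (is_derive_expR _).
- split.
    by move=> x; apply: (@continuous_comp _ _ _ f (flat k)); [exact: cf|exact: continuous_flat].
  move=> i; have [f' sf' df'] := df i.
  exists (fun x => (flat k.+2 (f x) + (- k%:R) * flat k.+1 (f x)) * f' x) => [|x].
    apply: smooth_mul => //; apply: smooth_add; first exact: smooth_flat.
    by apply: smooth_mul; [exact: smooth_cst|exact: smooth_flat].
  rewrite mulNr; exact: is_derive_chain (df' x) (is_derive_flat _ _).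
Qed.

Lemma is_derive_scalel (f : 'rV[R]_n -> R) (w x v : 'rV[R]_n) (df : R) :
  is_derive x v f df -> is_derive x v (fun y => f y *: w) (df *: w).
Proof.
move=> [d1 d2].
suff h : (fun h : R => h^-1 *: (((fun y => f y *: w) \o shift x) (h *: v) - f x *: w)) @ 0^' --> df *: w.
  by apply: DeriveDef; [apply/cvg_ex; exists (df *: w)|exact/cvg_lim].
rewrite (_ : (fun h : R => _) = (fun h => (h^-1 *: ((f \o shift x) (h *: v) - f x)) *: w)); last first.
  by apply/funext => h /=; rewrite -scalerBl scalerA.
by apply: cvgZr_tmp; rewrite -d2; exact: d1.
Qed.

Lemma smooth_Ck (f : 'rV[R]_n -> R) (w : 'rV[R]_n) k : smooth f ->
  Ck k (fun x => f x *: w).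
Proof.
elim: k f => [|k IH] f sf.
  split => //; have [cf _] := smooth_derive sf.
  by move=> x; exact: (cvgZr_tmp (cf x)).
have [cf df] := smooth_derive sf.
split; first by move=> x; exact: (cvgZr_tmp (cf x)).
move=> i; have [g sg dg] := df i; split.
  by move=> x; have [] := is_derive_scalel w (dg x).
rewrite (_ : (fun x => _) = (fun x => g x *: w)); first exact: IH.
by apply/funext => x; have [_] := is_derive_scalel w (dg x).
Qed.

Lemma compact_support (V : normedModType R) (f : 'rV[R]_n -> V) (K : set 'rV[R]_n) :
  compact K -> (forall x, ~ K x -> f x = 0) ->
  compact (closure [set x | f x != 0]) /\ closure [set x | f x != 0] `<=` K.
Proof.
move=> cK f0.
have cl : closure [set x | f x != 0] `<=` K.
  have cK' : closed K by apply: compact_closed => //; exact: norm_hausdorff.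
  rewrite [X in _ `<=` X]((closure_id _).1 cK'); apply: closure_subset.
  by move=> x /=; apply: contraNP => /f0 ->.
split => //; apply: (subclosed_compact _ cK cl); exact: closed_closure.
Qed.

(** Any compact set outside which [f] vanishes serves as a witness; such witnesses pass to sums,
    products, translates and derivatives without computing supports. *)
Definition test_function (U : set 'rV[R]_n) (f : 'rV[R]_n -> R) :=
  smooth f /\ exists K, [/\ compact K, K `<=` U & forall x, ~ K x -> f x = 0].

Lemma test_function_Cinfty_c U f (w : 'rV[R]_n) : test_function U f ->
  Cinfty_c U (fun x => f x *: w).
Proof.
move=> [sf [K [cK KU f0]]]; split; first by move=> k; exact: smooth_Ck.
have [|h1 h2] := @compact_support _ (fun x => f x *: w) K cK.
  by move=> x /f0 ->; rewrite scale0r.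
by split => //; exact: subset_trans KU.
Qed.

Lemma compact_rat_cball k : compact (@rat_cball R n k).
Proof.
apply: bounded_closed_compact; last exact: closed_rat_cball.
exists (@rat_radius R n k + `|rat_center k : 'rV[R]_n|); split; first exact: num_real.
move=> M rM x /= xk; apply: le_trans (ltW rM).
rewrite -(subrK (rat_center k) x); apply: le_trans (ler_normD _ _) _.
by rewrite lerD2r (le_trans (ler_norm_enorm _)).
Qed.

(** With S_m the sum of the bumps of the first m rational balls contained in [U], the functions 1 -
    exp(-m S_m) take values in [0, 1], vanish where S_m does, and tend to 1 wherever some bump is
    positive, that is, on all of [U]. *)
Lemma open_test_functions (U : set 'rV[R]_n) : open U ->
  exists psi : nat -> 'rV[R]_n -> R,
  [/\ forall m, test_function U (psi m), forall m x, 0 <= psi m x <= 1 &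
      forall x, psi m x @[m --> \oo] --> (\1_U x : R)].
Proof.
move=> oU.
(* Composing [flat 0] with the squared radius minus the squared distance gives a smooth function
   positive exactly on the open ball; squares avoid the non-smooth point of the norm. *)
pose u k (x : 'rV[R]_n) : R := if `[< @rat_cball R n k `<=` U >] then
  flat 0 (@rat_radius R n k ^+ 2 - dotv (x - rat_center k) (x - rat_center k)) else 0.
have su k : smooth (u k).
  rewrite /u; case: asboolP => _; last exact: smooth_cst.
  apply: smooth_flat; apply: smooth_add; first exact: smooth_cst.
  rewrite (_ : (fun x => _) = (fun x : 'rV[R]_n => (-1) * dotv (x - rat_center k) (x - rat_center k))); last first.
    by apply/funext => x; rewrite mulN1r.
  apply: smooth_mul; first exact: smooth_cst.
  apply: smooth_sum => i; apply: smooth_mul;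
    exact: (smooth_translate (- rat_center k) (smooth_coord i)).
have u0 k x : 0 <= u k x by rewrite /u; case: asboolP => // _; exact: flat_ge0.
have uin k x : 0 < u k x -> rat_inner U k x.
  rewrite /u; case: asboolP => [kU|_]; last by rewrite ltxx.
  rewrite flat0_gt0 subr_gt0 -sqr_enorm => h; split => //.
  by rewrite /rat_cball/= ltW// -(ltr_pXn2r (n := 2)) ?nnegrE ?enorm_ge0// ltW// rat_radius_gt0.
have ugt k x : rat_ball k x -> @rat_cball R n k `<=` U -> 0 < u k x.
  move=> kx kU; rewrite /u; case: asboolP => // _.
  by rewrite flat0_gt0 subr_gt0 -sqr_enorm ltr_pXn2r ?nnegrE ?enorm_ge0// ltW// rat_radius_gt0.
pose S m x := \sum_(k < m) u k x.
have S0 m x : 0 <= S m x by apply: sumr_ge0.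
pose psi m x := 1 + (-1) * expR (- m%:R * S m x).
exists psi; split.
- move=> m; split.
    apply: smooth_add; first exact: smooth_cst.
    apply: smooth_mul; first exact: smooth_cst.
    apply: smooth_exp; apply: smooth_mul; first exact: smooth_cst.
    by apply: smooth_sum => k; exact: su.
  exists (\big[setU/set0]_(k < m) rat_inner U k); split.
  + apply: big_ind => [|A B|k _]; [exact: compact0|exact: compactU|].
    apply: (subclosed_compact (@closed_rat_inner _ _ U k) (@compact_rat_cball k)).
    by move=> x [].
  + by rewrite -bigcup_mkord => x [k _ [kU]]; exact: kU.
  + rewrite -bigcup_mkord => x nx; rewrite /psi (_ : S m x = 0) ?mulr0 ?expR0 ?mulr1 ?subrr//.
    apply: big1 => k _; apply/eqP; rewrite eq_le u0 andbT leNgt; apply/negP => /uin kx.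
    by apply: nx; exists k => /=.
- move=> m x; rewrite /psi mulN1r subr_ge0 -expR0 ler_expR mulNr oppr_le0 mulr_ge0//=.
  by rewrite gerBl expR_ge0.
- move=> x; rewrite indicE; have [xU|xU] := boolP (x \in U); last first.
    rewrite (_ : (fun m => _) = cst 0); first exact: cvg_cst.
    apply/funext => m; rewrite /psi (_ : S m x = 0) ?mulr0 ?expR0 ?mulr1 ?subrr//.
    apply: big1 => k _; apply/eqP; rewrite eq_le u0 andbT leNgt; apply/negP => /uin [kU kx].
    by move/negP : xU; apply; rewrite inE; exact: kU.
  have [k kx kU] := open_rat_ball oU (set_mem xU).
  have uk := ugt _ _ kx kU.
  rewrite -[X in _ --> X]addr0; apply: cvgD; first exact: cvg_cst.
  rewrite -(mulr0 (-1)); apply: cvgM; first exact: cvg_cst.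
  apply/cvgrPdist_lt => e e0; near=> m.
  rewrite sub0r normrN ger0_norm ?expR_ge0// mulNr expRN.
  have km : (k < m)%N by near: m; exact: nbhs_infty_gt.
  have Sk : u k x <= S m x.
    by rewrite /S (bigD1 (Ordinal km))//= lerDl sumr_ge0.
  have me : (e * u k x)^-1 < m%:R by near: m; exact: nbhs_infty_gtr.
  have eu : 0 < e * u k x by rewrite mulr_gt0.
  rewrite -[ltRHS]invrK ltf_pV2 ?posrE ?invr_gt0 ?expR_gt0//.
  apply: (@lt_le_trans _ _ (m%:R * S m x)); last first.
    by apply: le_trans (expR_ge1Dx _); rewrite lerDr.
  apply: (@lt_le_trans _ _ (m%:R * u k x)); last by rewrite ler_wpM2l.
  by rewrite -ltr_pdivrMr// -invfM.
Unshelve. all: by end_near. Qed.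

End smooth_functions.

(** * Differentiation of measures and polar decomposition *)

Lemma integrable_indic_lty d (T : measurableType d) (R : realType)
    (mu : {measure set T -> \bar R}) (A : set T) :
  measurable A -> (mu A < +oo)%E -> mu.-integrable setT (EFin \o (\1_A : T -> R)).
Proof.
move=> mA lA; apply/integrableP; split.
  by apply/measurable_EFinP; exact: measurable_indic.
rewrite (eq_integral (fun x => (\1_A x)%:E)); first by rewrite integral_indic// setIT.
by move=> x _; rewrite /= ger0_norm.
Qed.

Lemma integrable_cst_lty d (T : measurableType d) (R : realType)
    (mu : {measure set T -> \bar R}) (A : set T) (k : R) :
  measurable A -> (mu A < +oo)%E -> mu.-integrable A (EFin \o cst k).
Proof.
move=> mA lA; apply/integrableP; split.
  by apply/measurable_EFinP; exact: measurable_cst.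
rewrite (eq_integral (cst `|k|%:E))//.
by rewrite integral_cst// lte_mul_pinfty// lee_fin.
Qed.

Lemma ae_imply2 d (T : measurableType d) (R : realType)
    (mu : {measure set T -> \bar R}) (P Q S : T -> Prop) :
  (forall x, P x -> Q x -> S x) -> {ae mu, forall x, P x} ->
  {ae mu, forall x, Q x} -> {ae mu, forall x, S x}.
Proof. by move=> PQS aP aQ; apply: filterS2 aP aQ. Qed.

Section vitali.
Local Open Scope ereal_scope.
Context {R : realType} {n : nat}.
Local Notation T := (borelRn R n).
Local Notation lam := (lebesgue_borelRn R n).
Implicit Types (s : seq ('rV[R]_n * R)).

Let Uballs s : set 'rV[R]_n := \big[setU/set0]_(b <- s) ball b.1 b.2.

Let UballsP s x : Uballs s x <-> exists2 b, b \in s & ball b.1 b.2 x.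
Proof.
rewrite /Uballs; elim: s => [|b s IH].
  by rewrite big_nil; split => // -[b].
rewrite big_cons; split=> [[bx|/IH[c cs cx]]|[c]].
- by exists b => //; rewrite mem_head.
- by exists c => //; rewrite in_cons cs orbT.
- by rewrite in_cons => /orP[/eqP ->|cs cx]; [left|right; apply/IH; exists c].
Qed.

Let mball (b : 'rV[R]_n * R) : measurable (ball b.1 b.2 : set T).
Proof. by apply: measurable_open_borelRn; exact: ball_open. Qed.

Let mUballs s : measurable (Uballs s : set T).
Proof. by apply: big_ind => [|A1 A2 mA1 mA2|b _]; [exact: measurable0|exact: measurableU|exact: mball]. Qed.

Let max_radius b0 s : exists2 b, b \in b0 :: s & forall c, c \in b0 :: s -> (c.2 <= b.2)%R.
Proof.
elim: s b0 => [|b1 s IH] b0.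
  by exists b0; rewrite ?mem_head// => c; rewrite inE => /eqP ->.
have [b bs bmax] := IH b1; have [h|h] := leP b0.2 b.2.
  exists b; first by rewrite in_cons bs orbT.
  by move=> c; rewrite in_cons => /orP[/eqP ->//|]; exact: bmax.
exists b0; rewrite ?mem_head// => c; rewrite in_cons => /orP[/eqP ->//|/bmax cb].
exact: le_trans cb (ltW h).
Qed.

(* Greedy selection: the largest ball [b], enlarged three times, covers every
   ball that it meets; the remaining ones are disjoint from [b]. *)
Lemma vitali_weak_type (sigma : {measure set T -> \bar R}) (e : R) s : (0 <= e)%R ->
  (forall b, b \in s -> (0 < b.2)%R /\ e%:E * lam (ball b.1 b.2) <= sigma (ball b.1 b.2)) ->
  e%:E * lam (\big[setU/set0]_(b <- s) ball b.1 b.2) <=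
  (3 ^+ n)%:E * sigma (\big[setU/set0]_(b <- s) ball b.1 b.2).
Proof.
move=> e0; rewrite -/(Uballs s).
have [m] := ubnP (size s); elim: m s => // m IH [|b0 s0] sm hs.
  by rewrite /Uballs !big_nil !measure0 !mule0.
set s := b0 :: s0 in sm hs *.
have [b bs bmax] := max_radius b0 s0.
pose meets (c : 'rV[R]_n * R) := `[< exists x, ball b.1 b.2 x /\ ball c.1 c.2 x >].
pose s' := [seq c <- s | ~~ meets c].
have [b2 hb] := hs b bs.
have mbb : meets b by apply/asboolP; exists b.1; split; exact: ballxx.
have s's : (size s' < m)%N.
  rewrite -ltnS (leq_trans _ sm)// ltnS size_filter.
  rewrite -(count_predC (fun c => ~~ meets c) s) -addn1 leq_add2l -has_count.
  by apply/hasP; exists b => //=; rewrite negbK.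
have hs' c : c \in s' -> (0 < c.2)%R /\ e%:E * lam (ball c.1 c.2) <= sigma (ball c.1 c.2).
  by rewrite mem_filter => /andP[_]; exact: hs.
have {}IH := IH s' s's hs'.
have cov : Uballs s `<=` ball b.1 (3 * b.2) `|` Uballs s'.
  move=> x /UballsP[c cs cx]; have [mc|mc] := boolP (meets c); last first.
    by right; apply/UballsP; exists c => //; rewrite mem_filter mc.
  left; move/asboolP : mc => [y []]; move: cx; rewrite -!ball_normE/= => cx by_ cy.
  have cb := bmax c cs.
  have -> : (b.1 - x = (b.1 - y) + ((y - c.1) + (c.1 - x)))%R by rewrite subrKA subrKA.
  apply: le_lt_trans (ler_normD _ _) _.
  have h := ler_normD (y - c.1)%R (c.1 - x)%R.
  rewrite distrC in cy.
  have -> : (3 * b.2 = b.2 + (b.2 + b.2))%R by ring.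
  rewrite ltrD// (le_lt_trans h)// ltrD//; first exact: lt_le_trans cy _.
  exact: lt_le_trans cx _.
have dis : ball b.1 b.2 `&` Uballs s' = set0.
  rewrite -subset0 => x [bx /UballsP[c]]; rewrite mem_filter => /andP[/asboolP + _] cx.
  by apply; exists x.
have sub : ball b.1 b.2 `|` Uballs s' `<=` Uballs s.
  move=> x [bx|/UballsP[c]]; first by apply/UballsP; exists b.
  by rewrite mem_filter => /andP[_ cs] cx; apply/UballsP; exists c.
have b32 : (0 < 3 * b.2)%R by rewrite mulr_gt0.
have m3 : measurable (ball b.1 (3 * b.2)%R : set T) by exact: (mball (b.1, (3 * b.2)%R)).
have l3 : lam (ball b.1 (3 * b.2)%R) = (3 ^+ n)%:E * lam (ball b.1 b.2).
  rewrite (lebesgue_ball _ b32) (lebesgue_ball _ b2) -EFinM -exprMn; congr (_ ^+ _)%:E.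
  by rewrite mulrnAr.
have n0 : (0 <= 3 ^+ n :> R)%R by rewrite exprn_ge0.
apply: (@le_trans _ _ (e%:E * (lam (ball b.1 (3 * b.2)%R) + lam (Uballs s')))).
  apply: lee_wpmul2l; first by rewrite lee_fin.
  apply: (@le_trans _ _ (lam (ball b.1 (3 * b.2)%R `|` Uballs s'))).
    by apply: le_measure; rewrite ?inE//; exact: measurableU.
  exact: measureU2.
rewrite ge0_muleDr// l3 muleCA.
apply: (@le_trans _ _ ((3 ^+ n)%:E * sigma (ball b.1 b.2) + (3 ^+ n)%:E * sigma (Uballs s'))).
  by apply: leeD => //; apply: lee_wpmul2l => //; rewrite lee_fin.
rewrite -ge0_muleDr//; apply: lee_wpmul2l; first by rewrite lee_fin.
rewrite -measureU//; apply: le_measure; rewrite ?inE//; exact: measurableU.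
Qed.

End vitali.

(** * Lebesgue differentiation along Euclidean balls *)

Section differentiation.
Local Open Scope ereal_scope.
Context {R : realType} {n : nat}.
Local Notation T := (borelRn R n).
Local Notation lam := (lebesgue_borelRn R n).

Let mball (x : 'rV[R]_n) (r : R) : measurable (ball x r : set T).
Proof. by apply: measurable_open_borelRn; exact: ball_open. Qed.

(** Outer regularity encloses [A] in an open set of tiny [sigma] measure. The points of [A] with
    arbitrarily small bad cubes are covered by bad cubes inside it, whose union has small volume by
    the weak type inequality. *)
Lemma null_density (sigma : {finite_measure set T -> \bar R}) (A : set T) (e : R) :
  measurable A -> sigma A = 0 -> (0 < e)%R ->
  {ae lam, forall x, A x -> exists2 d : R, (0 < d)%R & forall r, (0 < r < d)%R ->
     sigma (ball x r) < e%:E * lam (ball x r)}.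
Proof.
move=> mA sA e0.
pose bad (x : 'rV[R]_n) (r : R) := e%:E * lam (ball x r) <= sigma (ball x r).
pose N : set 'rV[R]_n := [set x | A x /\ forall d : R, (0 < d)%R -> exists2 r, (0 < r < d)%R & bad x r].
(* [N] is defined through a continuum of radii, so its measurability is not at hand; it is enclosed
   in measurable sets of arbitrarily small measure. *)
suff H (eta : R) : (0 < eta)%R -> exists W : set T, [/\ measurable W, N `<=` W & lam W <= eta%:E].
  have /choice[W HW] : forall j : nat, exists W : set T, [/\ measurable W, N `<=` W & lam W <= (j.+1%:R^-1)%:E].
    by move=> j; apply: H; rewrite invr_gt0.
  exists (\bigcap_j W j); split.
  - by apply: bigcapT_measurable => j; have [] := HW j.
  - apply/eqP; rewrite -measure_le0; apply/lee_addgt0Pr => d d0; rewrite add0e.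
    have [j jd] : exists j : nat, (j.+1%:R^-1 < d)%R.
      by have [M _ /(_ M (leqnn M))] := near_infty_natSinv_lt (PosNum d0); exists M.
    have [mW _ lW] := HW j.
    apply: (@le_trans _ _ (lam (W j))); last by apply: le_trans lW _; rewrite lee_fin ltW.
    apply: le_measure; rewrite ?inE//; last by move=> x; exact.
    by apply: bigcapT_measurable => i; have [] := HW i.
  - move=> x /= nx j _; have [_ + _] := HW j; apply; split.
      by apply: contrapT => nAx; apply: nx.
    move=> d d0; apply: contrapT => h; apply: nx => _; exists d => // r rd.
    by rewrite ltNge; apply/negP => b; apply: h; exists r.
move=> eta0.
have c3 : (3 ^+ n != 0 :> R)%R by rewrite gt_eqF// exprn_gt0.
pose eta' := (eta * e / 3 ^+ n)%R.
have etaE : (3 ^+ n * eta' = e * eta)%R by rewrite /eta' mulrC (divfK c3) mulrC.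
have eta'0 : (0 < eta')%R by rewrite !(divr_gt0, mulr_gt0)// exprn_gt0.
have [U [oU AU UA]] := outer_regularity sigma mA eta'0.
have mU : measurable (U : set T) by exact: measurable_open_borelRn.
have sU : sigma U <= eta'%:E.
  apply: (@le_trans _ _ (sigma (A `|` (U `\` A)))).
    by rewrite setDUK.
  apply: le_trans (measureU2 _ _ _) _ => //; first exact: measurableD.
  by rewrite [X in X + _]sA add0e ltW.
(* Reduction to countably many bad cubes: for each rational ball contained in some bad cube, one
   such cube is chosen. A bad point lies in a rational ball inside its own bad cube, hence in the
   chosen one. *)
pose Q k (p : 'rV[R]_n * R) := [/\ (0 < p.2)%R, ball p.1 p.2 `<=` U, bad p.1 p.2 &
  @rat_ball R n k `<=` ball p.1 p.2].
have /choice[p Hp] : forall k, exists p, (exists q, Q k q) -> Q k p.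
  move=> k; have [[q Qq]|nQ] := pselect (exists q, Q k q); first by exists q.
  by exists (0%R, 0%R).
pose s m := [seq p k | k <- iota 0 m & `[< exists q, Q k q >]].
have sP m b : b \in s m -> exists2 k, (k < m)%N & b = p k /\ Q k (p k).
  move=> /mapP[k]; rewrite mem_filter mem_iota add0n leq0n/= => /andP[/asboolP h km] ->.
  by exists k => //; split => //; exact: Hp.
pose W m : set 'rV[R]_n := \big[setU/set0]_(b <- s m) ball b.1 b.2.
have WP m x : W m x <-> exists2 b, b \in s m & ball b.1 b.2 x.
  rewrite /W; elim: (s m) => [|b t IH].
    by rewrite big_nil; split => // -[b].
  rewrite big_cons; split=> [[bx|/IH[c cs cx]]|[c]].
  - by exists b => //; rewrite mem_head.
  - by exists c => //; rewrite in_cons cs orbT.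
  - by rewrite in_cons => /orP[/eqP ->|cs cx]; [left|right; apply/IH; exists c].
have mW m : measurable (W m : set T).
  by apply: big_ind => [|A1 A2 mA1 mA2|b _]; [exact: measurable0|exact: measurableU|exact: mball].
have lW m : lam (W m) <= eta%:E.
  have h : e%:E * lam (W m) <= (3 ^+ n)%:E * sigma (W m).
    apply: vitali_weak_type; first exact: ltW.
    by move=> b /sP[k _ [-> []]].
  rewrite -(@lee_pmul2l _ e%:E) ?lte_fin//.
  apply: (le_trans h); apply: (@le_trans _ _ ((3 ^+ n)%:E * eta'%:E)).
    apply: lee_wpmul2l; first by rewrite lee_fin exprn_ge0.
    apply: le_trans sU; apply: le_measure; rewrite ?inE//.
    by move=> x /WP[b /sP[k _ [-> [_ + _ _]]]]; apply.
  by rewrite -EFinM etaE EFinM.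
exists (\bigcup_m W m); split; first exact: bigcupT_measurable.
- move=> x [Ax badx].
  have /nbhs_ballP[d /= d0 dU] : nbhs x U.
    by apply: open_nbhs_nbhs; split => //; exact: AU.
  have [r /andP[r0 rd] br] := badx d d0.
  have [k kx kr] := @rat_ball_basis R n x r r0.
  have Qk : exists q, Q k q.
    exists (x, r); split => //.
      by apply: subset_trans dU; apply: le_ball; exact: ltW.
    by move=> y ky; apply: eball_ball; apply: kr; exact: ltW.
  exists k.+1 => //; apply/WP; exists (p k); last first.
    by have [_ _ _] := Hp k Qk; apply.
  apply/mapP; exists k => //; rewrite mem_filter mem_iota add0n leq0n ltnSn !andbT.
  exact/asboolP.
- have cW : lam \o W @ \oo --> lam (\bigcup_m W m).
    apply: nondecreasing_cvg_mu => //; first exact: bigcupT_measurable.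
    move=> i j ij; apply/subsetPset => x /WP[b bs bx]; apply/WP; exists b => //.
    move/mapP : bs => [k]; rewrite mem_filter mem_iota add0n leq0n/= => /andP[h km] ->.
    apply/mapP; exists k => //; rewrite mem_filter h mem_iota add0n leq0n/=.
    exact: leq_trans ij.
  rewrite -(cvg_lim _ cW)//; apply: lime_le; first by apply/cvg_ex; exists (lam (\bigcup_m W m)).
  exact: nearW.
Qed.

Lemma measurable_eball (x : 'rV[R]_n) (r : R) : measurable (eball x r : set T).
Proof. by apply: measurable_open_borelRn; exact: open_eball. Qed.

Hypothesis n1 : (1 <= n)%N.

(** The Euclidean ball contains the cube of half side r/n and lies in the one of half side r, so it
    occupies at least the fraction n^-n of the latter. *)
Lemma lebesgue_eball (x : 'rV[R]_n) (r : R) : (0 < r)%R ->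
  exists l : R, [/\ (0 < l)%R, lam (eball x r) = l%:E & ((r *+ 2) ^+ n <= n%:R ^+ n * l)%R].
Proof.
move=> r0; have n0 : (0 < n%:R :> R)%R by rewrite ltr0n.
have rn0 : (0 < r / n%:R)%R by rewrite divr_gt0.
have mE := measurable_eball x r.
have h1 : lam (eball x r) <= ((r *+ 2) ^+ n)%:E.
  rewrite -(lebesgue_ball x r0); apply: le_measure; rewrite ?inE//.
  exact: eball_ball.
have h2 : ((r / n%:R *+ 2) ^+ n)%:E <= lam (eball x r).
  rewrite -(lebesgue_ball x rn0); apply: le_measure; rewrite ?inE//.
  exact: ball_eball.
have fE : lam (eball x r) \is a fin_num.
  by rewrite ge0_fin_numE//; apply: le_lt_trans h1 _; rewrite ltry.
exists (fine (lam (eball x r))); rewrite fineK//; split => //.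
  rewrite -lte_fin fineK//; apply: lt_le_trans h2; rewrite lte_fin.
  by rewrite exprn_gt0// pmulrn_lgt0.
rewrite -lee_fin EFinM fineK//.
have -> : ((r *+ 2) ^+ n = n%:R ^+ n * (r / n%:R *+ 2) ^+ n)%R.
  by rewrite -exprMn; congr (_ ^+ _)%R; rewrite mulrnAr mulrCA divff ?mulr1// gt_eqF.
by rewrite EFinM; apply: lee_wpmul2l h2; rewrite lee_fin exprn_ge0// ltW.
Qed.

(** The measure with density max(g - q, 0) does not charge the set g <= q, so its cube averages
    there are eventually below e. Localization to a bounded cube makes this density integrable even
    when q is negative. *)
Let upper_average (g : 'rV[R]_n -> R) (q e : R) (N : nat) :
  lam.-integrable setT (EFin \o g) -> (0 < e)%R ->
  {ae lam, forall x, ball (0%R : 'rV[R]_n) N%:R%R x -> (g x <= q)%R ->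
    exists2 d : R, (0 < d)%R & forall r, (0 < r < d)%R ->
      (\int[lam]_(y in eball x r) g y <= (q + e * n%:R ^+ n) * fine (lam (eball x r)))%R}.
Proof.
move=> ig e0; pose B : set 'rV[R]_n := ball (0%R : 'rV[R]_n) N%:R%R.
have mB : measurable (B : set T) by exact: mball.
have mg : measurable_fun setT (g : T -> R) by apply/measurable_EFinP; exact: measurable_int ig.
pose h (y : 'rV[R]_n) : R := (Num.max (g y - q) 0 * \1_B y)%R.
have h0 y : (0 <= h y)%R by rewrite mulr_ge0// le_max lexx orbT.
have mh : measurable_fun [set: T] h.
  apply: measurable_funM; last exact: measurable_indic.
  by apply: measurable_maxr => //; exact: measurable_funB.
have lB : lam B < +oo.
  have [N0|N0] := posnP N; last by rewrite /B lebesgue_ball ?ltr0n// ltry.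
  rewrite (_ : B = set0) ?measure0// -subset0 => y.
  by rewrite /B N0 -ball_normE/= normr_lt0.
have ih : lam.-integrable [set: T] (EFin \o h).
  apply: (@le_integrable _ _ _ lam setT measurableT _
    (EFin \o (fun y => (`|g y| + `|q| * \1_B y)%R))).
  - exact/measurable_EFinP.
  - move=> y _; rewrite /= lee_fin (ger0_norm (h0 y)).
    rewrite ger0_norm ?addr_ge0 ?mulr_ge0// /h indicE.
    case: (y \in B) => /=; last by rewrite !mulr0 addr0.
    rewrite !mulr1 ge_max addr_ge0// andbT.
    by apply: lerD; rewrite ?ler_norm// -normrN ler_norm.
  - under [X in _.-integrable _ X]eq_fun do rewrite /= EFinD EFinM.
    apply: integrableD => //; first exact: (integrable_abse ig).
    by apply: integrableZl => //; exact: (integrable_indic_lty mB lB).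
have ihE (C : set T) : measurable C -> lam.-integrable C (EFin \o h).
  by move=> mC; exact: integrableS ih.
pose sigma := density ih h0.
pose A := [set y | (g y <= q)%R].
have mA : measurable (A : set T).
  by rewrite -[X in measurable X]setTI; apply: measurable_fun_ler.
have sA : sigma A = 0.
  rewrite /sigma /density integral0_eq// => y Ay.
  by rewrite /h (max_idPr _) ?mul0r// subr_le0.
apply: filterS (null_density mA sA e0) => x hx Bx gx.
have [d1 d10 hd1] := hx gx.
have /nbhs_ballP[d2 /= d20 hd2] : nbhs x B.
  by apply: open_nbhs_nbhs; split => //; exact: ball_open.
exists (Num.min d1 d2); first by rewrite lt_min d10.
move=> r /andP[r0]; rewrite lt_min => /andP[rd1 rd2].
have [l [l0 lE lr]] := lebesgue_eball x r0.
have mE := measurable_eball x r.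
have iq : lam.-integrable (eball x r) (EFin \o cst q).
  by apply: (integrable_cst_lty _ mE); rewrite [ltLHS]lE ltry.
rewrite lE/=; apply: (@le_trans _ _ (\int[lam]_(y in eball x r) (h y + q))%R).
  apply: le_Rintegral => //.
  - exact: integrableS ig.
  - exact: (integrableD mE (ihE _ mE) iq).
  - move=> y xy; rewrite -lerBlDr /h indicE mem_set ?mulr1 ?le_max ?lexx//.
    by apply: hd2; apply: le_ball (eball_ball xy); exact: ltW.
rewrite RintegralD//; last exact: ihE.
have fl : fine (lam (eball x r)) = l by rewrite lE.
rewrite Rintegral_cst// [X in (q * X)%R]fl addrC mulrDl lerD2l.
have h1 : (\int[lam]_(y in eball x r) h y <= \int[lam]_(y in ball x r) h y)%R.
  rewrite -lee_fin !EFin_Rintegral//; try exact: ihE.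
  apply: ge0_subset_integral => //.
  - by apply: measurable_funTS; exact/measurable_EFinP.
  - by move=> y _; rewrite lee_fin.
  - exact: eball_ball.
apply: (le_trans h1); rewrite -lee_fin EFin_Rintegral//; last exact: ihE.
apply: (@le_trans _ _ (e%:E * lam (ball x r))).
  by apply: ltW; apply: hd1; rewrite r0.
rewrite (lebesgue_ball x r0) -EFinM lee_fin -mulrA ler_wpM2l//.
exact: ltW.
Qed.

(** A single null set serves all rational levels, all cubes of integer radius and all tolerances
    1/(j+1), coded by one integer. A rational level just above the value at x bounds the upper limit
    of the averages, and the same for -g bounds the lower limit. *)
Theorem lebesgue_differentiation_eball (g : 'rV[R]_n -> R) :
  lam.-integrable setT (EFin \o g) ->
  {ae lam, forall x, ((fine (lam (eball x r)))^-1 * \int[lam]_(y in eball x r) g y)%R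
     @[r --> 0^'+] --> g x}.
Proof.
move=> ig.
have igN : lam.-integrable setT (EFin \o (fun x => - g x)%R).
  exact: (integrableN ig).
pose P (f : 'rV[R]_n -> R) (k : nat) (x : 'rV[R]_n) :=
  if unpickle k is Some p then
    let: (q, N, j) := (p : rat * nat * nat) in
    ball (0%R : 'rV[R]_n) N%:R%R x -> (f x <= ratr q)%R ->
    exists2 d : R, (0 < d)%R & forall r, (0 < r < d)%R ->
      (\int[lam]_(y in eball x r) f y <=
        (ratr q + j.+1%:R^-1 * n%:R ^+ n) * fine (lam (eball x r)))%R
  else True.
have aeP (f : 'rV[R]_n -> R) : lam.-integrable setT (EFin \o f) ->
    {ae lam, forall x k, P f k x}.
  move=> fi; apply: ae_foralln => k; rewrite /P.
  case: unpickle => [[[q N] j]|]; last exact: aeW.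
  by apply: upper_average => //; rewrite invr_gt0.
have key (f : 'rV[R]_n -> R) x : (forall k, P f k x) -> forall e : R, (0 < e)%R ->
    \forall r \near 0^'+, ((fine (lam (eball x r)))^-1 * \int[lam]_(y in eball x r) f y < f x + e)%R.
  move=> Px e e0.
  have fxe : (f x < f x + e / 2)%R by rewrite ltrDl divr_gt0.
  have [q] := rat_in_itvoo fxe.
  rewrite in_itv/= => /andP[q1 q2].
  have n0 : (0 < n%:R ^+ n :> R)%R by rewrite exprn_gt0// ltr0n.
  have e2 : (0 < e / 2 / n%:R ^+ n)%R by rewrite !divr_gt0.
  have [j hj] : exists j : nat, (j.+1%:R^-1 < e / 2 / n%:R ^+ n)%R.
    by have [M _ /(_ M (leqnn M))] := near_infty_natSinv_lt (PosNum e2); exists M.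
  have [N hN] : exists N : nat, ball (0%R : 'rV[R]_n) N%:R%R x.
    exists (Num.truncn `|x|).+1; rewrite -ball_normE/= sub0r normrN.
    exact: truncnS_gt.
  have := Px (pickle (q, N, j)); rewrite /P pickleK => /(_ hN (ltW q1))[d d0 hd].
  near=> r.
  have r0 : (0 < r)%R by near: r; exact: nbhs_right_gt.
  have rd : (r < d)%R by near: r; exact: nbhs_right_lt.
  have [l [l0 lE lr]] := lebesgue_eball x r0.
  have := hd r; rewrite r0 rd lE/= => /(_ isT) h.
  rewrite mulrC ltr_pdivrMr//; apply: le_lt_trans h _.
  rewrite ltr_pM2r// [e in ltRHS]splitr addrA ltrD//.
  by rewrite -ltr_pdivlMr.
have a1 := aeP _ ig; have a2 := aeP _ igN.
apply: (ae_imply2 _ a1 a2) => x P1 P2.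
apply/cvgrPdist_lt => e e0.
have h1 := key _ _ P1 e e0; have h2 := key _ _ P2 e e0.
near=> r.
have H1 : ((fine (lam (eball x r)))^-1 * \int[lam]_(y in eball x r) g y < g x + e)%R.
  by near: r.
have H2 : ((fine (lam (eball x r)))^-1 * \int[lam]_(y in eball x r) (- g y) < - g x + e)%R.
  by near: r.
move: H2; rewrite (_ : \int[lam]_(y in eball x r) (- g y) = - \int[lam]_(y in eball x r) g y)%R; last first.
  rewrite -mulN1r -RintegralZl//; last 2 first.
  - exact: measurable_eball.
  - by apply: integrableS ig => //; exact: measurable_eball.
  by apply: eq_Rintegral => y _; rewrite mulN1r.
rewrite mulrN; move: H1; set a := (_ * _)%R => H1 H2.
by clear -H1 H2; rewrite ltr_norml; apply/andP; split; lra.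
Unshelve. all: by end_near. Qed.

End differentiation.

Lemma cvg_rV {R : realType} {n : nat} (I : Type) (F : set_system I) {FF : Filter F}
    (f : I -> 'rV[R]_n) (v : 'rV[R]_n) :
  (forall i, f t ord0 i @[t --> F] --> v ord0 i) -> f t @[t --> F] --> v.
Proof.
move=> fv; apply/cvgrPdist_le => e e0.
have : \forall t \near F, forall i : 'I_n, `|v ord0 i - f t ord0 i| <= e.
  by apply: filter_forall => i; move/cvgrPdist_le : (fv i); exact.
apply: filterS => t ht; rewrite [leLHS]mx_normrE; apply/bigmax_leP; split; first exact: ltW.
by move=> [i j] _ /=; rewrite (ord1 i) !mxE.
Qed.

Lemma cvg_rV_coord {R : realType} {n : nat} (I : Type) (F : set_system I) {FF : Filter F}
    (f : I -> 'rV[R]_n) (v : 'rV[R]_n) i :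
  f t @[t --> F] --> v -> f t ord0 i @[t --> F] --> v ord0 i.
Proof.
move=> fv; apply: (@continuous_cvg _ _ _ _ _ f (fun M : 'rV[R]_n => M ord0 i)) => //.
exact: coord_continuous.
Qed.

Lemma ler_dist_enorm {R : realType} {n : nat} (x y : 'rV[R]_n) :
  `|enorm x - enorm y| <= enorm (x - y).
Proof.
have h1 := ler_enormD (x - y) y; have h2 := ler_enormD (y - x) x.
rewrite subrK in h1; rewrite subrK enormB in h2.
by rewrite ler_norml; apply/andP; split; lra.
Qed.

Section eball_measurability.
Context {R : realType} {n : nat}.
Local Notation T := (borelRn R n).

Lemma measurable_eball_measure (m : {finite_measure set T -> \bar R}) (s : R) :
  measurable_fun [set: T] (fun x : T => fine (m (eball x s))).
Proof.
pose A : set (T * T) := [set p | enorm ((p.2 : 'rV[R]_n) - p.1) < s].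
have mA : measurable A.
  rewrite -[X in measurable X]setTI.
  apply: (@measurable_fun_ltr _ _ _ setT (fun p : T * T => enorm ((p.2 : 'rV[R]_n) - p.1)) (cst s)) => //.
  by apply: measurable_enorm; apply: measurable_subv.
have := measurable_fun_xsection m mA.
move=> /(measurableT_comp (fine_measurable measurableT)).
rewrite (_ : fine \o _ = (fun x : T => fine (m (eball x s))))//.
apply/funext => x /=; congr (fine (m _)).
by apply/seteqP; split => y; rewrite /xsection/= inE.
Qed.

(** An open ball is the increasing union of the concentric smaller ones. This one-sided continuity
    allows rational radii to control all radii. *)
Lemma eball_left_continuous (m : {finite_measure set T -> \bar R}) (x : 'rV[R]_n) (r e : R) :
  0 < r -> 0 < e -> exists2 t, 0 <= t < r & forall s, t <= s -> s <= r ->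
    fine (m (eball x r `\` eball x s)) < e.
Proof.
move=> r0 e0; pose F (k : nat) : set T := eball x r `\` eball x (r - r / k.+1%:R).
have mF k : measurable (F k) by apply: measurableD; exact: measurable_eball.
have : m \o F @ \oo --> m (\bigcap_k F k).
  apply: nonincreasing_cvg_mu => //.
  - by rewrite ltey_eq fin_num_measure.
  - by apply: bigcapT_measurable.
  - move=> i j ij; apply/subsetPset; apply: setDS => y /lt_le_trans; apply.
    rewrite lerB// (ler_wpM2l (ltW r0))//.
    by rewrite ler_pV2 ?inE ?unitfE ?pnatr_eq0 ?ltr0n// ler_nat.
rewrite (_ : \bigcap_k F k = set0); last first.
  rewrite -subset0 => y h; have [yr _] := h 0%N I.
  have yr' : 0 < r - enorm (y - x) by rewrite subr_gt0.
  pose d := (r - enorm (y - x)) / r.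
  have d0 : 0 < d by rewrite divr_gt0.
  have [k kd] : exists k : nat, k.+1%:R^-1 < d.
    by have [M _ /(_ M (leqnn M))] := near_infty_natSinv_lt (PosNum d0); exists M.
  have [_] := h k I; apply; rewrite /eball/= ltrBrDr -ltrBrDl.
  by rewrite -ltr_pdivlMl// mulrC.
rewrite measure0 => /fine_cvgP[_ /cvgrPdist_lt /(_ _ e0)[N _ /(_ N (leqnn N))]].
rewrite /= sub0r normrN => h; exists (r - r / N.+1%:R).
  rewrite subr_ge0 ler_pdivrMr ?ltr0n// ler_peMr ?ler1n ?ltW//=.
  by rewrite gtrBl divr_gt0.
move=> s ts sr; apply: le_lt_trans h; apply: le_trans (ler_norm _).
have mD : measurable ((eball x r `\` eball x s) : set T).
  by apply: measurableD; exact: measurable_eball.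
apply: fine_le; rewrite ?fin_num_measure//.
apply: le_measure; rewrite ?inE//.
by apply: setDS => y /lt_le_trans; apply.
Qed.

End eball_measurability.

(** * Polar decomposition through limits of ball quotients *)

Section polar.
Context {R : realType} {n : nat}.
Local Notation T := (borelRn R n).
Local Notation lam := (lebesgue_borelRn R n).
Variables (Omega : set 'rV[R]_n) (g : 'rV[R]_n -> 'rV[R]_n) (D : vmeasure R n).
Hypotheses (n1 : (1 <= n)%N) (oO : open Omega).
Hypothesis ig : forall i, lam.-integrable [set: T] (fun x => (g x ord0 i)%:E).
Hypothesis gO : forall x, ~ Omega x -> g x = 0.
Hypothesis DE : forall i (A : set T), measurable A ->
  D i A = (\int[lam]_(x in A) (g x ord0 i)%:E)%E.

Let gi (i : 'I_n) (x : 'rV[R]_n) : R := g x ord0 i.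

Let ie : lam.-integrable [set: T] (EFin \o (fun x => enorm (g x))).
Proof. exact: integrable_enorm ig. Qed.

Let tau : {finite_measure set T -> \bar R} := density ie (fun x => enorm_ge0 (g x)).

Let vtvE (A : set T) : measurable A -> vtotal_variation D A = tau A.
Proof. exact: (total_variation_density ig DE). Qed.

Let igp i : lam.-integrable [set: T] (EFin \o (gi i)^\+).
Proof. by apply: integrable_funrpos => //; exact: ig. Qed.

Let ign i : lam.-integrable [set: T] (EFin \o (gi i)^\-).
Proof. by apply: integrable_funrneg => //; exact: ig. Qed.

Let pos i : {finite_measure set T -> \bar R} := density (igp i) (funrpos_ge0 (gi i)).
Let neg i : {finite_measure set T -> \bar R} := density (ign i) (funrneg_ge0 (gi i)).

Let fineDE i (A : set T) : measurable A -> fine (D i A) = fine (pos i A) - fine (neg i A).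
Proof.
move=> mA; rewrite DE//.
rewrite -[fine (pos i A)]/(\int[lam]_(x in A) ((gi i)^\+ x)).
rewrite -[fine (neg i A)]/(\int[lam]_(x in A) ((gi i)^\- x)).
rewrite -RintegralB//; last 2 first.
- exact: integrableS (igp i).
- exact: integrableS (ign i).
by apply: eq_Rintegral => x _; rewrite -[LHS]/(gi i x) -[in LHS](funrposBneg (gi i)).
Qed.

(** The ball quotient rewritten with finite measures only, so that measurability in [x] and left
    continuity in [r] follow from those of ball measures. *)
Let bq (x : 'rV[R]_n) (r : R) : 'rV[R]_n :=
  (fine (tau (eball x r)))^-1 *: \row_i (fine (pos i (eball x r)) - fine (neg i (eball x r))).

Let ball_quotientE x r : ball_quotient D x r = bq x r.
Proof.
rewrite /ball_quotient vtvE; last exact: measurable_eball.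
congr (_ *: _); apply/rowP => i; rewrite !mxE fineDE//; exact: measurable_eball.
Qed.

Let measurable_bq r : measurable_fun [set: T] (fun x : T => bq x r : T).
Proof.
apply: measurable_scalev.
  by apply: measurable_invr; exact: measurable_eball_measure.
apply: measurable_fun_rV => i; under eq_fun do rewrite mxE.
by apply: measurable_funB; exact: measurable_eball_measure.
Qed.

Let fine_setD (m : {finite_measure set T -> \bar R}) x (r s : R) : s <= r ->
  fine (m (eball x r)) - fine (m (eball x s)) = fine (m (eball x r `\` eball x s)).
Proof.
move=> sr; have mr := @measurable_eball R n x r; have ms := @measurable_eball R n x s.
rewrite measureD//; last by rewrite ltey_eq fin_num_measure.
rewrite setIidr; last by move=> y /lt_le_trans; apply.
by rewrite fineB// fin_num_measure.
Qed.



Let fine_cvg_left (m : {finite_measure set T -> \bar R}) x (r : R) : 0 < r ->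
  fine (m (eball x s)) @[s --> r^'-] --> fine (m (eball x r)).
Proof.
move=> r0; apply/cvgrPdist_le => e e0.
have [t /andP[t0 tr] ht] := eball_left_continuous m x r0 e0.
near=> s.
have ts : t <= s by near: s; exact: nbhs_left_ge.
have sr : s <= r by near: s; exact: nbhs_left_le.
rewrite fine_setD// ger0_norm ?fine_ge0//; exact: ltW (ht _ ts sr).
Unshelve. all: by end_near. Qed.

Let bq_cvg_left x (r : R) : 0 < r -> 0 < fine (tau (eball x r)) -> bq x s @[s --> r^'-] --> bq x r.
Proof.
move=> r0 t0; apply: cvg_rV => i; rewrite /bq.
under eq_fun do rewrite !mxE; rewrite !mxE.
apply: cvgM.
  by apply: cvgV; [rewrite gt_eqF|exact: fine_cvg_left].
by apply: cvgB; exact: fine_cvg_left.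
Qed.

(** A strict violation at [r] would persist on a left neighbourhood of [r], which contains a
    rational radius. *)
Let rat_to_real x (c : 'rV[R]_n) (d e : R) : (forall r : R, 0 < r -> 0 < fine (tau (eball x r))) ->
  (forall s : rat, 0 < (ratr s : R) < d -> enorm (bq x (ratr s) - c) <= e) ->
  forall r : R, 0 < r < d -> enorm (bq x r - c) <= e.
Proof.
move=> t0 hs r /andP[r0 rd]; rewrite leNgt; apply/negP => er.
have ce : enorm (bq x s - c) @[s --> r^'-] --> enorm (bq x r - c).
  apply: (@continuous_cvg _ _ _ _ _ (fun s => bq x s - c) (@enorm R n)); first exact: continuous_enorm.
  exact: (cvgB (bq_cvg_left r0 (t0 _ r0)) (cvg_cst _)).
have : \forall s \near r^'-, e < enorm (bq x s - c) by move/cvgrPdist_lt: ce => /(_ (enorm (bq x r - c) - e)); rewrite subr_gt0 => /(_ er); apply: filterS => s; rewrite ltr_distlC => /andP[+ _]; rewrite subKr.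
rewrite near_withinE => -[del /= del0 hdel].
have : Num.max 0 (r - del) < r by rewrite gt_max r0 gtrBl.
move=> /rat_in_itvoo[s]; rewrite in_itv/= gt_max => /andP[/andP[s0 sd] sr].
have := hs s; rewrite s0 (lt_trans sr rd) => /(_ isT); apply/negP; rewrite -ltNge.
apply: hdel => //=; rewrite gtr0_norm ?subr_gt0//; lra.
Qed.

Let tau_pos x : (forall k : nat, 0 < fine (tau (eball x k.+1%:R^-1))) ->
  forall r : R, 0 < r -> 0 < fine (tau (eball x r)).
Proof.
move=> h r r0; have [k kr] : exists k : nat, k.+1%:R^-1 < r.
  by have [M _ /(_ M (leqnn M))] := near_infty_natSinv_lt (PosNum r0); exists M.
apply: lt_le_trans (h k) _; apply: fine_le; rewrite ?fin_num_measure//; try exact: measurable_eball.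
apply: le_measure; rewrite ?inE; try exact: measurable_eball.
by move=> y /lt_trans; apply.
Qed.

(** The Cauchy criterion for the ball quotient at accuracy 1/(j+1), with a nearly unit rational
    vector as approximate limit. Only countable unions and intersections occur, hence measurability;
    the intersection over [j] says that the limit exists and is a unit vector. *)
Let conv (j : nat) : set T :=
  \bigcup_(c in [set c : {ffun 'I_n -> rat} | `|enorm (ratrV c : 'rV[R]_n) - 1| <= j.+1%:R^-1])
  \bigcup_k \bigcap_(s in [set s : rat | 0 < (ratr s : R) < k.+1%:R^-1])
    [set x : T | enorm (bq x (ratr s) - ratrV c) <= j.+1%:R^-1].

Let measurable_conv j : measurable (conv j).
Proof.
rewrite /conv bigcup_mkcond; apply: countable_bigcupT_measurable => // c.
case: ifPn => // _; apply: bigcupT_measurable => k.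
rewrite -[X in measurable X]setCK setC_bigcap; apply: measurableC.
rewrite bigcup_mkcond; apply: countable_bigcupT_measurable => // s.
case: ifPn => // _; apply: measurableC; rewrite -[X in measurable X]setTI.
apply: (@measurable_fun_ler _ _ _ setT (fun x : T => enorm (bq x (ratr s) - ratrV c)) (cst j.+1%:R^-1)) => //.
by apply: measurable_enorm; apply: measurable_subv => //; exact: measurable_bq.
Qed.


Let vtv_gt0 x (r : R) : (0 < vtotal_variation D (eball x r))%E = (0 < fine (tau (eball x r))).
Proof.
have mB := @measurable_eball R n x r.
by rewrite vtvE// -[X in (0 < X)%E](fineK (fin_num_measure tau _ mB)) lte_fin.
Qed.

Let cvg_conv x (v : 'rV[R]_n) : bq x r @[r --> 0^'+] --> v -> enorm v = 1 -> forall j, conv j x.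
Proof.
move=> hv v1 j.
have j0 : 0 < j.+1%:R^-1 / 2 :> R by rewrite divr_gt0// invr_gt0.
have [c cv] := ratrV_dense v j0.
exists c => /=.
  rewrite -[X in _ - X]v1; apply: le_trans (ler_dist_enorm _ _) _.
  by apply/ltW/(lt_trans cv); rewrite ltr_pdivrMr// ltr_pMr ?ltr1n// invr_gt0.
have ce : enorm (bq x r - v) @[r --> 0^'+] --> enorm (v - v).
  apply: (@continuous_cvg _ _ _ _ _ (fun s => bq x s - v) (@enorm R n)); first exact: continuous_enorm.
  exact: (cvgB hv (cvg_cst _)).
rewrite subrr enorm0 in ce.
move/cvgrPdist_le : ce => /(_ _ j0); rewrite near_withinE => -[del /= del0 hdel].
have [k kr] : exists k : nat, k.+1%:R^-1 < del.
  by have [M _ /(_ M (leqnn M))] := near_infty_natSinv_lt (PosNum del0); exists M.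
exists k => // s /= /andP[s0 sk].
have := hdel (ratr s); rewrite /ball_/= !sub0r !normrN (gtr0_norm s0) (lt_trans sk kr) => /(_ isT s0).
rewrite ger0_norm ?enorm_ge0// => h.
have := ler_enormD (bq x (ratr s) - v) (v - ratrV c); rewrite addrA subrK (enormB v) => h1.
rewrite (le_trans h1)// [leRHS]splitr lerD//; exact: ltW.
Qed.

Let conv_cvg x : (forall k : nat, 0 < fine (tau (eball x k.+1%:R^-1))) -> (forall j, conv j x) ->
  exists2 v, enorm v = 1 & bq x r @[r --> 0^'+] --> v.
Proof.
move=> /tau_pos t0 cx.
have cx' (e : R) : 0 < e -> exists c : 'rV[R]_n, `|enorm c - 1| <= e /\
    \forall r \near 0^'+, enorm (bq x r - c) <= e.
  move=> e0; have [j je] : exists j : nat, j.+1%:R^-1 < e.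
    by have [M _ /(_ M (leqnn M))] := near_infty_natSinv_lt (PosNum e0); exists M.
  have [c /= c1 [k _ hk]] := cx j; exists (ratrV c); split; first exact: le_trans (ltW je).
  have k0 : 0 < k.+1%:R^-1 :> R by rewrite invr_gt0.
  near=> r; apply: le_trans (ltW je); apply: (rat_to_real t0 hk).
  apply/andP; split; near: r; [exact: nbhs_right_gt|exact: nbhs_right_lt].
have cF : cvg (bq x r @[r --> 0^'+]).
  apply/cauchy_cvgP; apply: cauchy_exP => e e0.
  have e2 : 0 < e / 2 by rewrite divr_gt0.
  have [c [_ hc]] := cx' _ e2; exists c; rewrite nbhs_simpl/=.
  apply: filterS hc => r hr; rewrite -ball_normE/= distrC.
  by apply: le_lt_trans (ler_norm_enorm _) _; apply: le_lt_trans hr _; lra.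
set v : 'rV[R]_n := lim _ in cF; exists v => //.
apply/eqP; rewrite -subr_eq0 -normr_eq0; apply/eqP/le_anti; rewrite normr_ge0 andbT.
apply/ler_addgt0Pl => e e0; rewrite addr0; have e2 : 0 < e / 2 by rewrite divr_gt0.
have [c [c1 hc]] := cx' _ e2.
have ce : enorm (bq x r - c) @[r --> 0^'+] --> enorm (v - c).
  apply: (@continuous_cvg _ _ _ _ _ (fun s => bq x s - c) (@enorm R n)); first exact: continuous_enorm.
  exact: (cvgB cF (cvg_cst _)).
have vc : enorm (v - c) <= e / 2 by exact: cvgr_to_le ce hc.
apply: le_trans (ler_distD (enorm c) _ _) _; have := ler_dist_enorm v c; lra.
Unshelve. all: by end_near. Qed.

Let domE : vnormal_domain Omega D = Omega `&` (\bigcap_k [set x : T | 0 < fine (tau (eball x k.+1%:R^-1))])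
   `&` \bigcap_j conv j.
Proof.
have bqE x : ball_quotient D x = bq x by apply/funext => r; exact: ball_quotientE.
apply/seteqP; split => x.
  move=> [Ox t0 [v v1]]; rewrite bqE => hv; split; [split => // k _|move=> j _].
    by rewrite /= -vtv_gt0; apply: t0; rewrite invr_gt0.
  exact: cvg_conv hv v1 j.
move=> [[Ox t0] cx]; split => //; first by move=> r r0; rewrite vtv_gt0; apply: tau_pos => // k; exact: t0.
by rewrite bqE; apply: conv_cvg => k; [exact: t0|exact: cx].
Qed.

Let measurable_dom : measurable (vnormal_domain Omega D : set T).
Proof.
rewrite domE; apply: measurableI; first apply: measurableI.
- exact: measurable_open_borelRn.
- apply: bigcapT_measurable => k; rewrite -[X in measurable X]setTI.
  apply: (@measurable_fun_ltr _ _ _ setT (cst 0) (fun x : T => fine (tau (eball x k.+1%:R^-1)))) => //.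
  exact: measurable_eball_measure.
- by apply: bigcapT_measurable => j; exact: measurable_conv.
Qed.


Let natSinv_cvg_right : k.+1%:R^-1 @[k --> \oo] --> (0 : R)^'+.
Proof.
move=> A [del /= del0 hdel].
have [N _ hN] := near_infty_natSinv_lt (PosNum del0).
exists N => // k /= /hN kd; apply: hdel; last by rewrite invr_gt0.
by rewrite /ball_/= sub0r normrN gtr0_norm// invr_gt0.
Qed.

Let vnormal_cvg x : vnormal_domain Omega D x ->
  bq x k.+1%:R^-1 @[k --> \oo] --> vnormal Omega D x.
Proof.
have bqE : ball_quotient D x = bq x by apply/funext => r; exact: ball_quotientE.
move=> dx; rewrite /vnormal mem_set//.
case: (dx) => _ _ [v v1]; rewrite bqE => hv.
rewrite (_ : lim _ = v); last by apply: cvg_lim => //; exact: norm_hausdorff.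
exact: cvg_comp natSinv_cvg_right hv.
Qed.

Let enorm_vnormal x : enorm (vnormal Omega D x) <= 1.
Proof.
rewrite /vnormal; case: ifPn => [|_]; last by rewrite enorm0.
rewrite inE => -[_ _ [v v1 hv]].
rewrite (_ : lim _ = v) ?v1//.
by apply: cvg_lim => //; exact: norm_hausdorff.
Qed.

Let measurable_vnormal i : measurable_fun [set: T] (fun x : T => vnormal Omega D x ord0 i).
Proof.
apply: (@measurable_fun_cvg _ T R setT (fun k (x : T) => \1_(vnormal_domain Omega D) x * bq x k.+1%:R^-1 ord0 i)) => //.
  move=> k; apply: measurable_funM; first exact: measurable_indic.
  exact: measurableT_comp (measurable_coord i) (measurable_bq _).
move=> x _ /=; rewrite indicE.
have [dx|dx] := boolP (x \in vnormal_domain Omega D).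
  under eq_fun do rewrite mul1r; apply: cvg_rV_coord.
  by apply: vnormal_cvg; rewrite inE in dx.
under eq_fun do rewrite mul0r; rewrite /vnormal (negbTE dx) mxE; exact: cvg_cst.
Qed.

(** At a Lebesgue point of both [g] and |g| where [g] does not vanish, dividing the two averages
    shows that the ball quotient tends to g/|g|. The same averages give positive variation to every
    ball around the point, and [gO] places it in [Omega]. *)
Let vnormal_ae : {ae lam, forall x : T, g x = enorm (g x) *: vnormal Omega D x}.
Proof.
have h1 : {ae lam, forall x : T, forall i,
  (fine (lam (eball x r)))^-1 * \int[lam]_(y in eball x r) gi i y @[r --> 0^'+] --> gi i x}.
  by apply: filter_forall => i; exact: (lebesgue_differentiation_eball n1 (ig i)).
have h2 := lebesgue_differentiation_eball n1 ie.
apply: (ae_imply2 _ h1 h2) => x hi he.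
have [->|g0] := eqVneq (g x) 0; first by rewrite enorm0 scale0r.
have e0 : 0 < enorm (g x) by rewrite enorm_gt0.
pose v := (enorm (g x))^-1 *: g x.
have v1 : enorm v = 1 by rewrite enormZ gtr0_norm ?invr_gt0// mulVf// gt_eqF.
have lB r : 0 < r -> fine (lam (eball x r)) != 0.
  by move=> r0; have [l [l0 lE _]] := lebesgue_eball n1 x r0; rewrite lE/= gt_eqF.
have tauE r : fine (tau (eball x r)) = \int[lam]_(y in eball x r) enorm (g y) by [].
have hv : bq x r @[r --> 0^'+] --> v.
  apply: cvg_rV => i; rewrite mxE.
  have : ((fine (lam (eball x r)))^-1 * \int[lam]_(y in eball x r) enorm (g y))^-1 *
    ((fine (lam (eball x r)))^-1 * \int[lam]_(y in eball x r) gi i y) @[r --> 0^'+] -->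
    (enorm (g x))^-1 * g x ord0 i.
    by apply: cvgM (hi i); apply: cvgV he; rewrite gt_eqF.
  apply: cvg_trans; apply: near_eq_cvg; near=> r.
  have r0 : 0 < r by near: r; exact: nbhs_right_gt.
  rewrite !mxE tauE -fineDE; last exact: measurable_eball.
  rewrite DE; last exact: measurable_eball.
  rewrite invfM invrK mulrACA divff ?mul1r// lB//.
have tpos r : 0 < r -> 0 < fine (tau (eball x r)).
  move=> r0; have : \forall s \near 0^'+, 0 < (fine (lam (eball x s)))^-1 * \int[lam]_(y in eball x s) enorm (g y).
    exact: (cvgr_gt _ he).
  move=> hs; have [s [s0 sr hs']] : exists s : R, [/\ 0 < s, s < r & 0 < (fine (lam (eball x s)))^-1 * \int[lam]_(y in eball x s) enorm (g y)].
    apply: (@filter_ex _ (0^'+)); near=> s; split.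
    - near: s; exact: nbhs_right_gt.
    - near: s; exact: nbhs_right_lt.
    - by near: s.
  have ts : 0 < fine (tau (eball x s)).
    rewrite lt_neqAle fine_ge0// andbT eq_sym; apply: contraTneq hs' => h.
    by rewrite -tauE h mulr0 ltxx.
  apply: lt_le_trans ts _; apply: fine_le; rewrite ?fin_num_measure//; try exact: measurable_eball.
  apply: le_measure; rewrite ?inE; try exact: measurable_eball.
  by move=> y /lt_trans; apply.
have bqE : ball_quotient D x = bq x by apply/funext => r; exact: ball_quotientE.
have dx : vnormal_domain Omega D x.
  split; first by apply: contrapT => /gO; exact/eqP.
    by move=> r r0; rewrite vtv_gt0 tpos.
  by exists v => //; rewrite bqE.
rewrite /vnormal mem_set// bqE (_ : lim _ = v); last by apply: cvg_lim => //; exact: norm_hausdorff.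
by rewrite /v scalerA divff ?scale1r// gt_eqF.
Unshelve. all: by end_near. Qed.

Lemma polar_density_vnormal : polar_density D (vnormal Omega D).
Proof.
have mE : measurable_fun [set: T] (fun x => enorm (g x)) by apply/measurable_EFinP; exact: measurable_int ie.
have tauE (A : set T) : measurable A -> tau A = (\int[lam]_(x in A) (enorm (g x))%:E)%E by [].
move=> i; split.
  rewrite (eq_setfun_integrable _ _ vtvE).
  apply: (@finite_bounded_integrable _ _ _ tau _ 1); first exact: measurable_vnormal.
  by move=> x; exact: le_trans (ler_coord_enorm _ _) (enorm_vnormal x).
move=> A mA; rewrite (eq_setfun_integral _ _ vtvE) DE//.
rewrite [RHS]integral_mkcond [LHS]integral_mkcond.
rewrite [X in _ = (\int[_]_x X x)%E](_ : _ = EFin \o (fun x => \1_A x * vnormal Omega D x ord0 i)); last first.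
  by apply/funext => x; rewrite /= patchE indicE; case: ifPn => _; rewrite ?mul1r ?mul0r.
have mf : measurable_fun [set: T] (fun x : T => \1_A x * vnormal Omega D x ord0 i).
  by apply: measurable_funM => //; exact: measurable_vnormal.
rewrite [RHS](@integral_density _ _ _ lam tau _ mE (fun x => enorm_ge0 (g x)) tauE _ mf).
apply: ae_eq_integral => //.
- by apply: (iffLR (measurable_restrictT _ mA)); apply: measurable_funTS; exact: measurable_int (ig i).
- by apply/measurable_EFinP; apply: measurable_funM.
- apply: (ae_imply _ vnormal_ae) => x gx _; rewrite patchE indicE/=.
  by case: ifPn => _; rewrite ?mul0r// mul1r [in LHS]gx mxE mulrC.
Qed.

End polar.

(** * Integration by parts for the fractional gradient *)

Section real_fubini.
Local Open Scope ereal_scope.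

(** One of the two parts has infinite integral, so the extended integral is infinite and [fine]
    sends it to 0. *)
Lemma Rintegral_not_integrable d (T : measurableType d) (R : realType)
    (mu : {measure set T -> \bar R}) (f : T -> R) : measurable_fun setT f ->
  ~ mu.-integrable setT (EFin \o f) -> (\int[mu]_x f x = 0)%R.
Proof.
move=> mf nf; have mE : measurable_fun setT (EFin \o f) by exact/measurable_EFinP.
rewrite /Rintegral integralE.
have p0 : 0 <= \int[mu]_x (EFin \o f)^\+ x by exact: integral_ge0.
have m0 : 0 <= \int[mu]_x (EFin \o f)^\- x by exact: integral_ge0.
have [hm|] := ltP (\int[mu]_x (EFin \o f)^\- x) +oo; last first.
  by rewrite leye_eq => /eqP ->; case: (\int[mu]_x _).
have [hp|] := ltP (\int[mu]_x (EFin \o f)^\+ x) +oo; last first.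
  rewrite leye_eq => /eqP ->; move: m0 hm; by case: (\int[mu]_x _).
exfalso; apply: nf; apply/integrableP; split => //.
rewrite -[X in X < _]/(\int[mu]_x ((abse \o (EFin \o f)) x)) fune_abse.
rewrite ge0_integralD//; last 2 first.
- exact: measurable_funepos.
- exact: measurable_funeneg.
exact: lte_add_pinfty.
Qed.

(** In the non-integrable case both sides are 0. Constants can thus be moved for every section of a
    double integral, not just for almost every one. *)
Lemma RintegralZl_total d (T : measurableType d) (R : realType)
    (mu : {measure set T -> \bar R}) (f : T -> R) (c : R) : measurable_fun setT f ->
  (\int[mu]_x (c * f x) = c * \int[mu]_x f x)%R.
Proof.
move=> mf; have [fi|nf] := pselect (mu.-integrable setT (EFin \o f)).
  by rewrite RintegralZl.
have [->|c0] := eqVneq c 0%R.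
  by rewrite mul0r; under eq_Rintegral do rewrite mul0r; rewrite Rintegral_cst// mul0r.
rewrite (Rintegral_not_integrable mf nf) mulr0 Rintegral_not_integrable//.
  by apply: measurable_funM.
move=> h; apply: nf.
rewrite (_ : EFin \o f = (fun x => c^-1%:E * (c * f x)%:E)); first exact: integrableZl.
by apply/funext => x /=; rewrite -EFinM mulKf.
Qed.

Context d1 d2 (X : measurableType d1) (Y : measurableType d2) (R : realType).
Variables (m1 : {sigma_finite_measure set X -> \bar R}) (m2 : {sigma_finite_measure set Y -> \bar R}).
Variable f : X * Y -> R.
Hypothesis fi : (m1 \x m2).-integrable setT (EFin \o f).

Let mf : measurable_fun setT f.
Proof. by apply/measurable_EFinP; exact: measurable_int fi. Qed.

Let F x := \int[m2]_y (f (x, y))%:E.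
Let G y := \int[m1]_x (f (x, y))%:E.

Let FE : ae_eq m1 setT (EFin \o fine \o F) F.
Proof.
have := ae_integrable1 fi; apply: ae_imply => x xi _ /=.
by rewrite fineK//; exact: integrable_fin_num.
Qed.

Let GE : ae_eq m2 setT (EFin \o fine \o G) G.
Proof.
have := ae_integrable2 fi; apply: ae_imply => x xi _ /=.
by rewrite fineK//; exact: integrable_fin_num.
Qed.

Let iF : m1.-integrable setT F := integrable_fubini_F fi.
Let iG : m2.-integrable setT G.
Proof.
apply: (@integrable_fubini_F _ _ _ _ _ m2 m1 (fun p => (f (p.2, p.1))%:E)).
apply/integrable12ltyP.
  apply/measurable_EFinP; apply: (measurableT_comp mf).
  exact: (measurable_fun_pair measurable_snd measurable_fst).
exact: (integrable21ltyP _ _ (measurable_int _ fi)).1 fi.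
Qed.

Let mfine d (T : measurableType d) (H : T -> \bar R) : measurable_fun setT H ->
  measurable_fun setT (EFin \o fine \o H).
Proof.
by move=> mH; apply/measurable_EFinP; apply: measurableT_comp mH; exact: fine_measurable.
Qed.

Let le_abse_fine (x : \bar R) : `|(fine x)%:E| <= `|x|.
Proof. by case: x => [r| |]//=; rewrite normr0 leey. Qed.

Lemma integrable_Rfubini1 :
  m1.-integrable setT (EFin \o (fun x => \int[m2]_y f (x, y))%R).
Proof.
apply: le_integrable iF => //; first by apply: mfine; exact: measurable_int iF.
by move=> x _; exact: le_abse_fine.
Qed.

Lemma integrable_Rfubini2 :
  m2.-integrable setT (EFin \o (fun y => \int[m1]_x f (x, y))%R).
Proof.
apply: le_integrable iG => //; first by apply: mfine; exact: measurable_int iG.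
by move=> x _; exact: le_abse_fine.
Qed.

(** Almost every section is integrable, so [fine] alters the iterated integrands only on null
    sets. *)
Lemma Rfubini :
  (\int[m1]_x (\int[m2]_y f (x, y)) = \int[m2]_y (\int[m1]_x f (x, y)))%R.
Proof.
have hF := ae_eq_integral _ _ measurableT (mfine (measurable_int _ iF)) (measurable_int _ iF) FE.
have hG := ae_eq_integral _ _ measurableT (mfine (measurable_int _ iG)) (measurable_int _ iG) GE.
rewrite /Rintegral; congr fine.
by transitivity (\int[m1]_x F x); [exact: hF|rewrite (Fubini fi)].
Qed.

End real_fubini.

(** * Odd kernels and nonlocal integration by parts *)

Section nonlocal.
Context {R : realType} {n : nat}.
Local Notation T := (borelRn R n).
Local Notation lam := (lebesgue_borelRn R n).

Lemma measurable_translate_pair (f : 'rV[R]_n -> R) : measurable_fun [set: T] f ->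
  measurable_fun [set: T * T] (fun p : T * T => f ((p.1 : 'rV[R]_n) + p.2)).
Proof.
move=> mf; apply: (measurableT_comp mf).
by apply: measurable_addv; [exact: measurable_fst|exact: measurable_snd].
Qed.

Lemma Rintegral_translate (f : 'rV[R]_n -> R) v : measurable_fun [set: T] f ->
  \int[lam]_x f (x + v) = \int[lam]_x f x.
Proof.
by move=> mf; congr fine; apply: (@integral_translate _ _ (EFin \o f)); exact/measurable_EFinP.
Qed.

Lemma Rintegral_reflect (f : 'rV[R]_n -> R) : measurable_fun [set: T] f ->
  \int[lam]_x f (- x) = \int[lam]_x f x.
Proof.
by move=> mf; congr fine; apply: (@integral_reflect _ _ (EFin \o f)); exact/measurable_EFinP.
Qed.

Lemma measurable_translate (f : 'rV[R]_n -> R) v : measurable_fun [set: T] f ->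
  measurable_fun [set: T] (fun x : T => f ((x : 'rV[R]_n) + v)).
Proof.
by move=> mf; apply: (measurableT_comp mf); apply: measurable_addv.
Qed.

Lemma integrable_translate (f : 'rV[R]_n -> R) v : lam.-integrable [set: T] (EFin \o f) ->
  lam.-integrable [set: T] (EFin \o (fun x => f (x + v))).
Proof.
move=> /integrableP[/measurable_EFinP mf fi]; apply/integrableP; split.
  by apply/measurable_EFinP; exact: measurable_translate.
rewrite (integral_translate (f := fun x => `|(f x)%:E|%E))//.
by apply/measurable_EFinP; exact: measurableT_comp.
Qed.

Section by_parts.
Variables (K h c : 'rV[R]_n -> R).
Hypotheses (mK : measurable_fun [set: T] K) (mc : measurable_fun [set: T] c).
Hypotheses (KN : forall z, K (- z) = - K z) (c1 : forall x, `|c x| <= 1).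
Hypothesis ih : lam.-integrable [set: T] (EFin \o h).
Hypothesis i1 : (lam \x lam)%E.-integrable [set: T * T]
  (EFin \o (fun p : T * T => c p.1 * (K p.2 * (h ((p.1 : 'rV[R]_n) + p.2) - h p.1)))).
Hypothesis i2 : (lam \x lam)%E.-integrable [set: T * T]
  (EFin \o (fun p : T * T => h p.1 * (K p.2 * (c ((p.1 : 'rV[R]_n) + p.2) - c p.1)))).

Let mh : measurable_fun [set: T] h.
Proof. by apply/measurable_EFinP; exact: measurable_int ih. Qed.

Let mD (u : 'rV[R]_n -> R) (x : 'rV[R]_n) : measurable_fun [set: T] u ->
  measurable_fun [set: T] (fun z : T => K z * (u (x + z) - u x)).
Proof.
move=> mu; apply: measurable_funM => //; apply: measurable_funB => //.
by apply: (measurableT_comp mu); apply: measurable_addv.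
Qed.

Let swap (u v : 'rV[R]_n -> R) : measurable_fun [set: T] u -> measurable_fun [set: T] v ->
  (lam \x lam)%E.-integrable [set: T * T]
    (EFin \o (fun p : T * T => u p.1 * (K p.2 * (v ((p.1 : 'rV[R]_n) + p.2) - v p.1)))) ->
  \int[lam]_x (u x * \int[lam]_z (K z * (v (x + z) - v x))) =
  \int[lam]_z (K z * \int[lam]_x (u x * (v (x + z) - v x))).
Proof.
move=> mu mv uv.
transitivity (\int[lam]_x (\int[lam]_z (u x * (K z * (v (x + z) - v x))))).
  by apply: eq_Rintegral => x _; rewrite RintegralZl_total//; exact: mD.
rewrite (Rfubini uv)/=; apply: eq_Rintegral => z _.
rewrite -RintegralZl_total; last first.
  by apply: measurable_funM => //; apply: measurable_funB => //; exact: measurable_translate.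
by apply: eq_Rintegral => x _; rewrite mulrCA.
Qed.

(** After Fubini the kernel multiplies A(z), the integral of c times the z-increment of h, or B(z),
    with the roles exchanged. Translation by z gives A(-z) = B(z): the two terms c h cancel at fixed
    z, where everything is integrable. The sign comes from z -> -z and oddness. *)
Lemma nonlocal_by_parts :
  \int[lam]_x (c x * \int[lam]_z (K z * (h (x + z) - h x))) =
  - \int[lam]_x (h x * \int[lam]_z (K z * (c (x + z) - c x))).
Proof.
rewrite (swap mc mh i1) (swap mh mc i2).
pose A z := \int[lam]_x (c x * (h (x + z) - h x)).
pose B z := \int[lam]_x (h x * (c (x + z) - c x)).
have ich v : lam.-integrable [set: T] (EFin \o (fun x => c (x + v) * h x)).
  apply: (@integrable_bounded_mul _ T R lam setT measurableT h (fun x => c (x + v)) 1) => //.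
  exact: measurable_translate.
have ich' v : lam.-integrable [set: T] (EFin \o (fun x => c x * h (x + v))).
  apply: (@integrable_bounded_mul _ T R lam setT measurableT (fun x => h (x + v)) c 1) => //.
  exact: integrable_translate.
have ich0 : lam.-integrable [set: T] (EFin \o (fun x => c x * h x)).
  exact: (@integrable_bounded_mul _ T R lam setT measurableT h c 1).
have AB z : A (- z) = B z.
  rewrite /A /B; under eq_Rintegral do rewrite mulrBr.
  rewrite (RintegralB measurableT (ich' (- z)) ich0).
  under [in RHS]eq_Rintegral do rewrite mulrBr (mulrC (h _)) (mulrC (h _)).
  rewrite (RintegralB measurableT (ich z) ich0).
  congr (_ - _); rewrite -[LHS](Rintegral_translate z); last first.
    by apply: measurable_funM => //; exact: measurable_translate.
  by apply: eq_Rintegral => x _; rewrite addrK.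
have mKA : measurable_fun [set: T] (fun z => K z * A z).
  have := measurable_int _ (integrable_Rfubini2 i1).
  move=> /measurable_EFinP; apply: eq_measurable_fun => z _ /=.
  rewrite -RintegralZl_total; last first.
    by apply: measurable_funM => //; apply: measurable_funB => //; exact: measurable_translate.
  by apply: eq_Rintegral => x _; rewrite mulrCA.
rewrite -(Rintegral_reflect mKA) -mulN1r -RintegralZl_total; last first.
  have := measurable_int _ (integrable_Rfubini2 i2).
  move=> /measurable_EFinP; apply: eq_measurable_fun => z _ /=.
  rewrite -RintegralZl_total; last first.
    by apply: measurable_funM => //; apply: measurable_funB => //; exact: measurable_translate.
  by apply: eq_Rintegral => x _; rewrite mulrCA.
by apply: eq_Rintegral => z _; rewrite KN AB mulNr mulN1r.
Qed.

End by_parts.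


Section kernels.
Variables (alpha : R).
Hypotheses (n1 : (1 <= n)%N) (a01 : 0 < alpha < 1).

Definition riesz_kernel (i : 'I_n) (z : 'rV[R]_n) : R :=
  z ord0 i / enorm z `^ (n%:R + alpha + 1).

Lemma measurable_riesz_kernel i : measurable_fun [set: T] (riesz_kernel i).
Proof.
apply: measurable_funM; first exact: measurable_coord.
by apply: measurable_invr; apply: measurable_funpowR; exact: measurable_enorm.
Qed.

Lemma riesz_kernelN i z : riesz_kernel i (- z) = - riesz_kernel i z.
Proof. by rewrite /riesz_kernel enormN mxE mulNr. Qed.

Lemma enorm_powR_S (z : 'rV[R]_n) : z != 0 ->
  enorm z `^ (n%:R + alpha + 1) = enorm z `^ (n%:R + alpha) * enorm z.
Proof.
move=> z0; rewrite powRD ?powRr1 ?enorm_ge0//.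
by apply/implyP => _; rewrite enorm_eq0.
Qed.

Lemma riesz_kernel_le i z : `|riesz_kernel i z| <= (enorm z `^ (n%:R + alpha))^-1.
Proof.
have [->|z0] := eqVneq z 0.
  by rewrite /riesz_kernel mxE mul0r normr0 invr_ge0 powR_ge0.
have e0 : 0 < enorm z by rewrite enorm_gt0.
rewrite /riesz_kernel normrM normfV (ger0_norm (powR_ge0 _ _)) enorm_powR_S//.
rewrite invfM mulrA mulrAC ler_piMl ?invr_ge0 ?powR_ge0//.
by rewrite ler_pdivrMr// mul1r ler_coord_enorm.
Qed.

(** The integrand of the fractional seminorm in the coordinates (x, z) with z = y - x. *)
Definition nonlocal_quotient (c : 'rV[R]_n -> R) (p : T * T) : R :=
  `|c ((p.1 : 'rV[R]_n) + p.2) - c p.1| / enorm p.2 `^ (n%:R + alpha).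

Lemma nonlocal_quotient_ge0 c p : 0 <= nonlocal_quotient c p.
Proof. by rewrite divr_ge0 ?powR_ge0. Qed.

Lemma measurable_nonlocal_quotient c : measurable_fun [set: T] c ->
  measurable_fun [set: T * T] (nonlocal_quotient c).
Proof.
move=> mc; apply: measurable_funM.
  apply: measurableT_comp => //; apply: measurable_funB.
    exact: measurable_translate_pair.
  exact: measurableT_comp mc measurable_fst.
apply: measurable_invr; apply: measurable_funpowR; apply: measurable_enorm.
exact: measurable_snd.
Qed.

Lemma measurable_riesz_difference i (u v : 'rV[R]_n -> R) :
  measurable_fun [set: T] u -> measurable_fun [set: T] v ->
  measurable_fun [set: T * T]
   (fun p : T * T => u p.1 * (riesz_kernel i p.2 * (v ((p.1 : 'rV[R]_n) + p.2) - v p.1))).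
Proof.
move=> mu mv; apply: measurable_funM; first exact: measurableT_comp mu measurable_fst.
apply: measurable_funM; first exact: measurableT_comp (measurable_riesz_kernel i) measurable_snd.
apply: measurable_funB; first exact: measurable_translate_pair.
exact: measurableT_comp mv measurable_fst.
Qed.

Lemma riesz_difference_le i c (x z : 'rV[R]_n) :
  `|riesz_kernel i z * (c (x + z) - c x)| <= nonlocal_quotient c (x, z).
Proof. by rewrite normrM /nonlocal_quotient mulrC ler_wpM2l// riesz_kernel_le. Qed.

(** Here the increment falls on a function with no regularity, such as an indicator; its
    integrability over [A] is the finiteness of the fractional perimeter. *)
Lemma integrable_riesz_rough i (h c : 'rV[R]_n -> R) (M : R) (A : set T) :
  measurable_fun [set: T] h -> measurable_fun [set: T] c -> measurable A ->
  (forall x, `|h x| <= M) -> (forall x, ~ A x -> h x = 0) ->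
  (lam \x lam)%E.-integrable [set: T * T]
    (EFin \o (fun p : T * T => \1_A p.1 * nonlocal_quotient c p)) ->
  (lam \x lam)%E.-integrable [set: T * T]
    (EFin \o (fun p : T * T => h p.1 * (riesz_kernel i p.2 * (c ((p.1 : 'rV[R]_n) + p.2) - c p.1)))).
Proof.
move=> mh mc mA hM hA ic.
have M0 : 0 <= M by exact: le_trans (normr_ge0 _) (hM 0).
apply: (@le_integrable _ _ _ _ _ measurableT _
   (EFin \o (fun p : T * T => M * (\1_A p.1 * nonlocal_quotient c p)))).
- by apply/measurable_EFinP; exact: measurable_riesz_difference.
- move=> [x z] _ /=; rewrite lee_fin normrM [leRHS]normrM (ger0_norm M0).
  have [/set_mem xA|/negP xA] := boolP (x \in A).
    rewrite indicE mem_set// mul1r (ger0_norm (nonlocal_quotient_ge0 _ _)).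
    by apply: ler_pM => //; exact: riesz_difference_le.
  rewrite hA ?normr0 ?mul0r ?mulr_ge0//.
  by move=> h'; apply: xA; exact: mem_set.
- under [X in _.-integrable _ X]eq_fun do rewrite /= EFinM.
  exact: integrableZl.
Qed.

Lemma fkernelE (z : 'rV[R]_n) : fkernel alpha z = Num.min 1 (enorm z) / enorm z `^ (n%:R + alpha).
Proof. by []. Qed.

(** The increment of [h] vanishes unless x or x + z lies in [A], so it is dominated by L min(1, |z|)
    times a sum of two indicators. Integrating in x first leaves 2 |A| L [fkernel]. *)
Lemma integrable_riesz_smooth i (h c : 'rV[R]_n -> R) (L : R) (A : set T) :
  measurable_fun [set: T] h -> measurable_fun [set: T] c -> measurable A -> (lam A < +oo)%E ->
  (forall x, `|c x| <= 1) -> (forall x, ~ A x -> h x = 0) -> 0 <= L ->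
  (forall x z, `|h (x + z) - h x| <= L * Num.min 1 (enorm z)) ->
  (lam \x lam)%E.-integrable [set: T * T]
    (EFin \o (fun p : T * T => c p.1 * (riesz_kernel i p.2 * (h ((p.1 : 'rV[R]_n) + p.2) - h p.1)))).
Proof.
move=> mh mc mA Aoo c1 hA L0 hL.
have mI : measurable_fun [set: T] (\1_A : T -> R) by exact: measurable_indic.
have iI : lam.-integrable [set: T] (EFin \o (\1_A : T -> R)).
  exact: integrable_indic_lty.
pose dom (p : T * T) : R := L * fkernel alpha p.2 * (\1_A p.1 + \1_A ((p.1 : 'rV[R]_n) + p.2)).
have dom0 p : 0 <= dom p.
  apply: mulr_ge0; first exact: (mulr_ge0 L0 (fkernel_ge0 _ _)).
  by apply: addr_ge0; rewrite indicE ler0n.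
apply: (@le_integrable _ _ _ _ _ measurableT _ (EFin \o dom)).
- by apply/measurable_EFinP; exact: measurable_riesz_difference.
- move=> [x z] _ /=; rewrite lee_fin (ger0_norm (dom0 _)) normrM.
  apply: (@le_trans _ _ (nonlocal_quotient h (x, z))).
    rewrite -[leRHS]mul1r; apply: ler_pM => //; exact: riesz_difference_le.
  have [/not_orP[nA nA']|AA] := pselect (~ (A x \/ A (x + z))).
    by rewrite /nonlocal_quotient/= !hA// subrr normr0 mul0r dom0.
  have I1 : 1 <= \1_A x + \1_A (x + z) :> R.
    have [ax|ax] : A x \/ A (x + z) by apply: contrapT.
      by rewrite [X in X + _]indicE mem_set// lerDl indicE ler0n.
    by rewrite [X in _ + X]indicE mem_set// lerDr indicE ler0n.
  rewrite /dom/= -[leLHS]mulr1; apply: ler_pM => //; first exact: nonlocal_quotient_ge0.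
  by rewrite /nonlocal_quotient/= fkernelE mulrA ler_wpM2r// invr_ge0 powR_ge0.
- have md : measurable_fun [set: T * T] dom.
    apply: measurable_funM.
      apply: measurable_funM; first exact: measurable_cst.
      by apply: (measurableT_comp (@measurable_fkernel R n alpha)); exact: measurable_snd.
    apply: measurable_funD; first exact: measurableT_comp mI measurable_fst.
    exact: measurable_translate_pair.
  apply/integrable21ltyP; first exact/measurable_EFinP.
  have aE : lam A = (fine (lam A))%:E by rewrite fineK// ge0_fin_numE.
  have iIE : (\int[lam]_x (EFin \o (\1_A : T -> R)) x)%E = (fine (lam A))%:E.
    by rewrite -aE; transitivity (lam (A `&` setT)); [exact: integral_indic|rewrite setIT].
  have inner (z : T) : (\int[lam]_x `|(EFin \o dom) (x, z)| = (fkernel alpha z * (L * (fine (lam A) *+ 2)))%:E)%E.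
    under eq_integral do rewrite /= ger0_norm//.
    rewrite /dom/=; under eq_integral do rewrite EFinM.
    have iJ := integrable_translate z iI.
    rewrite integralZl//; last exact: (integrableD measurableT iI iJ).
    under eq_integral do rewrite EFinD.
    rewrite (integralD measurableT iI iJ).
    rewrite (integral_translate (f := EFin \o \1_A)); last exact/measurable_EFinP.
    rewrite iIE -EFinD -EFinM; congr EFin; ring.
  under eq_integral do rewrite inner.
  under eq_integral do rewrite EFinM.
  have := integrableZr measurableT (L * (fine (lam A) *+ 2)) (integrable_fkernel n1 a01).
  exact: integrable_lty.
Qed.

End kernels.

End nonlocal.

(** * Quantitative bounds for Lipschitz and smooth fields *)

Section lipschitz_fields.
Context {R : realType} {n : nat}.
Local Notation T := (borelRn R n).
Local Notation lam := (lebesgue_borelRn R n).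
Implicit Types (phi : 'rV[R]_n -> 'rV[R]_n).

Lemma is_derive_coord phi x v df j : is_derive x v phi df ->
  is_derive x v (fun y => phi y ord0 j) (df ord0 j).
Proof.
move=> [dv dE]; have cv : (fun h => h^-1 *: (phi (h *: v + x) - phi x)) @ (0 : R)^' --> df.
  by rewrite -dE; exact: dv.
have cj : (fun h => h^-1 *: (phi (h *: v + x) ord0 j - phi x ord0 j)) @ (0 : R)^' --> df ord0 j.
  rewrite (_ : (fun h => _) = (fun h => (h^-1 *: (phi (h *: v + x) - phi x)) ord0 j)).
    exact: cvg_rV_coord cv.
  by apply/funext => h; rewrite !mxE.
apply: DeriveDef; first by apply/cvg_ex; exists (df ord0 j).
exact: cvg_lim.
Qed.

Lemma directional_lipschitz (h dh : 'rV[R]_n -> R) (v : 'rV[R]_n) (L : R) :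
  (forall x, is_derive x v h (dh x)) -> (forall x, `|dh x| <= L) ->
  forall x t, `|h (t *: v + x) - h x| <= L * `|t|.
Proof.
move=> dE dL.
suff H x (t : R) : 0 <= t -> `|h (t *: v + x) - h x| <= L * `|t|.
  move=> x t; have [t0|t0] := leP 0 t; first exact: H.
  have := H (t *: v + x) (- t); rewrite oppr_ge0 ltW// => /(_ isT).
  by rewrite addrA -scalerDl addNr scale0r add0r normrN distrC.
move=> t0; pose f s := h (s *: v + x).
have df (s : R) := (is_derive_line h x v s (dh (s *: v + x))).1 (dE _).
have cf : {within `[0, t], continuous f}.
  by apply: derivable_within_continuous => s _; exact: ex_derive.
have [c _] := MVT_segment t0 (fun s _ => df s) cf.
rewrite /f scale0r add0r subr0 => ->; rewrite normrM ler_wpM2r//.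
Qed.

(* telescoping along the coordinate axes *)
Lemma partial_lipschitz (h : 'rV[R]_n -> R) (dh : 'I_n -> 'rV[R]_n -> R) (L : R) :
  (forall i x, is_derive x (basisv i) h (dh i x)) -> (forall i x, `|dh i x| <= L) -> 0 <= L ->
  forall x z, `|h (x + z) - h x| <= L * (n%:R * `|z|).
Proof.
move=> dE dL L0 x z.
pose s (k : seq 'I_n) := \sum_(i <- k) z ord0 i *: basisv i.
have H k : `|h (x + s k) - h x| <= L * (\sum_(i <- k) `|z ord0 i|).
  elim: k => [|i k IH]; first by rewrite /s !big_nil addr0 subrr normr0 mulr0.
  rewrite /s !big_cons (addrCA x) -/(s k) mulrDr.
  rewrite -(subrKA (h (x + s k))) (le_trans (ler_normD _ _))// lerD//.
  exact: directional_lipschitz.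
have -> : x + z = x + s (index_enum 'I_n) by congr (_ + _); rewrite /s [LHS]row_sum_delta.
apply: le_trans (H _) _; rewrite ler_wpM2l//.
have -> : n%:R * `|z| = \sum_(i < n) `|z| by rewrite sumr_const card_ord mulr_natl.
by apply: ler_sum => i _; exact: ler_coord_norm.
Qed.

Lemma compactly_supported_bound (V : normedModType R) (f : 'rV[R]_n -> V) (A : set 'rV[R]_n) :
  continuous f -> compact A -> (forall x, ~ A x -> f x = 0) -> exists2 M : R, 0 <= M & forall x, `|f x| <= M.
Proof.
move=> cf cA f0; have : compact (f @` A) by apply: continuous_compact => //; exact: continuous_subspaceT.
move=> /compact_bounded[M [_ hM]]; exists (`|M| + 1); first by rewrite addr_ge0.
move=> x; have [Ax|/f0 ->] := pselect (A x); last by rewrite normr0 addr_ge0.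
by apply: hM; [rewrite (le_lt_trans (ler_norm M))// ltrDl|exists x].
Qed.

Lemma Cinfty_c_derive (Omega : set 'rV[R]_n) phi : Cinfty_c Omega phi ->
  [/\ continuous phi, forall i x, is_derive x (basisv i) phi ('D_(basisv i) phi x),
   forall i, continuous (fun x => 'D_(basisv i) phi x)
  & forall i x, ~ closure [set x | phi x != 0] x -> 'D_(basisv i) phi x = 0].
Proof.
move=> [/(_ 1%N) [cphi dphi] _]; split => //.
- by move=> i x; apply: DeriveDef => //; exact: (dphi i).1.
- by move=> i; exact: (dphi i).2.1.
move=> i x nx; rewrite -[RHS](derive_cst 0 x (basisv i)); apply: near_eq_derive.
have : nbhs x (~` closure [set x | phi x != 0]).
  by apply: open_nbhs_nbhs; split => //; apply: closed_openC; exact: closed_closure.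
apply: filterS => y ny /=; apply/eqP; apply: contrapT => /negP h; apply: ny.
exact: subset_closure.
Qed.

Lemma Cinfty_c_Lip_c (Omega : set 'rV[R]_n) phi : Cinfty_c Omega phi -> Lip_c Omega phi.
Proof.
move=> cphi; have [cont der cder zder] := Cinfty_c_derive cphi.
case: cphi => _ [cK KO]; split; last by split.
have /choice[M hM] : forall i, exists M : R, 0 <= M /\ forall x, `|'D_(basisv i) phi x| <= M.
  by move=> i; have [M M0 hM] := compactly_supported_bound (cder i) cK (zder i); exists M.
pose L := \sum_i M i.
have L0 : 0 <= L by apply: sumr_ge0 => i _; exact: (hM i).1.
have ML i : M i <= L.
  by rewrite /L (bigD1 i)//= lerDl; apply: sumr_ge0 => j _; exact: (hM j).1.
exists (L * n%:R); split; first exact: num_real.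
move=> K LK [x y] _ /=; apply: (@le_trans _ _ (L * n%:R * `|x - y|)); last exact: ler_wpM2r (ltW LK).
rewrite [leLHS]mx_normrE; apply/bigmax_leP; split; first by rewrite !mulr_ge0.
move=> [a j] _ /=; rewrite (ord1 a) !mxE -mulrA.
suff : `|phi (y + (x - y)) ord0 j - phi y ord0 j| <= L * (n%:R * `|x - y|) by rewrite subrKC.
apply: (@partial_lipschitz (fun u => phi u ord0 j) (fun i u => 'D_(basisv i) phi u ord0 j)) => //.
  by move=> i u; exact: is_derive_coord.
move=> i u; exact: le_trans (le_trans (ler_coord_norm _ _) ((hM i).2 u)) (ML i).
Qed.

(** The constant K + 2 M merges the Lipschitz bound, used for |z| < 1, with twice the supremum, used
    otherwise; this is the form that pairs with [fkernel]. *)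
Lemma Lip_c_bounds (Omega : set 'rV[R]_n) phi : (1 <= n)%N -> Lip_c Omega phi ->
  exists L M A, [/\ 0 <= L, [/\ measurable (A : set T), (lam A < +oo)%E & A `<=` Omega],
   continuous phi /\ (forall x, ~ A x -> phi x = 0), forall x, `|phi x| <= M &
   forall i x z, `|phi (x + z) ord0 i - phi x ord0 i| <= L * Num.min 1 (enorm z)].
Proof.
move=> n1 [[k [_ hk]] [cA AO]].
pose K := `|k| + 1; have K0 : 0 <= K by rewrite addr_ge0.
have hK x y : `|phi x - phi y| <= K * `|x - y|.
  by apply: (hk K _ (x, y)) => //; rewrite (le_lt_trans (ler_norm k))// ltrDl.
have cont : continuous phi.
  move=> x B /nbhs_ballP[e /= e0 eB]; apply/nbhs_ballP; exists (e / (K + 1)); first by rewrite /= divr_gt0// ltr_wpDl.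
  move=> y; rewrite -ball_normE/= ltr_pdivlMr ?ltr_wpDl// => h.
  apply: eB; rewrite -ball_normE/=.
  apply: le_lt_trans (hK _ _) _; apply: le_lt_trans h; rewrite mulrC ler_wpM2l// lerDl//.
set A := closure _ in cA AO.
have phi0 x : ~ A x -> phi x = 0.
  move=> nA; apply/eqP; apply: contrapT => /negP h; apply: nA; exact: subset_closure.
have [M M0 hM] := compactly_supported_bound cont cA phi0.
exists (K + M *+ 2), M, A; split => //.
- by rewrite addr_ge0// mulrn_wge0.
- split => //; first by apply: measurable_closed_borelRn; exact: closed_closure.
  have /compact_bounded[r [_ hr]] := cA.
  have r0 : 0 < `|r| + 2 by rewrite ltr_wpDl.
  apply: (@le_lt_trans _ _ (lam (ball (0 : 'rV[R]_n) (`|r| + 2)))).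
    apply: le_measure; rewrite ?inE.
    - by apply: measurable_closed_borelRn; exact: closed_closure.
    - by apply: measurable_open_borelRn; exact: ball_open.
    - move=> x Ax; rewrite -ball_normE/= sub0r normrN.
      apply: (@le_lt_trans _ _ (`|r| + 1)); last by rewrite ltrD2l ltr1n.
      by apply: hr => //; rewrite (le_lt_trans (ler_norm r))// ltrDl.
  by rewrite lebesgue_ball// ltry.
- move=> i x z; have : `|phi (x + z) ord0 i - phi x ord0 i| <= `|phi (x + z) - phi x|.
    by have := ler_coord_norm (phi (x + z) - phi x) i; rewrite !mxE.
  move=> /le_trans; apply; have [ez|ez] := leP 1 (enorm z).
    rewrite mulr1; apply: le_trans (ler_normB _ _) _.
    by rewrite mulr2n (le_trans (lerD (hM _) (hM _)))// lerDr.
  apply: le_trans (hK _ _) _; rewrite addrAC subrr add0r.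
  apply: ler_pM => //; last exact: ler_norm_enorm.
  by rewrite lerDl mulrn_wge0.
Qed.

End lipschitz_fields.

Lemma continuous_rV_coord {R : realType} {n : nat} (f : 'rV[R]_n -> 'rV[R]_n) i :
  continuous f -> continuous (fun x => f x ord0 i : R).
Proof.
move=> cf x; apply: (@continuous_comp _ _ _ f (fun M : 'rV[R]_n => M ord0 i)).
  exact: cf.
exact: coord_continuous.
Qed.

(** * Reduction of the fractional operators to Borel integrals *)

Section borel_representation.
Context {R : realType} {n : nat}.
Local Notation T := (borelRn R n).
Local Notation lam := (lebesgue_borelRn R n).
Local Notation Leb := (lebesgueRn R n).

Lemma mu_frac_ge0 (alpha : R) : 0 <= mu_frac n alpha.
Proof.
rewrite /mu_frac !mulr_ge0 ?powR_ge0 ?invr_ge0// /GammaR; apply: Rintegral_ge0 => x _;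
  by rewrite mulr_ge0 ?powR_ge0 ?expR_ge0.
Qed.

Lemma ae_integral_lebesgueRn (f g : 'rV[R]_n -> \bar R) :
  measurable_fun [set: T] g -> {ae lam, forall x, f x = g x} ->
  (\int[Leb]_x f x = \int[lam]_x g x)%E.
Proof. exact: (@ae_integral_completed _ T R lam). Qed.

Lemma ae_integral_lebesgueRn_in (B : set 'rV[R]_n) (f g : 'rV[R]_n -> \bar R) :
  measurable (B : set T) -> measurable_fun [set: T] g -> {ae lam, forall x, f x = g x} ->
  (\int[Leb]_(x in B) f x = \int[lam]_x ((\1_B x)%:E * g x))%E.
Proof.
move=> mB mg fg; rewrite integral_mkcond; apply: ae_integral_lebesgueRn.
  by apply: emeasurable_funM => //; apply/measurable_EFinP; exact: measurable_indic.
apply: (ae_imply _ fg) => x fgx; rewrite patchE indicE.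
by case: ifPn; rewrite ?mul1e ?mul0e.
Qed.

Lemma ae_integrable_lebesgueRn (f g : 'rV[R]_n -> \bar R) :
  measurable_fun [set: T] g -> {ae lam, forall x, f x = g x} ->
  Leb.-integrable setT f <-> lam.-integrable setT g.
Proof. exact: (@ae_integrable_completed _ T R lam). Qed.

Lemma ae_lebesgueRn (P : 'rV[R]_n -> Prop) :
  {ae lam, forall x, P x} <-> {ae Leb, forall x, P x}.
Proof. exact: (@ae_completed _ T R lam). Qed.

Variables (alpha : R) (E F : set 'rV[R]_n).
Hypotheses (n1 : (1 <= n)%N) (a01 : 0 < alpha < 1).
Hypotheses (mF : measurable (F : set T)) (EF : {ae lam, forall x, E x <-> F x}).

Let chi : 'rV[R]_n -> R := \1_F.

Let mchi : measurable_fun [set: T] chi.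
Proof. exact: (@measurable_indic _ T). Qed.

Let chi_le1 x : `|chi x| <= 1.
Proof. by rewrite /chi indicE; case: (_ \in _); rewrite ?normr1 ?normr0. Qed.

Let indicEF x : (E x <-> F x) -> \1_E x = chi x.
Proof. by move=> h; rewrite /chi !indicE; congr ((_ : bool)%:R); apply: asbool_equiv_eq. Qed.

Definition nonlocal_grad (i : 'I_n) (x : 'rV[R]_n) : R :=
  mu_frac n alpha * \int[lam]_z (riesz_kernel alpha i z * (chi (x + z) - chi x)).

(** Agreement of [E] and [F] is needed at [x] itself because the value there enters every increment;
    in the integration variable agreement almost everywhere is enough. *)
Lemma frac_gradE x : (E x <-> F x) -> forall i, frac_grad alpha E x ord0 i = nonlocal_grad i x.
Proof.
move=> Ex i; rewrite mxE; congr (_ * _); rewrite /Rintegral; congr fine.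
pose g y := riesz_kernel alpha i (y - x) * (chi y - chi x).
have mg : measurable_fun [set: T] g.
  apply: measurable_funM; last exact: measurable_funB.
  apply: (measurableT_comp (@measurable_riesz_kernel R n alpha i)).
  exact: measurable_subv.
transitivity (\int[lam]_y (g y)%:E)%E.
  apply: ae_integral_lebesgueRn; first exact/measurable_EFinP.
  apply: (ae_imply _ EF) => y Ey; rewrite /g /riesz_kernel mxE !indicEF//.
  by congr EFin; rewrite mulrAC [in RHS]mulrAC (mulrC (chi _ - _)).
rewrite -(integral_translate _ x); last exact/measurable_EFinP.
by apply: eq_integral => z _; rewrite /g addrK (addrC z).
Qed.

Lemma frac_grad_cvgE x : (E x <-> F x) ->
  lam.-integrable [set: T] (fun z => (nonlocal_quotient alpha chi (x, z))%:E) -> frac_grad_cvg alpha E x.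
Proof.
move=> Ex ix; have := integrable_translate (- x) ix => iy.
apply/(ae_integrable_lebesgueRn (measurable_int _ iy)); last exact: iy.
apply: (ae_imply _ EF) => y Ey /=; congr EFin.
rewrite /frac_grad_integrand /nonlocal_quotient/= enormZ subrKC !indicEF//.
(* On the diagonal both expressions are 0, the increment being 0. *)
have [yx|yx] := eqVneq (y - x) 0.
  by rewrite yx enorm0 mulr0 -(subrK x y) yx add0r subrr normr0 mul0r.
rewrite normrM normfV (ger0_norm (powR_ge0 _ _)) enorm_powR_S// invfM.
by rewrite [X in X * _]mulrA divfK// gt_eqF// enorm_gt0.
Qed.

Lemma Rintegral_lebesgueRn_setE (f : 'rV[R]_n -> R) :
  measurable_fun [set: T] (fun x => chi x * f x) ->
  \int[Leb]_(x in E) f x = \int[lam]_x (chi x * f x).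
Proof.
move=> mf; rewrite Rintegral_mkcond /Rintegral; congr fine.
apply: ae_integral_lebesgueRn; first exact/measurable_EFinP.
apply: (ae_imply _ EF) => x Ex; rewrite -(indicEF Ex) patchE indicE.
by case: ifPn => _; rewrite ?mul1r ?mul0r.
Qed.

Lemma Rintegral_lebesgueRn (f : 'rV[R]_n -> R) : measurable_fun [set: T] f ->
  \int[Leb]_x f x = \int[lam]_x f x.
Proof.
move=> mf; congr fine; apply: ae_integral_lebesgueRn; first exact/measurable_EFinP.
by apply: aeW.
Qed.

Lemma frac_divE (phi : 'rV[R]_n -> 'rV[R]_n) : Lip_c setT phi -> forall x,
  frac_div alpha phi x = mu_frac n alpha *
  \sum_i \int[lam]_z (riesz_kernel alpha i z * (phi (x + z) ord0 i - phi x ord0 i)).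
Proof.
move=> /(Lip_c_bounds n1)[L [M [A [L0 [mA Aoo _] [cphi phi0] phiM phiL]]]] x.
congr (_ * _); pose h i y : R := phi y ord0 i.
have mh i : measurable_fun [set: T] (h i).
  by apply: continuous_measurable_rV; exact: continuous_rV_coord.
pose g y := \sum_i riesz_kernel alpha i (y - x) * (h i y - h i x).
have mg : measurable_fun [set: T] g.
  apply: measurable_sum => i; apply: measurable_funM; last exact: measurable_funB.
  by apply: (measurableT_comp (@measurable_riesz_kernel R n alpha i)); exact: measurable_subv.
transitivity (\int[lam]_y g y).
  rewrite -Rintegral_lebesgueRn//; apply: eq_Rintegral => y _.
  rewrite /dotv /g mulr_suml; apply: eq_bigr => i _.
  by rewrite /riesz_kernel /h !mxE mulrAC.
rewrite -(Rintegral_translate x mg).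
transitivity (\int[lam]_z \sum_i (riesz_kernel alpha i z * (h i (x + z) - h i x))).
  by apply: eq_Rintegral => z _; apply: eq_bigr => i _; rewrite addrK (addrC z).
apply: (@Rintegral_bigsum _ T R lam setT measurableT _ _ (fun i z => riesz_kernel alpha i z * (h i (x + z) - h i x))) => i.
apply: (@le_integrable _ T R lam setT measurableT _ (EFin \o (fun z => L * fkernel alpha z))).
- apply/measurable_EFinP; apply: measurable_funM; first exact: measurable_riesz_kernel.
  apply: measurable_funB => //; apply: (measurableT_comp (mh i)).
  exact: measurable_addv.
- move=> z _ /=; rewrite lee_fin; apply: le_trans (riesz_difference_le _ _ _ _ _) _.
  apply: le_trans (ler_norm _); rewrite /nonlocal_quotient/= fkernelE mulrA ler_wpM2r//.
    by rewrite invr_ge0 powR_ge0.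
  exact: phiL.
- under [X in _.-integrable _ X]eq_fun do rewrite /= EFinM.
  by apply: integrableZl => //; exact: integrable_fkernel.
Qed.

End borel_representation.

(** * The fractional perimeter and the nonlocal quotient *)

Section perimeter_comparison.
Context {R : realType} {n : nat}.
Local Notation T := (borelRn R n).
Local Notation lam := (lebesgue_borelRn R n).
Local Notation Leb := (lebesgueRn R n).
Variables (alpha : R) (E F : set 'rV[R]_n).
Hypotheses (mF : measurable (F : set T)) (EF : {ae lam, forall x, E x <-> F x}).
Local Notation chi := (\1_F : 'rV[R]_n -> R).

Let mchi : measurable_fun [set: T] chi.
Proof. exact: (@measurable_indic _ T). Qed.

Let indicEF x : (E x <-> F x) -> \1_E x = chi x.
Proof. by move=> h; rewrite !indicE; congr ((_ : bool)%:R); apply: asbool_equiv_eq. Qed.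

Let kf (p : T * T) : R :=
  `|chi p.2 - chi p.1| / enorm ((p.2 : 'rV[R]_n) - p.1) `^ (n%:R + alpha).

Let mkf : measurable_fun [set: T * T] kf.
Proof.
apply: measurable_funM.
  apply: measurableT_comp => //; apply: measurable_funB.
    exact: measurableT_comp mchi measurable_snd.
  exact: measurableT_comp mchi measurable_fst.
apply: measurable_invr; apply: measurable_funpowR; apply: measurable_enorm.
by apply: measurable_subv; [exact: measurable_snd|exact: measurable_fst].
Qed.

Let kf0 p : 0 <= kf p.
Proof. by rewrite divr_ge0 ?powR_ge0. Qed.

Let I (B : set 'rV[R]_n) (y : 'rV[R]_n) : \bar R := (\int[lam]_x ((\1_B x)%:E * (kf (y, x))%:E))%E.

Let I_ge0 B y : (0 <= I B y)%E.
Proof. by apply: integral_ge0 => x _; rewrite mule_ge0// lee_fin// indicE ler0n. Qed.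

Let mI B : measurable (B : set T) -> measurable_fun [set: T] (I B).
Proof.
move=> mB.
apply: (@measurable_fun_fubini_tonelli_F _ _ T T R lam (fun p : T * T => ((\1_B p.2)%:E * (kf p)%:E)%E)).
  2: by move=> p; rewrite mule_ge0// lee_fin// indicE ler0n.
apply: emeasurable_funM; last exact/measurable_EFinP.
apply/measurable_EFinP; apply: (measurableT_comp (@measurable_indic _ T R setT B mB)).
exact: measurable_snd.
Qed.

Let double_integralE (A B : set 'rV[R]_n) : measurable (A : set T) -> measurable (B : set T) ->
  (\int[Leb]_(y in A) \int[Leb]_(x in B) frac_kernel alpha \1_E x y =
   \int[lam]_y ((\1_A y)%:E * I B y))%E.
Proof.
move=> mA mB; apply: ae_integral_lebesgueRn_in => //; first exact: mI.
apply: (ae_imply _ EF) => y Ey.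
apply: (@ae_integral_lebesgueRn_in R n B _ (fun x => (kf (y, x))%:E)) => //.
  apply/measurable_EFinP; apply: (measurableT_comp mkf).
  exact: measurable_fun_pair.
by apply: (ae_imply _ EF) => x Ex; rewrite /frac_kernel/= !indicEF.
Qed.

Let I_compl (B : set 'rV[R]_n) y : measurable (B : set T) ->
  (I B y + I (~` B) y = \int[lam]_z (nonlocal_quotient alpha chi (y, z))%:E)%E.
Proof.
move=> mB; have mk : measurable_fun [set: T] (fun x : T => (kf (y, x))%:E).
  by apply/measurable_EFinP; apply: (measurableT_comp mkf); exact: measurable_fun_pair.
rewrite -ge0_integralD//; last 4 first.
- by move=> x _; rewrite mule_ge0// lee_fin// indicE ler0n.
- apply: emeasurable_funM => //; apply/measurable_EFinP; exact: (@measurable_indic _ T).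
- by move=> x _; rewrite mule_ge0// lee_fin// indicE ler0n.
- apply: emeasurable_funM => //; apply/measurable_EFinP; apply: (@measurable_indic _ T).
  exact: measurableC.
have mq : measurable_fun [set: T] (fun z => (nonlocal_quotient alpha chi (y, z))%:E).
  apply/measurable_EFinP; apply: (measurableT_comp (@measurable_nonlocal_quotient R n alpha _ mchi)).
  exact: measurable_fun_pair.
rewrite -(integral_translate mq (- y)).
apply: eq_integral => x _.
rewrite /nonlocal_quotient/= subrKC -/(kf (y, x)) !indicE in_setC.
by case: (x \in B); rewrite /= mul1e mul0e ?adde0 ?add0e.
Qed.

(** Splitting the inner integral over [Omega] and its complement gives the two terms of the
    perimeter, the second with coefficient 1 in place of 2. *)
Lemma nonlocal_le_perimeter (Omega : set 'rV[R]_n) : open Omega ->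
  (\int[lam]_x ((\1_Omega x)%:E * \int[lam]_z (nonlocal_quotient alpha chi (x, z))%:E)
    <= frac_perimeter alpha E Omega)%E.
Proof.
move=> oO; have mO : measurable (Omega : set T) by exact: measurable_open_borelRn.
have mO' : measurable (~` Omega : set T) by exact: measurableC.
have miO : measurable_fun [set: T] (fun x => (\1_Omega x)%:E : \bar R).
  by apply/measurable_EFinP; exact: (@measurable_indic _ T).
have i0 x : (0 <= (\1_Omega x)%:E :> \bar R)%E by rewrite lee_fin indicE ler0n.
have m1 := emeasurable_funM miO (mI mO); have m2 := emeasurable_funM miO (mI mO').
rewrite /frac_perimeter !double_integralE//.
under eq_integral do rewrite -(I_compl _ mO) ge0_muleDr//.
rewrite ge0_integralD//; last 2 first.
- by move=> x _; rewrite mule_ge0.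
- by move=> x _; rewrite mule_ge0.
rewrite leeD2l// -[X in (X <= _)%E]mul1e lee_wpmul2r// ?lee_fin ?ler1n//.
by apply: integral_ge0 => x _; rewrite mule_ge0.
Qed.

Lemma double_integral_nonlocal :
  (\int[Leb]_y \int[Leb]_x frac_kernel alpha \1_E x y =
   \int[lam]_y \int[lam]_z (nonlocal_quotient alpha chi (y, z))%:E)%E.
Proof.
rewrite double_integralE//; apply: eq_integral => y _.
rewrite indicE in_setT mul1e -(I_compl y measurableT) setCT -[LHS]adde0; congr (_ + _)%E.
apply/esym; rewrite /I; under eq_integral do rewrite indicE in_set0 mul0e.
exact: integral0.
Qed.

End perimeter_comparison.

(** * Gradient density of a set of finite fractional perimeter *)

Section finite_perimeter.
Context {R : realType} {n : nat}.
Local Notation T := (borelRn R n).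
Local Notation lam := (lebesgue_borelRn R n).
Local Notation Leb := (lebesgueRn R n).
Variables (alpha : R) (E F Omega : set 'rV[R]_n).
Hypotheses (n1 : (1 <= n)%N) (a01 : 0 < alpha < 1) (oO : open Omega).
Hypotheses (mF : measurable (F : set T)) (EF : {ae lam, forall x, E x <-> F x}).
Hypothesis Pfin : (frac_perimeter alpha E Omega < +oo)%E.
Local Notation chi := (\1_F : 'rV[R]_n -> R).
Local Notation mu := (mu_frac n alpha).

Let mchi : measurable_fun [set: T] chi.
Proof. exact: (@measurable_indic _ T). Qed.

Let chi_le1 x : `|chi x| <= 1.
Proof. by rewrite indicE; case: (_ \in _); rewrite ?normr1 ?normr0. Qed.

Let mO : measurable (Omega : set T).
Proof. exact: measurable_open_borelRn. Qed.

Let mIO : measurable_fun [set: T] (\1_Omega : 'rV[R]_n -> R).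
Proof. exact: (@measurable_indic _ T). Qed.

Let IO0 x : 0 <= \1_Omega x :> R.
Proof. by rewrite indicE ler0n. Qed.

Let IOT x : Omega x -> \1_Omega x = 1 :> R.
Proof. by move=> Ox; rewrite indicE mem_set. Qed.

Let IOF x : ~ Omega x -> \1_Omega x = 0 :> R.
Proof. by move=> Ox; rewrite indicE memNset. Qed.

Let mq x : measurable_fun [set: T] (fun z => (nonlocal_quotient alpha chi (x, z))).
Proof.
apply: (measurableT_comp (@measurable_nonlocal_quotient R n alpha _ mchi)).
exact: measurable_fun_pair.
Qed.

Let integrable_quotient : (lam \x lam)%E.-integrable [set: T * T]
    (EFin \o (fun p : T * T => \1_Omega p.1 * nonlocal_quotient alpha chi p)).
Proof.
apply/integrable12ltyP.
  apply/measurable_EFinP; apply: measurable_funM.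
    exact: measurableT_comp mIO measurable_fst.
  exact: measurable_nonlocal_quotient.
apply: le_lt_trans Pfin.
have := nonlocal_le_perimeter alpha mF EF oO; apply: le_trans.
rewrite le_eqVlt; apply/orP; left; apply/eqP; apply: eq_integral => x _.
rewrite -ge0_integralZl//; last 2 first.
- by apply/measurable_EFinP; exact: mq.
- by move=> z _; rewrite lee_fin nonlocal_quotient_ge0.
apply: eq_integral => z _ /=; rewrite -EFinM; congr EFin.
by rewrite ger0_norm// mulr_ge0// nonlocal_quotient_ge0.
Qed.

Let ae_integrable_quotient : {ae lam, forall x, Omega x ->
  lam.-integrable [set: T] (fun z => (nonlocal_quotient alpha chi (x, z))%:E)}.
Proof.
apply: (ae_imply _ (ae_integrable1 integrable_quotient)) => x /= ix Ox.
move: ix; rewrite IOT//; apply: eq_integrable => // z _.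
by rewrite /= mul1r.
Qed.

(** A Borel representative of the fractional gradient, extended by 0 outside [Omega]; with it,
    measures on [Omega] become measures on the whole space. *)
Definition frac_grad_density (x : 'rV[R]_n) : 'rV[R]_n :=
  \row_i (\1_Omega x * nonlocal_grad alpha F i x).

Lemma integrable_frac_grad_density i :
  lam.-integrable [set: T] (fun x => (frac_grad_density x ord0 i)%:E).
Proof.
have h := @integrable_riesz_rough R n alpha i \1_Omega chi 1 Omega mIO mchi mO.
have := integrable_Rfubini1 (h _ _ integrable_quotient).
move=> /(_ _ _)/= h'.
have : lam.-integrable [set: T] (EFin \o (fun x => mu * \int[lam]_z (\1_Omega x * (riesz_kernel alpha i z * (chi (x + z) - chi x))))).
  under [X in _.-integrable _ X]eq_fun do rewrite /= EFinM.
  apply: integrableZl => //; apply: h'.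
    by move=> x; rewrite indicE; case: (_ \in _); rewrite ?normr1 ?normr0.
  by move=> x nx; rewrite indicE memNset.
apply: eq_integrable => // x _; rewrite /= mxE /nonlocal_grad mulrCA; congr (_ * _)%:E.
rewrite RintegralZl_total//; apply: measurable_funM; first exact: measurable_riesz_kernel.
by apply: measurable_funB => //; apply: (measurableT_comp mchi); exact: measurable_addv.
Qed.

Lemma frac_grad_density_out x : ~ Omega x -> frac_grad_density x = 0.
Proof. by move=> nO; apply/rowP => i; rewrite !mxE IOF// mul0r. Qed.

Lemma ae_frac_grad_cvg : {ae lam, forall x, Omega x -> frac_grad_cvg alpha E x}.
Proof.
apply: (ae_imply2 _ EF ae_integrable_quotient) => x Ex ix Ox.
exact: (frac_grad_cvgE EF Ex (ix Ox)).
Qed.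

Lemma ae_frac_grad_density : {ae lam, forall x, Omega x -> frac_grad alpha E x = frac_grad_density x}.
Proof.
apply: (ae_imply _ EF) => x Ex Ox; apply/rowP => i.
by rewrite (frac_gradE alpha mF EF Ex) mxE IOT// mul1r.
Qed.

(** Nonlocal integration by parts is applied to each component with the indicator as bounded factor:
    the Lipschitz estimate makes one double integral converge, the finite perimeter the other. *)
Lemma frac_div_by_parts phi : Lip_c Omega phi ->
  \int[Leb]_(x in E) frac_div alpha phi x = - \int[lam]_x dotv (phi x) (frac_grad_density x).
Proof.
move=> Lphi; have LT : Lip_c setT phi by case: Lphi => ? [? ?]; split.
have [L [M [A [L0 [mA Aoo AO] [cphi phi0] phiM phiL]]]] := Lip_c_bounds n1 Lphi.
pose h i y : R := phi y ord0 i.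
have mh i : measurable_fun [set: T] (h i).
  by apply: continuous_measurable_rV; exact: continuous_rV_coord.
have hM i x : `|h i x| <= M by apply: le_trans (ler_coord_norm _ _) (phiM x).
have M0 : 0 <= M by exact: le_trans (normr_ge0 _) (phiM 0).
have h0 i x : ~ A x -> h i x = 0 by move=> /phi0 p0; rewrite /h p0 mxE.
have hO i x : ~ Omega x -> h i x = 0 by move=> nO; apply: h0 => /AO.
have ih i : lam.-integrable [set: T] (EFin \o h i).
  have := integrable_bounded_mul measurableT (mh i) (hM i) (integrable_indic_lty mA Aoo).
  apply: eq_integrable => // x _ /=; rewrite indicE.
  by have [xA|/negP xA] := boolP (x \in A); rewrite ?mulr1// h0 ?mul0r// => /mem_set.
have i1 i := @integrable_riesz_smooth R n alpha n1 a01 i (h i) chi L A (mh i) mchi mA Aoo chi_le1 (h0 i) L0 (phiL i).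
have i2 i := @integrable_riesz_rough R n alpha i (h i) chi M Omega (mh i) mchi mO (hM i) (hO i) integrable_quotient.
pose D i x := \int[lam]_z (riesz_kernel alpha i z * (h i (x + z) - h i x)).
(* The same estimate with bounded factor 1 shows that each component of the fractional divergence is
   integrable. *)
have iD i : lam.-integrable [set: T] (EFin \o D i).
  have c1 (x : 'rV[R]_n) : `|cst (1 : R) x| <= 1 by rewrite normr1.
  have := integrable_Rfubini1 (@integrable_riesz_smooth R n alpha n1 a01 i (h i) (cst 1) L A
    (mh i) (@measurable_cst _ _ T R setT 1) mA Aoo c1 (h0 i) L0 (phiL i)).
  apply: eq_integrable => // x _ /=; congr EFin; apply: eq_Rintegral => z _.
  by rewrite mul1r.
have mD i : measurable_fun [set: T] (D i) by apply/measurable_EFinP; exact: measurable_int (iD i).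
have icD i : lam.-integrable [set: T] (EFin \o (fun x => chi x * D i x)).
  exact: integrable_bounded_mul (iD i).
have igD i : lam.-integrable [set: T] (EFin \o (fun x => h i x * frac_grad_density x ord0 i)).
  exact: (@integrable_bounded_mul _ T R lam setT measurableT (fun x => frac_grad_density x ord0 i)
    (h i) M (mh i) (hM i) (integrable_frac_grad_density i)).
transitivity (\int[Leb]_(x in E) (mu * \sum_i D i x)).
  by apply: eq_Rintegral => x _; rewrite (frac_divE n1 a01 LT).
rewrite (Rintegral_lebesgueRn_setE EF); last first.
  by apply: measurable_funM => //; apply: measurable_funM => //; exact: measurable_sum.
transitivity (\int[lam]_x (mu * \sum_i (chi x * D i x))).
  by apply: eq_Rintegral => x _; rewrite mulrCA; congr (_ * _); rewrite mulr_sumr.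
rewrite RintegralZl_total; last by apply: measurable_sum => i; exact: measurable_funM.
rewrite Rintegral_bigsum// /dotv Rintegral_bigsum//.
rewrite mulr_sumr -sumrN; apply: eq_bigr => i _.
rewrite (nonlocal_by_parts (measurable_riesz_kernel alpha i) mchi (riesz_kernelN alpha i) chi_le1 (ih i) (i1 i) (i2 i)).
rewrite mulrN -RintegralZl_total; last first.
  have := measurable_int _ (integrable_Rfubini1 (i2 i)) => /measurable_EFinP.
  apply: eq_measurable_fun => x _ /=.
  rewrite RintegralZl_total//; apply: measurable_funM; first exact: measurable_riesz_kernel.
  by apply: measurable_funB => //; apply: (measurableT_comp mchi); exact: measurable_addv.
congr (- _); apply: eq_Rintegral => x _; rewrite mxE /nonlocal_grad -/(h i x).
have [Ox|nO] := pselect (Omega x); last by rewrite hO// !mul0r mulr0.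
by rewrite IOT// mul1r mulrCA.
Qed.

(** The sum over components is formed inside the integral, where Cauchy-Schwarz bounds |u . z| by
    |z|; bounding components separately would lose a factor n. The null set is independent of [u],
    so that [u] may be taken to be phi x. *)
Lemma frac_grad_density_le : {ae lam, forall x, forall u : 'rV[R]_n, enorm u <= 1 ->
  (`|dotv u (frac_grad_density x)|%:E <=
   mu%:E * ((\1_Omega x)%:E * \int[lam]_z (nonlocal_quotient alpha chi (x, z))%:E))%E}.
Proof.
apply: (ae_imply _ ae_integrable_quotient) => x ix u u1.
have [Ox|nO] := pselect (Omega x); last first.
  by rewrite frac_grad_density_out// IOF// mul0e mule0 dotvC -(scale0r 0) dotvZl mul0r normr0.
rewrite IOT// mul1e.
have {}ix := ix Ox; have := integrable_fin_num measurableT ix => /fineK <-.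
rewrite -EFinM lee_fin -[fine _]/(\int[lam]_z nonlocal_quotient alpha chi (x, z)).
pose f i z := u ord0 i * (riesz_kernel alpha i z * (chi (x + z) - chi x)).
have mf i : measurable_fun [set: T] (fun z => riesz_kernel alpha i z * (chi (x + z) - chi x)).
  apply: measurable_funM; first exact: measurable_riesz_kernel.
  by apply: measurable_funB => //; apply: (measurableT_comp mchi); exact: measurable_addv.
have fi i : lam.-integrable [set: T] (EFin \o f i).
  apply: le_integrable ix => //; first by apply/measurable_EFinP; exact: measurable_funM.
  move=> z _ /=; rewrite lee_fin normrM [leRHS]ger0_norm ?nonlocal_quotient_ge0//.
  rewrite -[leRHS]mul1r ler_pM//; last exact: riesz_difference_le.
  exact: le_trans (ler_coord_enorm _ _) u1.
have sfi : lam.-integrable [set: T] (EFin \o (fun z => \sum_i f i z)) by exact: integrable_bigsum.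
have -> : dotv u (frac_grad_density x) = mu * \int[lam]_z (\sum_i f i z).
  rewrite Rintegral_bigsum// mulr_sumr; apply: eq_bigr => i _.
  by rewrite mxE IOT// mul1r /nonlocal_grad mulrCA; congr (_ * _); rewrite -RintegralZl_total.
rewrite normrM (ger0_norm (mu_frac_ge0 _)) ler_wpM2l ?mu_frac_ge0//.
apply: le_trans (le_normr_Rintegral measurableT sfi) _.
apply: le_Rintegral => //.
  by have := integrable_norm sfi.
move=> z _; have -> : \sum_i f i z = dotv u z / enorm z `^ (n%:R + alpha + 1) * (chi (x + z) - chi x).
  by rewrite /dotv !mulr_suml; apply: eq_bigr => i _; rewrite /f /riesz_kernel !mulrA.
rewrite normrM /nonlocal_quotient/= mulrC ler_wpM2l//.
have [->|z0] := eqVneq z 0.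
  by rewrite dotvC -(scale0r 0) dotvZl !mul0r normr0 invr_ge0 powR_ge0.
have e0 : 0 < enorm z by rewrite enorm_gt0.
rewrite normrM normfV (ger0_norm (powR_ge0 _ _)) enorm_powR_S//.
rewrite invfM mulrA mulrAC ler_piMl ?invr_ge0 ?powR_ge0// ler_pdivrMr// mul1r.
apply: le_trans (cauchy_schwarz _ _) _; rewrite ler_piMl//; exact: enorm_ge0.
Qed.

Lemma caccioppoli_perimeter_le :
  (caccioppoli_perimeter alpha E Omega <= mu%:E * frac_perimeter alpha E Omega)%E.
Proof.
apply: ub_ereal_sup => _ [phi [cphi phi1] <-].
have Lphi := Cinfty_c_Lip_c cphi; rewrite frac_div_by_parts//.
have cont : continuous phi by case: cphi => /(_ 0%N)[].
have phi_le1 : {ae lam, forall x, enorm (phi x) <= 1}.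
  apply/ae_lebesgueRn; move: phi1; rewrite /Linfty_le1 unlock /=; case: ifPn => [_|].
    move=> /ess_sup_inf.ess_supP; apply: ae_imply => x /=; rewrite lee_fin ger0_norm//; exact: enorm_ge0.
  (* The essential supremum takes a default value when the whole space has measure 0, and then every
     property holds almost everywhere. *)
  rewrite -leNgt => h _; exists setT; split => //.
    by apply/eqP; rewrite eq_le h measure_ge0.
have M1 : forall i, measurable_fun [set: T] (fun x => phi x ord0 i).
  by move=> i; apply: continuous_measurable_rV; exact: continuous_rV_coord.
have mdot : measurable_fun [set: T] (fun x => dotv (phi x) (frac_grad_density x)).
  apply: measurable_sum => i; apply: measurable_funM => //.
  by apply/measurable_EFinP; exact: measurable_int (integrable_frac_grad_density i).
pose Q x := ((\1_Omega x)%:E * \int[lam]_z (nonlocal_quotient alpha chi (x, z))%:E)%E.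
have mQ : measurable_fun [set: T] Q.
  apply: emeasurable_funM; first exact/measurable_EFinP.
  apply: (@measurable_fun_fubini_tonelli_F _ _ T T R lam (EFin \o nonlocal_quotient alpha chi)).
    by apply/measurable_EFinP; exact: measurable_nonlocal_quotient.
  by move=> p; rewrite lee_fin nonlocal_quotient_ge0.
have Q0 x : (0 <= Q x)%E.
  rewrite mule_ge0// ?lee_fin//; apply: integral_ge0 => z _; rewrite lee_fin nonlocal_quotient_ge0//.
apply: (@le_trans _ _ (\int[lam]_x (mu%:E * Q x))%E); last first.
  rewrite ge0_integralZl// ?lee_fin ?mu_frac_ge0// lee_wpmul2l ?lee_fin ?mu_frac_ge0//.
  exact: nonlocal_le_perimeter.
have le1 : (\int[lam]_x `|dotv (phi x) (frac_grad_density x)|%:E <= \int[lam]_x (mu%:E * Q x))%E.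
  apply: ae_ge0_le_integral => //.
  - by apply/measurable_EFinP; exact: measurableT_comp.
  - by move=> x _; rewrite mule_ge0// lee_fin mu_frac_ge0.
  - by apply: emeasurable_funM.
  - by apply: (ae_imply2 _ phi_le1 frac_grad_density_le) => x h1 h2 _; exact: h2.
apply: le_trans le1; apply: (@le_trans _ _ (`|\int[lam]_x (dotv (phi x) (frac_grad_density x))%:E|)%E).
  (* An infinite integral would have [fine] equal to 0, which also respects the bound. *)
  rewrite /Rintegral; case: (\int[lam]_x _)%E => [r| |] /=; rewrite ?oppr0 ?leey//.
  by rewrite lee_fin -normrN ler_norm.
apply: le_abse_integral => //; exact/measurable_EFinP.
Qed.

End finite_perimeter.

(** * Signed measures determined by test functions *)

Section test_functions_determine.
Context {R : realType} {n : nat}.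
Local Notation T := (borelRn R n).
Local Notation lam := (lebesgue_borelRn R n).

Lemma test_function_measurable (U : set 'rV[R]_n) f : test_function U f -> measurable_fun [set: T] f.
Proof. by move=> [/smooth_derive[cf _] _]; exact: continuous_measurable_rV. Qed.

Lemma bounded_cvg_Rintegral d (X : measurableType d) (m : {finite_measure set X -> \bar R})
    (f : nat -> X -> R) (g : X -> R) (M : R) :
  (forall k, measurable_fun setT (f k)) -> (forall k x, `|f k x| <= M) ->
  (forall x, f k x @[k --> \oo] --> g x) ->
  \int[m]_x f k x @[k --> \oo] --> \int[m]_x g x.
Proof.
move=> mf fM fg; apply: fine_cvg.
have mg : measurable_fun setT g by apply: (@measurable_fun_cvg _ _ _ setT f) => // x _; exact: fg.
have ig : m.-integrable setT (EFin \o g).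
  apply: (finite_bounded_integrable _ mg) => x.
  have : `|f k x| @[k --> \oo] --> `|g x| by apply: cvg_norm; exact: fg.
  by move=> /cvgr_to_le; apply; exact: nearW.
rewrite fineK; last by apply: integrable_fin_num.
apply: (dominated_cvg measurableT (f_ := fun k x => (f k x)%:E) (g := cst M%:E)) => //.
- by move=> k; exact/measurable_EFinP.
- by move=> x _; apply: cvg_EFin; [exact: nearW|exact: fg].
- exact: (@finite_bounded_integrable _ _ _ m (cst M) `|M|).
- by move=> k x _; rewrite /= lee_fin.
Qed.

Lemma charge_decomposition d (X : measurableType d) (nu : {charge set X -> \bar R}) :
  exists m1 m2 : {finite_measure set X -> \bar R}, forall A, measurable A -> nu A = (m1 A - m2 A)%E.
Proof.
have [P [N hPN]] := Hahn_decomposition nu.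
exists (jordan_pos hPN), (jordan_neg hPN) => A mA.
have := jordan_decomp hPN mA; rewrite /cadd/= /cscale/= => ->.
by rewrite mulN1e.
Qed.

(** Test functions increasing to an indicator only in the limit still give equality on open subsets
    of [Omega] by dominated convergence. The identity is rearranged as m1 + m4 = m3 + m2 between
    positive measures, so that uniqueness on the intersection-stable class of open sets applies. *)
Lemma test_functions_determine (Omega : set 'rV[R]_n) (m1 m2 m3 m4 : {finite_measure set T -> \bar R}) :
  open Omega ->
  (forall psi, test_function Omega psi ->
    \int[m1]_x psi x - \int[m2]_x psi x = \int[m3]_x psi x - \int[m4]_x psi x) ->
  (forall A : set T, measurable A -> A `<=` ~` Omega -> (m1 A - m2 A = m3 A - m4 A)%E) ->
  forall A : set T, measurable A -> (m1 A - m2 A = m3 A - m4 A)%E.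
Proof.
move=> oO hpsi hA.
have Ebis (A : set T) : measurable A -> (m1 A - m2 A = m3 A - m4 A)%E <->
    fine (m1 A) - fine (m2 A) = fine (m3 A) - fine (m4 A).
  move=> mA.
  rewrite -(fineK (fin_num_measure m1 A mA)) -(fineK (fin_num_measure m2 A mA)).
  rewrite -(fineK (fin_num_measure m3 A mA)) -(fineK (fin_num_measure m4 A mA)) -!EFinB.
  by split => [[]|->].
have inO (U : set 'rV[R]_n) : open U -> U `<=` Omega ->
    fine (m1 U) - fine (m2 U) = fine (m3 U) - fine (m4 U).
  move=> oU UO; have mU : measurable (U : set T) by exact: measurable_open_borelRn.
  have [psi [tpsi psi01 psiU]] := open_test_functions oU.
  have cv (m : {finite_measure set T -> \bar R}) : \int[m]_x psi k x @[k --> \oo] --> fine (m U).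
    rewrite (_ : fine (m U) = \int[m]_x (\1_U x)); last first.
      by congr fine; rewrite integral_indic// setIT.
    apply: (@bounded_cvg_Rintegral _ T m psi (\1_U : T -> R) 1) => //.
    - by move=> k; exact: test_function_measurable (tpsi k).
    - by move=> k x; have /andP[p0 p1] := psi01 k x; rewrite ger0_norm.
  have c12 := cvgB (cv m1) (cv m2) _; have c34 := cvgB (cv m3) (cv m4) _.
  have E k : \int[m1]_x psi k x - \int[m2]_x psi k x = \int[m3]_x psi k x - \int[m4]_x psi k x.
    apply: hpsi; case: (tpsi k) => s [K [? ? ?]]; split => //; exists K; split => //.
    exact: subset_trans UO.
  rewrite -(cvg_lim _ (c12 _))// -(cvg_lim _ (c34 _))//; congr (lim (_ @ \oo)).
  by apply/funext => k; exact: E.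
have addE (m m' : {finite_measure set T -> \bar R}) (A : set T) : measurable A ->
    measure_add m m' A = (fine (m A) + fine (m' A))%:E.
  by move=> mA; rewrite EFinD !fineK ?fin_num_measure//; exact: measure_addE.
have onU (U : set 'rV[R]_n) : open U -> measure_add m1 m4 U = measure_add m3 m2 U.
  move=> oU; have mU : measurable (U : set T) by exact: measurable_open_borelRn.
  have mO : measurable (Omega : set T) by exact: measurable_open_borelRn.
  have mUO : measurable (U `&` Omega : set T) by exact: measurableI.
  have mUO' : measurable (U `\` Omega : set T) by exact: measurableD.
  have h1 := inO (U `&` Omega) (openI oU oO) (@subIsetr _ _ _).
  have /(Ebis _ mUO') h2 := hA (U `\` Omega) mUO' (@subIsetr _ _ _).
  (* A general open set is split along [Omega]: the inner part is open, the outer part is covered by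
     the hypothesis on the complement. *)
  have mE (m : {finite_measure set T -> \bar R}) : m U = (fine (m (U `\` Omega)) + fine (m (U `&` Omega)))%:E.
    by rewrite EFinD !fineK ?fin_num_measure// -measureDI.
  rewrite addE// [RHS]addE// (mE m1) (mE m2) (mE m3) (mE m4)/=; congr EFin; lra.
move=> A mA; apply/(Ebis _ mA).
have : measure_add m1 m4 A = measure_add m3 m2 A.
  apply: (@measure_unique _ R T (@open 'rV[R]_n) (fun _ => setT)) => //.
  - by move=> U V; exact: openI.
  - by move=> _; exact: openT.
  - by rewrite bigcup_const//; exists 0%N.
  - by move=> _; rewrite [X in (X < _)%E](addE m1 m4 setT measurableT) ltry.
rewrite [LHS]addE// [RHS]addE// => -[]; lra.
Qed.


Lemma test_function_bounded (U : set 'rV[R]_n) f : test_function U f -> exists M, forall x, `|f x| <= M.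
Proof.
move=> [/smooth_derive[cf _] [K [cK _ f0]]].
by have [M _ hM] := @compactly_supported_bound R n R f K cf cK f0; exists M.
Qed.

Lemma charge_integral0 (nu : {charge set T -> \bar R}) : charge_integral nu (fun=> 0) = 0.
Proof.
have [m1 [m2 nuE]] := charge_decomposition nu.
rewrite (charge_integral_diff (M := 0) nuE)//; last by move=> x; rewrite normr0.
by rewrite !Rintegral_cst// !mul0r subrr.
Qed.

Lemma charge_density_determine (Omega : set 'rV[R]_n) (nu : {charge set T -> \bar R}) (g : 'rV[R]_n -> R) :
  open Omega -> lam.-integrable [set: T] (EFin \o g) -> (forall x, ~ Omega x -> g x = 0) ->
  (forall A : set T, measurable A -> A `<=` ~` Omega -> nu A = 0%E) ->
  (forall psi, test_function Omega psi -> charge_integral nu psi = \int[lam]_x (psi x * g x)) ->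
  forall A : set T, measurable A -> nu A = (\int[lam]_(x in A) (g x)%:E)%E.
Proof.
move=> oO ig g0 nu0 hpsi; have [m1 [m2 nuE]] := charge_decomposition nu.
have igp : lam.-integrable [set: T] (EFin \o g^\+) by exact: integrable_funrpos.
have ign : lam.-integrable [set: T] (EFin \o g^\-) by exact: integrable_funrneg.
have mg : measurable_fun [set: T] g by apply/measurable_EFinP; exact: measurable_int ig.
have mgp : measurable_fun [set: T] g^\+ by exact: measurable_funrpos.
have mgn : measurable_fun [set: T] g^\- by exact: measurable_funrneg.
pose m3 : {finite_measure set T -> \bar R} := density igp (funrpos_ge0 g).
pose m4 : {finite_measure set T -> \bar R} := density ign (funrneg_ge0 g).
have gE (A : set T) : measurable A -> (\int[lam]_(x in A) (g x)%:E = m3 A - m4 A)%E.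
  move=> mA; rewrite /m3 /m4/= /density -integralB_EFin//; last 2 first.
  - exact: (integrableS measurableT mA (@subsetT _ _) igp).
  - exact: (integrableS measurableT mA (@subsetT _ _) ign).
  by apply: eq_integral => x _; rewrite -EFinB; congr EFin; rewrite -[in LHS](funrposBneg g).
move=> A mA; rewrite nuE// gE//.
apply: (test_functions_determine oO) => // [psi tpsi|B mB BO].
  have mpsi := test_function_measurable tpsi.
  have [M hM] := test_function_bounded tpsi.
  rewrite -(charge_integral_diff nuE mpsi hM) hpsi//.
  have i3 : \int[m3]_x psi x = \int[lam]_x (psi x * g^\+ x).
    by congr fine; exact: (@integral_density _ T R lam m3 _ mgp (funrpos_ge0 g)).
  have i4 : \int[m4]_x psi x = \int[lam]_x (psi x * g^\- x).
    by congr fine; exact: (@integral_density _ T R lam m4 _ mgn (funrneg_ge0 g)).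
  rewrite i3 i4 -RintegralB//; last 2 first.
  - exact: (integrable_bounded_mul _ mpsi hM).
  - exact: (integrable_bounded_mul _ mpsi hM).
  by apply: eq_Rintegral => x _; rewrite -mulrBr; congr (_ * _); rewrite -[in LHS](funrposBneg g).
rewrite -nuE// nu0// -gE//; apply/esym/integral0_eq => x /BO /g0 ->.
by [].
Qed.

End test_functions_determine.

(** * Consequences of finite fractional perimeter *)

Section part1.
Context {R : realType} {n : nat}.
Local Notation T := (borelRn R n).
Local Notation lam := (lebesgue_borelRn R n).
Local Notation Leb := (lebesgueRn R n).

Lemma vmeasure_integral_scale_basis (D : vmeasure R n) (psi : 'rV[R]_n -> R) i :
  vmeasure_integral D (fun x => psi x *: basisv i) = charge_integral (D i) psi.
Proof.
rewrite /vmeasure_integral (bigD1 i)//= big1 ?addr0; last first.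
  move=> j ji; rewrite (_ : (fun x => _) = (fun=> 0)) ?charge_integral0//.
  by apply/funext => x; rewrite !mxE eqxx (negbTE ji) mulr0.
by congr charge_integral; apply/funext => x; rewrite !mxE !eqxx mulr1.
Qed.

Lemma dotv0r (u : 'rV[R]_n) : dotv u 0 = 0.
Proof. by rewrite /dotv big1// => i _; rewrite mxE mulr0. Qed.

Lemma dotv_scale_basis (u : 'rV[R]_n) (a : R) i : dotv (a *: basisv i) u = a * u ord0 i.
Proof.
rewrite dotvZl; congr (_ * _); rewrite /dotv (bigD1 i)//= big1 ?addr0; last first.
  by move=> j ji; rewrite !mxE eqxx (negbTE ji) mul0r.
by rewrite !mxE !eqxx mul1r.
Qed.

Lemma finite_frac_perimeter (alpha : R) (Omega E : set 'rV[R]_n) : (1 <= n)%N ->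
     0 < alpha < 1 -> open Omega ->
     measurable (E : set (lebRn R n)) ->
     (frac_perimeter alpha E Omega < +oo)%E ->
     [/\ (caccioppoli_perimeter alpha E Omega < +oo)%E,
         (caccioppoli_perimeter alpha E Omega <=
            (mu_frac n alpha)%:E * frac_perimeter alpha E Omega)%E,
         {ae lebesgueRn R n, forall x, Omega x -> frac_grad_cvg alpha E x} /\
         (forall i : 'I_n, (lebesgueRn R n).-integrable Omega
            (fun x : lebRn R n => (frac_grad alpha E x ord0 i)%:E)),
         (forall phi : 'rV[R]_n -> 'rV[R]_n, Lip_c Omega phi ->
            \int[lebesgueRn R n]_(x in E) frac_div alpha phi x =
            - \int[lebesgueRn R n]_(x in Omega)
                dotv (phi x) (frac_grad alpha E x))
       & (exists D : vmeasure R n, frac_variation_measure alpha E Omega D) /\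
         (forall D : vmeasure R n, frac_variation_measure alpha E Omega D ->
            polar_density D (vnormal Omega D) /\
            forall (i : 'I_n) (A : set (borelRn R n)), measurable A ->
              D i A = (\int[lebesgueRn R n]_(x in A `&` Omega)
                         (frac_grad alpha E x ord0 i)%:E)%E)].
Proof.
move=> n1 a01 oO mE Pfin.
have [F mF EF] := @completed_ae_borel _ T R lam E mE.
pose g := frac_grad_density alpha F Omega.
have ig i : lam.-integrable [set: T] (fun x => (g x ord0 i)%:E).
  exact: integrable_frac_grad_density oO mF EF Pfin i.
have mg i : measurable_fun [set: T] (fun x => g x ord0 i).
  by apply/measurable_EFinP; exact: measurable_int (ig i).
have gE : {ae lam, forall x, Omega x -> frac_grad alpha E x = g x}.
  exact: ae_frac_grad_density.
have g0 x : ~ Omega x -> g x = 0 by exact: frac_grad_density_out.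
have mO : measurable (Omega : set T) by exact: measurable_open_borelRn.
have cacc := caccioppoli_perimeter_le n1 a01 oO mF EF Pfin.
have gI (A : set T) i : measurable A ->
    (\int[lam]_(x in A) (g x ord0 i)%:E =
     \int[Leb]_(x in A `&` Omega) (frac_grad alpha E x ord0 i)%:E)%E.
  move=> mA; rewrite [RHS]integral_mkcond [LHS]integral_mkcond; apply/esym/ae_integral_lebesgueRn.
    apply: (iffLR (measurable_restrictT _ mA)); apply: measurable_funTS.
    exact: measurable_int (ig i).
  apply: (ae_imply _ gE) => x gx; rewrite !patchE in_setI.
  have [xO|/negP xO] := boolP (x \in Omega).
    by rewrite andbT gx//; exact: set_mem.
  by rewrite andbF g0 ?mxE ?if_same// => /mem_set.
split => //.
- apply: le_lt_trans cacc _; rewrite lte_mul_pinfty ?lee_fin ?mu_frac_ge0//.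
- split.
    by apply/ae_lebesgueRn; exact: ae_frac_grad_cvg EF Pfin.
  move=> i; apply/(integrable_mkcond _ _).
    exact: (@borel_completed _ T R lam).
  apply/(ae_integrable_lebesgueRn (measurable_int _ (ig i))); last exact: ig.
  apply: (ae_imply _ gE) => x gx; rewrite patchE.
  have [xO|/negP xO] := boolP (x \in Omega); first by rewrite gx//; exact: set_mem.
  by rewrite g0 ?mxE// => /mem_set.
- move=> phi Lphi; rewrite (frac_div_by_parts n1 a01 oO mF EF Pfin Lphi); congr (- _).
  have [L [M [A [L0 _ [cphi _] _ _]]]] := Lip_c_bounds n1 Lphi.
  rewrite [RHS]Rintegral_mkcond /Rintegral; congr fine; apply/esym/ae_integral_lebesgueRn.
    apply/measurable_EFinP; apply: measurable_sum => i; apply: measurable_funM => //.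
    by apply: continuous_measurable_rV; exact: continuous_rV_coord.
  apply: (ae_imply _ gE) => x gx; rewrite patchE; congr EFin.
  have [xO|/negP xO] := boolP (x \in Omega); first by rewrite gx//; exact: set_mem.
  have -> : frac_grad_density alpha F Omega x = 0 by apply: g0 => /mem_set.
  by rewrite dotv0r.
split.
  (* Existence: the vector measure with density [g] with respect to Lebesgue measure. *)
  pose D : vmeasure R n := fun i => induced_charge (ig i).
  exists D; split.
    move=> i A mA AO; rewrite /D/= /induced_charge; apply: integral0_eq => x /AO /g0 ->.
    by rewrite mxE.
  move=> phi /Cinfty_c_Lip_c Lphi; rewrite (frac_div_by_parts n1 a01 oO mF EF Pfin Lphi); congr (- _).
  have [L [M [A [L0 _ [cphi _] hM _]]]] := Lip_c_bounds n1 Lphi.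
  have mphi i : measurable_fun [set: T] (fun x => phi x ord0 i).
    by apply: continuous_measurable_rV; exact: continuous_rV_coord.
  have bphi i x : `|phi x ord0 i| <= M by exact: le_trans (ler_coord_norm _ _) (hM x).
  rewrite /vmeasure_integral /dotv Rintegral_bigsum//; last first.
    by move=> i; exact: (@integrable_bounded_mul _ T R lam setT measurableT (fun x => g x ord0 i) _ M (mphi i) (bphi i) (ig i)).
  apply: eq_bigr => i _; apply/esym.
  by apply: (@charge_integral_density R n (D i) lam (fun x => g x ord0 i) (fun x => phi x ord0 i) M) => //; exact: ig.
move=> D [D0 hD].
(* Uniqueness: the fields psi e_i isolate the i-th component, so any variation measure has density
   [g]; the polar decomposition then applies to it. *)
have DE i (A : set T) : measurable A -> D i A = (\int[lam]_(x in A) (g x ord0 i)%:E)%E.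
  apply: (@charge_density_determine R n Omega (D i) (fun x => g x ord0 i) oO (ig i)).
  - by move=> x /g0 ->; rewrite mxE.
  - exact: D0.
  - move=> psi tpsi; rewrite -vmeasure_integral_scale_basis.
    have cpsi := test_function_Cinfty_c (basisv i) tpsi.
    have Lpsi := Cinfty_c_Lip_c cpsi.
    apply/oppr_inj; rewrite -(hD _ cpsi) (frac_div_by_parts n1 a01 oO mF EF Pfin Lpsi).
    by congr (- _); apply: eq_Rintegral => x _; rewrite dotv_scale_basis.
split; last by move=> i A mA; rewrite DE// gI.
exact: (@polar_density_vnormal R n Omega g D n1 oO ig g0 DE).
Qed.

End part1.

(** * Translates of a set of finite perimeter *)

Section test_function_calculus.
Context {R : realType} {n : nat}.
Local Notation T := (borelRn R n).
Local Notation lam := (lebesgue_borelRn R n).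
Local Notation Leb := (lebesgueRn R n).
Implicit Types (f g : 'rV[R]_n -> R) (U : set 'rV[R]_n).

Lemma is_derive_translate f (x v w : 'rV[R]_n) (df : R) :
  is_derive (x + w) v f df -> is_derive x v (fun y => f (y + w)) df.
Proof.
rewrite -{1}(add0r (x + w)) -{1}(scale0r v) => /is_derive_line h.
rewrite -{1}(add0r x) -{1}(scale0r v); apply/is_derive_line.
by under eq_fun do rewrite -addrA.
Qed.

Lemma test_function_mul U f g : test_function U f -> smooth g -> test_function U (fun x => f x * g x).
Proof.
move=> [sf [K [cK KU f0]]] sg; split; first exact: smooth_mul.
by exists K; split => // x /f0 ->; rewrite mul0r.
Qed.

Lemma test_function_add U f g : test_function U f -> test_function U g ->
  test_function U (fun x => f x + g x).
Proof.
move=> [sf [K [cK KU f0]]] [sg [K' [cK' KU' g0]]]; split; first exact: smooth_add.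
exists (K `|` K'); split; first exact: compactU.
  by move=> x [/KU|/KU'].
by move=> x /not_orP[/f0 -> /g0 ->]; rewrite addr0.
Qed.

Lemma test_function0 U : test_function U (fun=> 0).
Proof. by split; [exact: smooth_cst|exists set0; split => //; exact: compact0]. Qed.

Lemma test_function_sum U I (s : seq I) (f : I -> 'rV[R]_n -> R) :
  (forall i, test_function U (f i)) -> test_function U (fun x => \sum_(i <- s) f i x).
Proof.
move=> tf; elim: s => [|i s IH].
  by under eq_fun do rewrite big_nil; exact: test_function0.
by under eq_fun do rewrite big_cons; exact: test_function_add.
Qed.

Lemma test_function_scale U (c : R) f : test_function U f -> test_function U (fun x => c * f x).
Proof.
by move=> tf; under eq_fun do rewrite mulrC; apply: test_function_mul => //; exact: smooth_cst.
Qed.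

Lemma test_function_translate f v : test_function setT f -> test_function setT (fun x => f (x + v)).
Proof.
move=> [sf [K [cK _ f0]]]; split; first exact: smooth_translate.
exists ((fun x => x - v) @` K); split => //.
  apply: continuous_compact => //; apply: continuous_subspaceT => x.
  by apply: continuousB; [exact: cvg_id|exact: cst_continuous].
move=> x nx; apply: f0 => Kx; apply: nx; exists (x + v) => //.
by rewrite addrK.
Qed.

Lemma test_function_derive U f i : test_function U f ->
  exists2 g, test_function U g & forall x, is_derive x (basisv i) f (g x).
Proof.
move=> [sf [K [cK KU f0]]]; have [_ /(_ i)[g sg dg]] := smooth_derive sf.
exists g => //; split => //; exists K; split => // x nK.
have cK' : closed K by apply: compact_closed => //; exact: norm_hausdorff.
have [_ <-] := dg x; rewrite -[RHS](derive_cst 0 x (basisv i)); apply: near_eq_derive.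
have : nbhs x (~` K) by apply: open_nbhs_nbhs; split => //; exact: closed_openC.
by apply: filterS => y /f0.
Qed.

Lemma test_function_integrable U f : test_function U f -> lam.-integrable [set: T] (EFin \o f).
Proof.
move=> tf; have [M hM] := test_function_bounded tf; have mf := test_function_measurable tf.
case: tf => _ [K [cK _ f0]].
have /compact_bounded[r [_ hr]] := cK.
pose B : set 'rV[R]_n := ball 0 (`|r| + 2).
have r0 : 0 < `|r| + 2 by rewrite ltr_wpDl.
have mB : measurable (B : set T) by apply: measurable_open_borelRn; exact: ball_open.
have KB x : K x -> B x.
  move=> Kx; rewrite /B -ball_normE/= sub0r normrN.
  apply: (@le_lt_trans _ _ (`|r| + 1)); last by rewrite ltrD2l ltr1n.
  by apply: hr => //; rewrite (le_lt_trans (ler_norm r))// ltrDl.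
have lB : (lam B < +oo)%E by rewrite /B [X in (X < _)%E]lebesgue_ball// ltry.
have := integrable_bounded_mul measurableT mf hM (integrable_indic_lty mB lB).
apply: eq_integrable => // x _ /=; rewrite indicE.
have [xA|/negP xA] := boolP (x \in B); rewrite ?mulr1// f0 ?mul0r// => /KB.
by move=> Bx; apply: xA; rewrite inE.
Qed.

Lemma enorm_basisv (i : 'I_n) : enorm (basisv i : 'rV[R]_n) = 1.
Proof.
have := @dotv_scale_basis R n (basisv i) 1 i; rewrite scale1r /enorm => ->.
by rewrite !mxE !eqxx mulr1 sqrtr1.
Qed.

Lemma divergence_scale_basis f g i x : test_function setT f ->
  (forall x, is_derive x (basisv i) f (g x)) ->
  divergence (fun x => f x *: basisv i) x = g x.
Proof.
move=> tf dg; rewrite /divergence (bigD1 i)//= big1 ?addr0; last first.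
  move=> j ji; have [d _ hd] := test_function_derive j tf.
  have := is_derive_scalel (basisv i) (hd x).
  by move=> [_ ->]; rewrite !mxE (negbTE ji) andbF mulr0.
have [_ ->] := is_derive_scalel (basisv i) (dg x).
by rewrite !mxE !eqxx mulr1.
Qed.

(** The fields f e_i are admissible competitors with divergence [g]; they are the only ones used to
    exploit the perimeter. *)
Lemma perimeter_test (E F : set 'rV[R]_n) f g i :
  measurable (F : set T) -> {ae lam, forall x, E x <-> F x} ->
  test_function setT f -> (forall x, `|f x| <= 1) -> measurable_fun [set: T] g ->
  (forall x, is_derive x (basisv i) f (g x)) ->
  ((\int[lam]_x (\1_F x * g x))%:E <= perimeter E)%E.
Proof.
move=> mF EF tf f1 mg dg; apply: ereal_sup_ubound => /=.
exists (fun x => f x *: basisv i); first split.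
- exact: test_function_Cinfty_c.
- rewrite /Linfty_le1 unlock/=; case: ifPn => // _; apply/ess_sup_inf.ess_supP.
  apply: aeW => x /=; rewrite lee_fin ger0_norm ?enorm_ge0//.
  by rewrite enormZ enorm_basisv mulr1.
have mcg : measurable_fun [set: T] (fun x => \1_F x * g x).
  by apply: measurable_funM => //; exact: (@measurable_indic _ T).
congr EFin; rewrite -(Rintegral_lebesgueRn_setE EF mcg).
by apply: eq_Rintegral => x _; exact: divergence_scale_basis.
Qed.

End test_function_calculus.

Lemma Rintegral_dominated_cvg d (X : measurableType d) (R : realType)
    (mu : {measure set X -> \bar R}) (f : nat -> X -> R) (g h : X -> R) :
  (forall k, measurable_fun setT (f k)) -> (forall x, f k x @[k --> \oo] --> g x) ->
  mu.-integrable setT (EFin \o h) -> (forall k x, `|f k x| <= h x) ->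
  mu.-integrable setT (EFin \o g) /\ \int[mu]_x f k x @[k --> \oo] --> \int[mu]_x g x.
Proof.
move=> mf fg ih fh.
have mg : measurable_fun setT g by apply: (@measurable_fun_cvg _ _ _ setT f) => // x _; exact: fg.
have ig : mu.-integrable setT (EFin \o g).
  apply: le_integrable ih => //; first exact/measurable_EFinP.
  move=> x _ /=; rewrite lee_fin; apply: le_trans (ler_norm _).
  have : `|f k x| @[k --> \oo] --> `|g x| by apply: cvg_norm; exact: fg.
  by move=> /cvgr_to_le; apply; exact: nearW.
split => //; apply: fine_cvg; rewrite fineK; last exact: integrable_fin_num.
apply: (@dominated_cvg _ X R mu setT measurableT (fun k x => (f k x)%:E) (EFin \o g) (EFin \o h)) => //.
- by move=> k; exact/measurable_EFinP.
- by move=> x _; apply: cvg_EFin; [exact: nearW|exact: fg].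
- by move=> k x _; rewrite /= lee_fin.
Qed.

(** * L1 continuity of translations for sets of finite perimeter *)

Section translation_estimate.
Context {R : realType} {n : nat}.
Local Notation T := (borelRn R n).
Local Notation lam := (lebesgue_borelRn R n).

(* Duality between L^1 and the continuous functions: [psi] is chosen close to the sign of [a]. *)
Lemma Rintegral_norm_le_dual (Omega : set 'rV[R]_n) (a : 'rV[R]_n -> R) (C : R) :
  open Omega -> lam.-integrable [set: T] (EFin \o a) -> (forall x, ~ Omega x -> a x = 0) ->
  (forall psi, test_function Omega psi -> (forall x, `|psi x| <= 1) ->
    \int[lam]_x (psi x * a x) <= C) ->
  \int[lam]_x `|a x| <= C.
Proof.
move=> oO ia a0 hC.
have ina : lam.-integrable [set: T] (EFin \o (fun x => `|a x|)) by have := integrable_norm ia.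
have ma : measurable_fun [set: T] a by apply/measurable_EFinP; exact: measurable_int ia.
pose m : {finite_measure set T -> \bar R} := density ina (fun x => normr_ge0 (a x)).
apply/ler_addgt0Pl => e e0.
have e2 : 0 < e / 2 by rewrite divr_gt0.
pose A1 : set T := [set x | 0 < a x]; pose A2 : set T := [set x | a x < 0].
have mA1 : measurable A1.
  by rewrite -[X in measurable X]setTI; apply: (@measurable_fun_ltr _ T R setT (cst 0) a).
have mA2 : measurable A2.
  by rewrite -[X in measurable X]setTI; apply: (@measurable_fun_ltr _ T R setT a (cst 0)).
(* The error is measured by |a| times Lebesgue measure: [U] and [V] exceed the sets a > 0 and a < 0
   by at most e/2 each in this measure, and s = 1_U - 1_V replaces the sign of [a]. *)
have [U [oU AU mU]] := outer_regularity m mA1 e2.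
have [V [oV AV mV]] := outer_regularity m mA2 e2.
have oUO : open (U `&` Omega) by exact: openI.
have oVO : open (V `&` Omega) by exact: openI.
have [u [tu u01 cu]] := open_test_functions oUO.
have [v [tv v01 cv]] := open_test_functions oVO.
have tw (W : set 'rV[R]_n) f : test_function (W `&` Omega) f -> test_function Omega f.
  move=> [sf [K [cK KU f0]]]; split => //; exists K; split => //.
  by move=> x /KU[].
pose psi k x : R := u k x + -1 * v k x.
have tpsi k : test_function Omega (psi k).
  by apply: test_function_add; [|apply: test_function_scale]; apply: tw; [exact: tu|exact: tv].
have psi1 k x : `|psi k x| <= 1.
  have /andP[u0 u1] := u01 k x; have /andP[v0 v1] := v01 k x.
  by rewrite /psi ler_norml; apply/andP; clear -u0 u1 v0 v1; split; lra.
pose s x : R := \1_(U `&` Omega) x + -1 * \1_(V `&` Omega) x.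
have mUO : measurable (U `&` Omega : set T) by exact: measurable_open_borelRn.
have mVO : measurable (V `&` Omega : set T) by exact: measurable_open_borelRn.
have ms : measurable_fun [set: T] s.
  apply: measurable_funD; first exact: (@measurable_indic _ T).
  by apply: measurable_funM => //; exact: (@measurable_indic _ T).
have s1 x : `|s x| <= 1.
  rewrite /s !indicE mulN1r; case: (_ \in _); case: (_ \in _);
    by rewrite ?subrr ?subr0 ?sub0r ?normrN ?normr1 ?normr0.
have isa : lam.-integrable [set: T] (EFin \o (fun x => s x * a x)).
  exact: integrable_bounded_mul ia.
have cvs : \int[lam]_x (psi k x * a x) @[k --> \oo] --> \int[lam]_x (s x * a x).
  have [] := @Rintegral_dominated_cvg _ T R lam (fun k x => psi k x * a x) (fun x => s x * a x) (fun x => `|a x|) _ _ ina _ => //.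
  - move=> k; apply: measurable_funM => //.
    exact: test_function_measurable (tpsi k).
  - move=> x; apply: cvgM; last exact: cvg_cst.
    apply: cvgD; first exact: cu.
    by apply: cvgM; [exact: cvg_cst|exact: cv].
  - by move=> k x /=; rewrite normrM ler_piMl.
have saC : \int[lam]_x (s x * a x) <= C.
  by apply: (cvgr_to_le cvs); apply: nearW => k; exact: hC.
have mUA : measurable (U `\` A1 : set T) by apply: measurableD => //; exact: measurable_open_borelRn.
have mVA : measurable (V `\` A2 : set T) by apply: measurableD => //; exact: measurable_open_borelRn.
have iW (W : set T) : measurable W -> lam.-integrable [set: T] (EFin \o (fun x => \1_W x * `|a x|)).
  move=> mW; apply: (@integrable_bounded_mul _ T R lam setT measurableT (fun x => `|a x|) _ 1) => //.
  by move=> x; rewrite indicE; case: (_ \in _); rewrite ?normr1 ?normr0.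
have mW (W : set T) : measurable W -> m W = (\int[lam]_x (\1_W x * `|a x|))%:E.
  move=> mW; rewrite EFin_Rintegral//; last exact: iW.
  rewrite /m/= /density integral_mkcond; apply: eq_integral => x _.
  by rewrite patchE indicE /=; case: ifPn; rewrite ?mul1r ?mul0r.
(* The function [s] differs from the sign of [a] only where x lies in both [U] and [V], hence in one
   of the two small remainders. *)
have key x : `|a x| <= s x * a x + (\1_(U `\` A1) x * `|a x| + \1_(V `\` A2) x * `|a x|).
  have [Ox|/a0 ->] := pselect (Omega x); last by rewrite normr0 !mulr0 !addr0.
  have sE : s x = \1_U x - \1_V x.
    by rewrite /s mulN1r !indicE !in_setI (mem_set Ox) !andbT.
  rewrite sE !indicE !in_setD.
  have [apos|aneg|az] := ltgtP 0 (a x); last by rewrite -az normr0 !mulr0 !addr0.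
  - have x1 : x \in A1 by rewrite inE.
    have x2 : x \in A2 = false by apply/negbTE; rewrite notin_setE/= /A2/= => h; have := lt_trans h apos; rewrite ltxx.
    have xU : x \in U by rewrite inE; apply: AU.
    rewrite x1 x2 xU (gtr0_norm apos) andbF andbT.
    by case: (x \in V); rewrite /=; clear -apos; lra.
  - have x1 : x \in A2 by rewrite inE.
    have x2 : x \in A1 = false by apply/negbTE; rewrite notin_setE/= /A1/= => h; have := lt_trans h aneg; rewrite ltxx.
    have xV : x \in V by rewrite inE; apply: AV.
    rewrite x1 x2 xV (ltr0_norm aneg) andbF andbT.
    by case: (x \in U); rewrite /=; clear -aneg; lra.
apply: (@le_trans _ _ (\int[lam]_x (s x * a x + (\1_(U `\` A1) x * `|a x| + \1_(V `\` A2) x * `|a x|)))).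
  apply: le_Rintegral => //.
  exact: (integrableD measurableT isa (integrableD measurableT (iW _ mUA) (iW _ mVA))).
rewrite (RintegralD measurableT isa (integrableD measurableT (iW _ mUA) (iW _ mVA))).
rewrite (RintegralD measurableT (iW _ mUA) (iW _ mVA)).
move: mU mV; rewrite (mW _ mUA) (mW _ mVA) !lte_fin => h1 h2.
have := lerD saC (lerD (ltW h1) (ltW h2)); rewrite -splitr addrC.
by rewrite [X in _ -> _ <= X]addrC.
Qed.


Lemma is_derive_scaler (f : 'rV[R]_n -> R) (c : R) x v (df : R) :
  is_derive x v f df -> is_derive x v (fun y => c * f y) (c * df).
Proof.
move=> h; apply: is_derive_eq (is_deriveM (is_derive_cst c x v) h) _.
by rewrite scaler0 addr0.
Qed.

Lemma is_derive_bigsum I (s : seq I) (f : I -> 'rV[R]_n -> R) x v (df : I -> R) :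
  (forall i, is_derive x v (f i) (df i)) ->
  is_derive x v (fun y => \sum_(i <- s) f i y) (\sum_(i <- s) df i).
Proof.
move=> h; elim: s => [|i s IH].
  by rewrite big_nil; under eq_fun do rewrite big_nil; exact: is_derive_cst.
rewrite big_cons; under eq_fun do rewrite big_cons.
exact: is_deriveD (h i) IH.
Qed.

Section finite_perimeter_translation.
Variables (E F : set 'rV[R]_n).
Hypotheses (mF : measurable (F : set T)) (EF : {ae lam, forall x, E x <-> F x}).
Hypotheses (Ffin : (lam F < +oo)%E) (Pfin : (perimeter E < +oo)%E).
Local Notation chi := (\1_F : 'rV[R]_n -> R).
Local Notation P := (fine (perimeter E)).

Let ichi : lam.-integrable [set: T] (EFin \o chi).
Proof. exact: integrable_indic_lty. Qed.

Let mchi : measurable_fun [set: T] chi.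
Proof. exact: (@measurable_indic _ T). Qed.

Lemma perimeter_ge0 (i : 'I_n) : (0 <= perimeter E)%E.
Proof.
have := @perimeter_test R n E F (fun=> 0) (fun=> 0) i mF EF (test_function0 _).
have -> : \int[lam]_x (chi x * 0) = 0.
  by under eq_Rintegral do rewrite mulr0; rewrite Rintegral_cst// mul0r.
by apply => // x; rewrite ?normr0//; exact: is_derive_cst.
Qed.

Let test_le f g (i : 'I_n) : test_function setT f -> (forall x, `|f x| <= 1) -> measurable_fun [set: T] g ->
  (forall x, is_derive x (basisv i) f (g x)) -> `|\int[lam]_x (chi x * g x)| <= P.
Proof.
move=> tf f1 mg dg.
have PE : perimeter E = P%:E by rewrite fineK// ge0_fin_numE// (perimeter_ge0 i).
have h1 := perimeter_test mF EF tf f1 mg dg.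
have mNg : measurable_fun [set: T] (fun x => -1 * g x) by exact: measurable_funM.
have dNg x : is_derive x (basisv i) (fun x => -1 * f x) (-1 * g x).
  exact: is_derive_scaler.
have h2 := perimeter_test mF EF (test_function_scale (-1) tf) _ mNg dNg.
move: h1; rewrite PE lee_fin => h1.
have : \int[lam]_x (chi x * (-1 * g x)) <= P.
  by rewrite -lee_fin -PE; apply: h2 => x; rewrite mulN1r normrN.
have -> : \int[lam]_x (chi x * (-1 * g x)) = - \int[lam]_x (chi x * g x).
  rewrite -[RHS]mulN1r -[RHS]RintegralZl_total; last exact: measurable_funM.
  by apply: eq_Rintegral => x _; rewrite mulrCA.
by move=> h3; rewrite ler_norml h1 andbT lerNl.
Qed.

(* The Riemann sum [t g_N] of [g = D_i psi] along the segment is [t] times the derivative of the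
   test function [f_N], and its error is controlled by the second derivative. *)
Lemma test_difference_le psi (i : 'I_n) (t : R) : test_function setT psi -> (forall x, `|psi x| <= 1) ->
  0 <= t -> `|\int[lam]_x (chi x * (psi (x + t *: basisv i) - psi x))| <= t * P.
Proof.
move=> tpsi psi1 t0.
have [g tg dg] := test_function_derive i tpsi.
have [g' tg' dg'] := test_function_derive i tg.
have [M hM] := test_function_bounded tg'.
have M0 : 0 <= M by exact: le_trans (normr_ge0 _) (hM 0).
have mpsi := test_function_measurable tpsi; have mg := test_function_measurable tg.
(* A second order Taylor bound: the mean value theorem for psi, then the Lipschitz bound for its
   derivative [g]. *)
have step y (s : R) : 0 <= s -> `|psi (s *: basisv i + y) - psi y - s * g y| <= M * s ^+ 2.
  move=> s0; pose u r := psi (r *: basisv i + y).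
  have du (r : R) := (is_derive_line psi y (basisv i) r (g (r *: basisv i + y))).1 (dg _).
  have cu : {within `[0, s], continuous u}.
    by apply: derivable_within_continuous => r _; exact: ex_derive.
  have [c] := MVT_segment s0 (fun r _ => du r) cu.
  rewrite in_itv/= => /andP[c0 cs]; rewrite /u scale0r add0r subr0 => ->.
  rewrite mulrC -mulrBr normrM (ger0_norm s0) expr2 mulrCA ler_wpM2l//.
  apply: le_trans (directional_lipschitz dg' hM y c) _.
  by rewrite ger0_norm// ler_wpM2l.
have bound (N : nat) : (0 < N)%N ->
  `|\int[lam]_x (chi x * (psi (x + t *: basisv i) - psi x))| <= t * P + M * t ^+ 2 * fine (lam F) / N%:R.
  move=> N0; pose tau := t / N%:R; have tau0 : 0 <= tau by rewrite divr_ge0.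
  have Ntau : N%:R * tau = t by rewrite mulrC divfK// pnatr_eq0 -lt0n.
  pose sh (k : nat) (x : 'rV[R]_n) := x + (k%:R * tau) *: basisv i.
  (* An average of translates keeps the bound 1, hence is admissible for the perimeter. The N Taylor
     errors add up to N M (t/N)^2, which vanishes as N grows. *)
  pose fN x := N%:R^-1 * \sum_(k <- iota 0 N) psi (sh k x).
  pose gN x := N%:R^-1 * \sum_(k <- iota 0 N) g (sh k x).
  have tfN : test_function setT fN.
    by apply: test_function_scale; apply: test_function_sum => k; exact: test_function_translate.
  have fN1 x : `|fN x| <= 1.
    rewrite /fN normrM ger0_norm ?invr_ge0// mulrC ler_pdivrMr ?ltr0n// mul1r.
    apply: le_trans (ler_norm_sum _ _ _) _.
    apply: (@le_trans _ _ (\sum_(k <- iota 0 N) 1)); first by apply: ler_sum.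
    by rewrite big_const_seq count_predT size_iota iter_addr addr0.
  have mgN : measurable_fun [set: T] gN.
    apply: measurable_funM => //; apply: measurable_sum => k.
    exact: measurable_translate.
  have dgN x : is_derive x (basisv i) fN (gN x).
    apply: is_derive_scaler; apply: (@is_derive_bigsum _ _ (fun k y => psi (sh k y)) _ _ (fun k => g (sh k x))) => k.
    exact: is_derive_translate.
  have hP := test_le tfN fN1 mgN dgN.
  have err x : `|psi (x + t *: basisv i) - psi x - t * gN x| <= M * t ^+ 2 / N%:R.
    have -> : psi (x + t *: basisv i) - psi x - t * gN x =
        \sum_(0 <= k < N) (psi (sh k.+1 x) - psi (sh k x) - tau * g (sh k x)).
      rewrite sumrB telescope_sumr// {1 2}/sh Ntau mul0r scale0r addr0; congr (_ - _).
      by rewrite /gN -mulr_sumr mulrA; congr (_ * _); rewrite /index_iota subn0.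
    apply: le_trans (ler_norm_sum _ _ _) _.
    apply: (@le_trans _ _ (\sum_(0 <= k < N) (M * tau ^+ 2))).
      apply: ler_sum => k _; have := step (sh k x) _ tau0.
      have -> // : tau *: basisv i + sh k x = sh k.+1 x.
      by rewrite /sh addrCA -scalerDl -natr1 mulrDl mul1r addrC [tau + _]addrC addrC.
    rewrite big_const_nat subn0 iter_addr addr0 -mulr_natr.
    have N1 : N%:R != 0 :> R by rewrite pnatr_eq0 -lt0n.
    by rewrite le_eqVlt; apply/orP; left; apply/eqP; rewrite /tau; field.
  pose e x := psi (x + t *: basisv i) - psi x - t * gN x.
  have me : measurable_fun [set: T] e.
    apply: measurable_funB; last exact: measurable_funM.
    by apply: measurable_funB => //; exact: measurable_translate.
  have gNM x : `|gN x| <= N%:R^-1 * \sum_(k <- iota 0 N) `|g (sh k x)|.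
    by rewrite /gN normrM ger0_norm ?invr_ge0// ler_wpM2l ?invr_ge0// ler_norm_sum.
  have [B hB] := test_function_bounded tg.
  have gNB x : `|t * gN x| <= `|t * (N%:R^-1 * \sum_(k <- iota 0 N) B)|.
    rewrite !normrM ler_wpM2l// ler_wpM2l//; apply: le_trans (ler_norm _).
    by apply: le_trans (ler_norm_sum _ _ _) _; apply: ler_sum.
  have ie : lam.-integrable [set: T] (EFin \o (fun x => e x * chi x)).
    exact: integrable_bounded_mul me err ichi.
  have ig : lam.-integrable [set: T] (EFin \o (fun x => t * gN x * chi x)).
    by apply: (@integrable_bounded_mul _ T R lam setT measurableT chi (fun x => t * gN x) _ _ gNB ichi); exact: measurable_funM.
  have -> : \int[lam]_x (chi x * (psi (x + t *: basisv i) - psi x)) =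
      \int[lam]_x (e x * chi x) + t * \int[lam]_x (chi x * gN x).
    rewrite -RintegralZl_total; last exact: measurable_funM.
    under [X in _ = _ + X]eq_Rintegral do rewrite (mulrC (chi _)) mulrA.
    rewrite -RintegralD//; apply: eq_Rintegral => x _; rewrite /e; ring.
  rewrite addrC; apply: le_trans (ler_normD _ _) _; apply: lerD.
    by rewrite normrM (ger0_norm t0) ler_wpM2l.
  apply: le_trans (le_normr_Rintegral measurableT ie) _.
  have ic : lam.-integrable [set: T] (EFin \o (fun x => M * t ^+ 2 / N%:R * chi x)).
    under [X in _.-integrable _ X]eq_fun do rewrite /= EFinM.
    exact: integrableZl.
  apply: (@le_trans _ _ (\int[lam]_x (M * t ^+ 2 / N%:R * chi x))).
    apply: le_Rintegral => //; first by have := integrable_norm ie.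
    move=> x _; rewrite normrM [X in _ * X]ger0_norm ?indicE ?ler0n//.
    by rewrite ler_wpM2r ?ler0n//; exact: err.
  rewrite RintegralZl//.
  have -> : \int[lam]_x chi x = fine (lam F).
    by congr fine; rewrite integral_indic// setIT.
  by rewrite mulrAC.
apply/ler_addgt0Pl => e e0.
pose c := M * t ^+ 2 * fine (lam F).
have c0 : 0 <= c by rewrite !mulr_ge0// ?exprn_ge0// fine_ge0.
have [N hN] : exists N : nat, c / e < N%:R.
  by exists (Num.truncn (c / e)).+1; exact: truncnS_gt.
have N0 : (0 < N)%N by rewrite -(ltr_nat R); apply: le_lt_trans hN; rewrite divr_ge0// ltW.
apply: le_trans (bound N N0) _; rewrite addrC lerD2r -/c.
by rewrite ler_pdivrMr ?ltr0n// mulrC -ler_pdivrMr// ltW.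
Qed.


Definition translation_defect (z : 'rV[R]_n) : R := \int[lam]_x `|chi (x + z) - chi x|.
Local Notation Td := translation_defect.

Let idiff z : lam.-integrable [set: T] (EFin \o (fun x => chi (x + z) - chi x)).
Proof.
have iz := integrable_translate z ichi.
exact: (integrableB measurableT iz ichi).
Qed.

Let indiff z : lam.-integrable [set: T] (EFin \o (fun x => `|chi (x + z) - chi x|)).
Proof. by have := integrable_norm (idiff z). Qed.

Let mndiff z : measurable_fun [set: T] (fun x => `|chi (x + z) - chi x|).
Proof. by apply/measurable_EFinP; exact: measurable_int (indiff z). Qed.

Lemma translation_defect_ge0 z : 0 <= Td z.
Proof. by apply: Rintegral_ge0. Qed.

Lemma translation_defect_le_volume z : Td z <= 2 * fine (lam F).
Proof.
have iz := integrable_translate z ichi.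
have cF : \int[lam]_x chi x = fine (lam F) by congr fine; rewrite integral_indic// setIT.
have -> : 2 * fine (lam F) = \int[lam]_x (chi (x + z) + chi x).
  rewrite (RintegralD measurableT iz ichi) (Rintegral_translate z mchi) cF; ring.
apply: le_Rintegral => //; first exact: (integrableD measurableT iz ichi).
move=> x _; apply: le_trans (ler_normB _ _) _.
by rewrite !ger0_norm// indicE ler0n.
Qed.

Let defectN z : Td (- z) = Td z.
Proof.
rewrite /translation_defect -(Rintegral_translate z (mndiff (- z))).
by apply: eq_Rintegral => x _; rewrite addrK distrC.
Qed.

Let defectD z w : Td (z + w) <= Td z + Td w.
Proof.
have h := integrable_translate w (indiff z).
rewrite /translation_defect -(Rintegral_translate w (mndiff z)) -(RintegralD measurableT h (indiff w)).
apply: le_Rintegral => //; first exact: (integrableD measurableT h (indiff w)).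
move=> x _; rewrite addrA addrAC.
exact: ler_distD.
Qed.

Let defect_basis i t : Td (t *: basisv i) <= `|t| * P.
Proof.
wlog t0 : t / 0 <= t => [H|].
  have [/H//|t0] := leP 0 t.
  rewrite -defectN -scaleNr -(normrN t); apply: H; rewrite oppr_ge0; exact: ltW.
(* Using -z in place of z makes the translation act on the test function as a shift by +t, matching
   the estimate for differences of psi. *)
rewrite -defectN (ger0_norm t0); apply: (@Rintegral_norm_le_dual setT) => //; first exact: openT.
  by move=> x /(_ I).
move=> psi tpsi psi1.
have [M hM] := test_function_bounded tpsi; have mpsi := test_function_measurable tpsi.
have mpsit := measurable_translate (t *: basisv i) mpsi.
have ic v : lam.-integrable [set: T] (EFin \o (fun x => psi x * chi (x + v))).
  exact: integrable_bounded_mul mpsi hM (integrable_translate v ichi).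
have ic0 : lam.-integrable [set: T] (EFin \o (fun x => psi x * chi x)).
  exact: integrable_bounded_mul mpsi hM ichi.
have ic1 : lam.-integrable [set: T] (EFin \o (fun x => psi (x + t *: basisv i) * chi x)).
  by apply: (integrable_bounded_mul measurableT mpsit _ ichi) => x; exact: hM.
suff -> : \int[lam]_x (psi x * (chi (x - t *: basisv i) - chi x)) =
    \int[lam]_x (chi x * (psi (x + t *: basisv i) - psi x)).
  exact: le_trans (ler_norm _) (test_difference_le i tpsi psi1 t0).
under eq_Rintegral do rewrite mulrBr.
under [RHS]eq_Rintegral do rewrite mulrBr (mulrC (chi _)) (mulrC (chi _)).
rewrite (RintegralB measurableT (ic _) ic0) (RintegralB measurableT ic1 ic0); congr (_ - _).
rewrite -[LHS](Rintegral_translate (t *: basisv i)); last first.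
  apply: measurable_funM => //; exact: measurable_translate.
by apply: eq_Rintegral => x _; rewrite addrK.
Qed.

(** The defect is subadditive, and each of the n coordinate steps costs at most |z_i| P <= |z| P;
    this is the origin of the factor n. *)
Lemma translation_defect_le_enorm z : Td z <= n%:R * P * enorm z.
Proof.
have T0 : Td 0 = 0.
  rewrite /translation_defect; under eq_Rintegral do rewrite addr0 subrr normr0.
  by rewrite Rintegral_cst// mul0r.
have H (s : seq 'I_n) : Td (\sum_(i <- s) z ord0 i *: basisv i) <= \sum_(i <- s) `|z ord0 i| * P.
  elim: s => [|i s IH]; first by rewrite !big_nil T0.
  rewrite !big_cons; exact: le_trans (defectD _ _) (lerD (defect_basis i (z ord0 i)) IH).
rewrite {1}(row_sum_delta z); apply: le_trans (H _) _.
apply: (@le_trans _ _ (\sum_(i < n) enorm z * P)).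
  by apply: ler_sum => i _; rewrite ler_wpM2r ?ler_coord_enorm// fine_ge0// (perimeter_ge0 i).
by rewrite sumr_const card_ord -[leLHS]mulr_natl le_eqVlt; apply/orP; left; apply/eqP; ring.
Qed.

End finite_perimeter_translation.

End translation_estimate.

(** * Membership in the fractional Sobolev space *)

Section finite_perimeter_W.
Context {R : realType} {n : nat}.
Local Notation T := (borelRn R n).
Local Notation lam := (lebesgue_borelRn R n).
Local Notation Leb := (lebesgueRn R n).
Variables (alpha : R) (E F : set 'rV[R]_n).
Hypotheses (n1 : (1 <= n)%N) (a01 : 0 < alpha < 1).
Hypotheses (mF : measurable (F : set T)) (EF : {ae lam, forall x, E x <-> F x}).
Hypotheses (Ffin : (lam F < +oo)%E) (Pfin : (perimeter E < +oo)%E).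
Local Notation chi := (\1_F : 'rV[R]_n -> R).

Let mchi : measurable_fun [set: T] chi.
Proof. exact: (@measurable_indic _ T). Qed.

Let finite_nonlocal :
  (\int[lam]_y \int[lam]_z (nonlocal_quotient alpha chi (y, z))%:E < +oo)%E.
Proof.
rewrite (@fubini_tonelli _ _ T T R lam lam (EFin \o nonlocal_quotient alpha chi)); last 2 first.
- by apply/measurable_EFinP; exact: measurable_nonlocal_quotient.
- by move=> p; rewrite lee_fin nonlocal_quotient_ge0.
(* The perimeter term handles |z| < 1 and the volume term |z| >= 1; together they give a bound by C
   min(1, |z|), so that [fkernel] dominates. *)
pose C := n%:R * fine (perimeter E) + 2 * fine (lam F).
have inner (z : T) : (\int[lam]_x (EFin \o nonlocal_quotient alpha chi) (x, z) =
    (translation_defect F z / enorm z `^ (n%:R + alpha))%:E)%E.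
  rewrite mulrC -RintegralZl_total; last first.
    apply: measurableT_comp => //; apply: measurable_funB => //; exact: measurable_translate.
  rewrite EFin_Rintegral//.
    by apply: eq_integral => x _ /=; rewrite /nonlocal_quotient/= mulrC.
  have iz := integrable_indic_lty mF Ffin.
  have := integrable_norm (integrableB measurableT (integrable_translate z iz) iz).
  move=> /(integrableZl measurableT (enorm z `^ (n%:R + alpha))^-1).
  by apply: eq_integrable => // x _ /=; rewrite EFinM.
under eq_integral do rewrite inner.
have iCf : lam.-integrable [set: T] (EFin \o (fun z => C * fkernel alpha z)).
  under [X in _.-integrable _ X]eq_fun do rewrite /= EFinM.
  by apply: integrableZl => //; exact: integrable_fkernel.
have := integrable_lty measurableT iCf; apply: le_lt_trans.
apply: ge0_le_integral => //.
- by move=> z _; rewrite lee_fin divr_ge0 ?translation_defect_ge0 ?powR_ge0.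
- have := @measurable_fun_fubini_tonelli_G _ _ T T R lam (EFin \o nonlocal_quotient alpha chi).
  move=> /(_ _ _); rewrite /fubini_G; under eq_fun do rewrite inner.
  apply; last by move=> p; rewrite lee_fin nonlocal_quotient_ge0.
  by apply/measurable_EFinP; exact: measurable_nonlocal_quotient.
- exact: measurable_int iCf.
move=> z _; rewrite lee_fin fkernelE mulrA ler_wpM2r ?invr_ge0 ?powR_ge0//.
have h1 := translation_defect_le_volume mF Ffin z.
have h2 := translation_defect_le_enorm mF EF Ffin Pfin z.
have P0 : 0 <= fine (perimeter E).
  by have := perimeter_ge0 mF EF (Ordinal n1); exact: fine_ge0.
have [ez|ez] := leP 1 (enorm z).
  by rewrite mulr1 (le_trans h1)// lerDr mulr_ge0.
rewrite (le_trans h2)// ler_wpM2r ?enorm_ge0// lerDl mulr_ge0// fine_ge0//.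
Qed.

Lemma finite_perimeter_W_alpha_1 : W_alpha_1 alpha \1_E.
Proof.
split; last by rewrite (double_integral_nonlocal alpha mF EF).
apply/(@ae_integrable_lebesgueRn R n _ (EFin \o chi)); last exact: integrable_indic_lty.
  exact/measurable_EFinP.
by apply: (ae_imply _ EF) => x Ex /=; rewrite !indicE; congr ((_ : bool)%:R%:E); apply: asbool_equiv_eq.
Qed.

Lemma finite_perimeter_frac_perimeter : (frac_perimeter alpha E setT < +oo)%E.
Proof.
rewrite /frac_perimeter setCT (double_integral_nonlocal alpha mF EF).
rewrite [X in (_ + _ * X)%E](_ : _ = 0%E) ?mule0 ?adde0//.
by apply: integral0_eq => y _; rewrite integral_set0.
Qed.

End finite_perimeter_W.

(** * The Riesz potential representation *)

Section derivative_integral.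
Context {R : realType} {n : nat}.
Local Notation T := (borelRn R n).
Local Notation lam := (lebesgue_borelRn R n).

(** Every difference quotient has integral 0 by translation invariance, and the quotients are
    dominated by L on a fixed cube, so the limit has integral 0 too. *)
Lemma Rintegral_derive0 (f df : 'rV[R]_n -> R) (v : 'rV[R]_n) (L M r : R) :
  measurable_fun [set: T] f -> (forall x, `|f x| <= M) -> (forall x, r < `|x| -> f x = 0) ->
  (forall x, is_derive x v f (df x)) -> (forall x, `|df x| <= L) -> `|v| <= 1 ->
  lam.-integrable [set: T] (EFin \o df) /\ \int[lam]_x df x = 0.
Proof.
move=> mf fM f0 dE dL v1.
have L0 : 0 <= L by exact: le_trans (normr_ge0 _) (dL 0).
(* The margin absorbs displacements of length at most 1: outside [B] both points of every difference
   quotient have norm above r. *)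
pose B : set 'rV[R]_n := ball 0 (`|r| + 2).
have r0 : 0 < `|r| + 2 by rewrite ltr_wpDl.
have mB : measurable (B : set T) by apply: measurable_open_borelRn; exact: ball_open.
have Bfin : (lam B < +oo)%E by rewrite /B [X in (X < _)%E]lebesgue_ball// ltry.
have nB x : ~ B x -> `|r| + 1 < `|x|.
  rewrite /B -ball_normE/= sub0r normrN => /negP; rewrite -leNgt; apply: lt_le_trans.
  by rewrite ltrD2l ltr1n.
have fint : lam.-integrable [set: T] (EFin \o f).
  have := integrable_bounded_mul measurableT mf fM (integrable_indic_lty mB Bfin).
  apply: eq_integrable => // x _ /=; rewrite indicE.
  have [xA|/negP xA] := boolP (x \in B); rewrite ?mulr1// f0 ?mul0r//.
  apply: le_lt_trans (nB x _); last by move=> Bx; apply: xA; rewrite inE.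
  by rewrite (le_trans (ler_norm r))// lerDl.
pose q (k : nat) x := k.+1%:R * (f (x + k.+1%:R^-1 *: v) - f x).
have mq k : measurable_fun [set: T] (q k).
  by apply: measurable_funM => //; apply: measurable_funB => //; exact: measurable_translate.
have q0 k : \int[lam]_x q k x = 0.
  have fk := integrable_translate (k.+1%:R^-1 *: v) fint.
  rewrite RintegralZl_total; last by apply: measurable_funB => //; exact: measurable_translate.
  by rewrite (RintegralB measurableT fk fint) Rintegral_translate// subrr mulr0.
have iB : lam.-integrable [set: T] (EFin \o (fun x => L * \1_B x)).
  under [X in _.-integrable _ X]eq_fun do rewrite /= EFinM.
  by apply: integrableZl => //; exact: integrable_indic_lty.
have qB k x : `|q k x| <= L * \1_B x.
  have k0 : 0 < k.+1%:R^-1 :> R by rewrite invr_gt0.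
  have [xA|/negP xA] := boolP (x \in B).
    rewrite indicE xA mulr1 /q normrM ger0_norm// mulrC -ler_pdivlMr// (addrC x).
    by apply: le_trans (directional_lipschitz dE dL x _) _; rewrite ger0_norm// ltW.
  have xr : `|r| + 1 < `|x| by apply: nB => Bx; apply: xA; rewrite inE.
  rewrite /q !f0 ?subrr ?mulr0 ?normr0 ?mulr_ge0// ?indicE//.
    by apply: le_lt_trans xr; rewrite (le_trans (ler_norm r))// lerDl.
  have h1 : `|k.+1%:R^-1 *: v| <= 1.
    rewrite normrZ (gtr0_norm k0) mulr_ile1 ?(ltW k0)//.
    by rewrite invf_le1// ler1n.
  apply: le_lt_trans (ler_norm r) _; apply: lt_le_trans (lerB_normD x _).
  by apply: lt_le_trans (lerB (lexx _) h1); rewrite ltrBrDr.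
have cq x : q k x @[k --> \oo] --> df x.
  have [dv dvE] := dE x.
  have cv : (fun h => h^-1 *: (f (h *: v + x) - f x)) @ (0 : R)^' --> df x.
    by rewrite -dvE; exact: dv.
  have c0 : k.+1%:R^-1 @[k --> \oo] --> (0 : R)^'.
    move=> A [del /= del0 hdel].
    have [N _ hN] := near_infty_natSinv_lt (PosNum del0).
    exists N => // k /= /hN kd; apply: hdel; last by rewrite invr_neq0.
    by rewrite /ball_/= sub0r normrN gtr0_norm// invr_gt0.
  have := cvg_comp _ _ c0 cv; apply: cvg_trans; apply: near_eq_cvg; apply: nearW => k /=.
  by rewrite invrK /q (addrC x).
have [idf cint] := @Rintegral_dominated_cvg _ T R lam q df (fun x => L * \1_B x) mq cq iB qB.
split => //; rewrite -(cvg_lim _ cint)//.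
by under eq_fun do rewrite q0; exact: lim_cst.
Qed.

End derivative_integral.

Section riesz_potential.
Context {R : realType} {n : nat}.
Local Notation T := (borelRn R n).
Local Notation lam := (lebesgue_borelRn R n).
Variable alpha : R.
Hypotheses (n1 : (1 <= n)%N) (a01 : 0 < alpha < 1).
Local Notation p := (n%:R + alpha - 1).

Definition potential (z : 'rV[R]_n) : R := (enorm z `^ p)^-1.

Lemma potential_exponent_gt0 : 0 < p.
Proof.
have /andP[a0 _] := a01; have : 1 <= n%:R :> R by rewrite ler1n.
lra.
Qed.

Lemma measurable_potential : measurable_fun [set: T] potential.
Proof. by apply: measurable_invr; apply: measurable_funpowR; exact: measurable_enorm. Qed.

Lemma potential_ge0 z : 0 <= potential z.
Proof. by rewrite invr_ge0 powR_ge0. Qed.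

(** The two functions coincide for 0 < |z| < 1, and the potential is at most 1 for |z| >= 1. It is
    not integrable at infinity, so it is always paired with a factor of bounded support. *)
Lemma potential_le z : potential z <= fkernel alpha z + 1.
Proof.
have p0 := potential_exponent_gt0.
have [->|z0] := eqVneq z 0.
  by rewrite /potential enorm0 powR0 ?gt_eqF// invr0 addr_ge0// fkernel_ge0.
have e0 : 0 < enorm z by rewrite enorm_gt0.
have [e1|e1] := leP 1 (enorm z).
  rewrite (@le_trans _ _ 1)// ?lerDr ?fkernel_ge0// invf_le1 ?powR_gt0//.
  by rewrite -[leLHS](powRr0 (enorm z)) ler_powR// ltW.
rewrite (@le_trans _ _ (fkernel alpha z))// ?lerDl//.
rewrite fkernelE (min_idPr (ltW e1)) /potential.
rewrite powRB ?enorm_eq0 ?z0 ?implybT// powRr1 ?enorm_ge0// invf_div.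
by [].
Qed.

(* [reg d] and [dreg d] regularize |z|^-p and |z|^-(p+2). *)
Let reg (d : R) (z : 'rV[R]_n) : R := ((dotv z z + d) `^ (p / 2))^-1.
Let dreg (d : R) (z : 'rV[R]_n) : R := ((dotv z z + d) `^ (p / 2 + 1))^-1.

Let arg_gt0 (d : R) (z : 'rV[R]_n) : 0 < d -> 0 < dotv z z + d.
Proof. by move=> d0; rewrite ltr_wpDl// dotvv_ge0. Qed.

Let measurable_arg (d : R) : measurable_fun [set: T] (fun z : T => dotv (z : 'rV[R]_n) z + d).
Proof. by apply: measurable_funD => //; exact: measurable_dotv. Qed.

Let measurable_reg d : measurable_fun [set: T] (reg d).
Proof. by apply: measurable_invr; apply: measurable_funpowR. Qed.

Let measurable_dreg d : measurable_fun [set: T] (dreg d).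
Proof. by apply: measurable_invr; apply: measurable_funpowR. Qed.

Let is_derive_reg (d : R) z i : 0 < d -> is_derive z (basisv i) (reg d) (- p * (z ord0 i * dreg d z)).
Proof.
move=> d0; have c0 := arg_gt0 z d0.
have dc j : is_derive z (basisv i) (fun y : 'rV[R]_n => y ord0 j) ((basisv i : 'rV[R]_n) ord0 j).
  exact: (@is_derive_coord R n id z (basisv i) (basisv i) j (is_derive_id _ _)).
have darg : is_derive z (basisv i) (fun y => dotv y y + d) (2 * z ord0 i).
  have ds : is_derive z (basisv i) (fun y : 'rV[R]_n => dotv y y)
      (\sum_j (z ord0 j * (basisv i : 'rV[R]_n) ord0 j + z ord0 j * (basisv i : 'rV[R]_n) ord0 j)).
    apply: (@is_derive_bigsum R n _ _ (fun j y => y ord0 j * y ord0 j)) => j.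
    exact: is_deriveM (dc j) (dc j).
  have E : \sum_j (z ord0 j * (basisv i : 'rV[R]_n) ord0 j + z ord0 j * (basisv i : 'rV[R]_n) ord0 j) = 2 * z ord0 i.
    rewrite (bigD1 i)//= big1 ?addr0; last first.
      by move=> j ji; rewrite !mxE (negbTE ji) andbF mulr0 addr0.
    by rewrite !mxE !eqxx mulr1 mulr2n mulrDl mul1r.
  rewrite E in ds; have := is_deriveD ds (is_derive_cst d z (basisv i)).
  by rewrite addr0.
have h := is_derive_chain darg (@is_derive1_powR R (- (p / 2)) _ c0).
have -> : reg d = (fun y => (dotv y y + d) `^ (- (p / 2))).
  by apply/funext => y; rewrite /reg powRN.
apply: is_derive_eq h _.
have -> : dreg d z = (dotv z z + d) `^ (- (p / 2) - 1) by rewrite /dreg -powRN opprD.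
move: (_ `^ _ : R) (z ord0 i : R) => c t; rewrite !mulNr; congr (- _).
by field.
Qed.

Let reg_ge0 d z : 0 <= reg d z. Proof. by rewrite invr_ge0 powR_ge0. Qed.
Let dreg_ge0 d z : 0 <= dreg d z. Proof. by rewrite invr_ge0 powR_ge0. Qed.

Let inv_powR_le (s t r : R) : 0 < s -> s <= t -> 0 <= r -> (t `^ r)^-1 <= (s `^ r)^-1.
Proof.
move=> s0 st r0; have t0 := lt_le_trans s0 st.
rewrite lef_pV2 ?posrE ?powR_gt0//.
by apply: ge0_ler_powR => //; rewrite nnegrE ltW.
Qed.

Let reg_bound (d : R) z : 0 < d -> reg d z <= (d `^ (p / 2))^-1.
Proof.
move=> d0; apply: inv_powR_le => //; first by rewrite lerDr dotvv_ge0.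
by rewrite divr_ge0// ltW// potential_exponent_gt0.
Qed.

Let dreg_bound (d : R) z : 0 < d -> dreg d z <= (d `^ (p / 2 + 1))^-1.
Proof.
move=> d0; apply: inv_powR_le => //; first by rewrite lerDr dotvv_ge0.
by rewrite addr_ge0// divr_ge0// ltW// potential_exponent_gt0.
Qed.

Let enorm_powR_sqr (z : 'rV[R]_n) (r : R) : dotv z z `^ (r / 2) = enorm z `^ r.
Proof.
by rewrite -sqr_enorm -powR_mulrn ?enorm_ge0// -powRrM; congr (_ `^ _); field.
Qed.

Let reg0 z : reg 0 z = potential z.
Proof. by rewrite /reg addr0 enorm_powR_sqr. Qed.

Let dreg0 (z : 'rV[R]_n) i : z ord0 i * dreg 0 z = riesz_kernel alpha i z.
Proof.
rewrite /dreg addr0 /riesz_kernel; congr (_ / _).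
(* The exponents match because p + 2 = n + alpha + 1. *)
by rewrite -(enorm_powR_sqr _ (n%:R + alpha + 1)); congr (_ `^ _); field.
Qed.

Let reg_le z (d : R) : 0 <= d -> z != 0 -> reg d z <= potential z.
Proof.
move=> d0 z0; rewrite -reg0; apply: inv_powR_le.
- by rewrite addr0 -sqr_enorm exprn_gt0// enorm_gt0.
- by rewrite lerD2l.
- by rewrite divr_ge0// ltW// potential_exponent_gt0.
Qed.

Let dreg_le (z : 'rV[R]_n) (d : R) i : 0 <= d -> `|z ord0 i * dreg d z| <= (enorm z `^ (n%:R + alpha))^-1.
Proof.
move=> d0; have [->|z0] := eqVneq z 0; first by rewrite mxE mul0r normr0 invr_ge0 powR_ge0.
apply: le_trans (riesz_kernel_le alpha i z); rewrite -dreg0 !normrM ler_wpM2l//.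
rewrite !ger0_norm//; apply: inv_powR_le.
- by rewrite addr0 -sqr_enorm exprn_gt0// enorm_gt0.
- by rewrite lerD2l.
- by rewrite addr_ge0// divr_ge0// ltW// potential_exponent_gt0.
Qed.

Let cvg_inv_powR (s r : R) : 0 < s -> ((s + k.+1%:R^-1) `^ r)^-1 @[k --> \oo] --> (s `^ r)^-1.
Proof.
move=> s0; have cs : s + k.+1%:R^-1 @[k --> \oo] --> s.
  rewrite -[X in _ --> X]addr0; apply: cvgD; first exact: cvg_cst.
  exact: cvg_harmonic.
apply: cvgV; first by rewrite gt_eqF// powR_gt0.
apply: (@continuous_cvg nat R R \oo _ (fun k => s + k.+1%:R^-1) (fun x => x `^ r) s) => //.
apply: differentiable_continuous; apply/derivable1_diffP.
exact: (@ex_derive _ _ _ _ _ _ _ (is_derive1_powR r s0)).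
Qed.

Let dot_gt0 (z : 'rV[R]_n) : z != 0 -> 0 < dotv z z + 0.
Proof. by move=> z0; rewrite addr0 -sqr_enorm exprn_gt0// enorm_gt0. Qed.

Let cvg_reg (z : 'rV[R]_n) : z != 0 -> reg k.+1%:R^-1 z @[k --> \oo] --> potential z.
Proof.
move=> z0; rewrite -reg0 /reg; have := @cvg_inv_powR _ (p / 2) (dot_gt0 z0).
by under eq_fun do rewrite addr0.
Qed.

Let cvg_dreg (z : 'rV[R]_n) i : z ord0 i * dreg k.+1%:R^-1 z @[k --> \oo] --> riesz_kernel alpha i z.
Proof.
have [->|z0] := eqVneq z 0.
  have z00 : (0 : 'rV[R]_n) ord0 i = 0 by rewrite mxE.
  rewrite /riesz_kernel z00 mul0r; under eq_fun do rewrite mul0r.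
  exact: cvg_cst.
rewrite -dreg0; apply: cvgM; first exact: cvg_cst.
have := @cvg_inv_powR _ (p / 2 + 1) (dot_gt0 z0).
by under eq_fun do rewrite addr0.
Qed.

Let ae_neq0 : {ae lam, forall z : 'rV[R]_n, z != 0}.
Proof.
exists [set (0 : 'rV[R]_n)]; split.
- by apply: measurable_closed_borelRn; apply: compact_closed; [exact: norm_hausdorff|exact: compact_set1].
- apply/eqP; rewrite eq_le measure_ge0 andbT; apply/lee_addgt0Pr => e e0; rewrite add0e.
  pose r := Num.min (e / 2) (1 / 2).
  have r0 : 0 < r by rewrite lt_min !divr_gt0.
  apply: (@le_trans _ _ (lam (ball (0 : 'rV[R]_n) r))).
    apply: le_measure; rewrite ?inE.
    - by apply: measurable_closed_borelRn; apply: compact_closed; [exact: norm_hausdorff|exact: compact_set1].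
    - by apply: measurable_open_borelRn; exact: ball_open.
    - by move=> _ /= ->; exact: ballxx.
  rewrite [leLHS]lebesgue_ball// lee_fin.
  have r1 : r *+ 2 <= 1 by rewrite -mulr_natr -ler_pdivlMr// ge_min lexx orbT.
  have re : r *+ 2 <= e by rewrite -mulr_natr -ler_pdivlMr// ge_min lexx.
  apply: le_trans re; case: n n1 => // m _; rewrite exprS ler_piMr ?mulrn_wge0 ?(ltW r0)//.
  by rewrite exprn_ile1// mulrn_wge0// ltW.
- by move=> z /= /negP; rewrite negbK => /eqP.
Qed.

(** Decay at infinity comes from the unregularized kernel, where it is at most [fkernel]; near 0 the
    regularization makes the function bounded. *)
Let integrable_odd (d : R) i : 0 < d -> lam.-integrable [set: T] (EFin \o (fun z : 'rV[R]_n => z ord0 i * dreg d z)).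
Proof.
move=> d0; pose C := (d `^ (p / 2 + 1))^-1.
pose B : set 'rV[R]_n := ball 0 1.
have mB : measurable (B : set T) by apply: measurable_open_borelRn; exact: ball_open.
have Bfin : (lam B < +oo)%E by rewrite /B [X in (X < _)%E]lebesgue_ball// ltry.
have iB : lam.-integrable [set: T] (EFin \o (fun x => C * \1_B x)).
  under [X in _.-integrable _ X]eq_fun do rewrite /= EFinM.
  by apply: integrableZl => //; exact: integrable_indic_lty.
have C0 : 0 <= C by rewrite invr_ge0 powR_ge0.
apply: le_integrable (integrableD measurableT (integrable_fkernel n1 a01) iB) => //.
  apply/measurable_EFinP; apply: measurable_funM => //; exact: measurable_coord.
move=> z _; rewrite /= lee_fin [leRHS]ger0_norm; last first.
  by rewrite addr_ge0 ?fkernel_ge0// mulr_ge0// indicE.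
have [e1|e1] := leP 1 (enorm z).
  apply: le_trans (dreg_le z i (ltW d0)) _.
  by rewrite fkernelE (min_idPl e1) mul1r lerDl mulr_ge0// indicE.
have zB : B z.
  by rewrite /B -ball_normE/= sub0r normrN; exact: le_lt_trans (ler_norm_enorm _) e1.
have IB : \1_B z = 1 :> R by rewrite indicE mem_set.
rewrite IB mulr1 normrM (ger0_norm (dreg_ge0 _ _)).
apply: (@le_trans _ _ C); last by rewrite lerDr fkernel_ge0.
rewrite -[leRHS]mul1r ler_pM//; last exact: dreg_bound.
exact: le_trans (ler_coord_enorm _ _) (ltW e1).
Qed.

Let odd_integral0 (d : R) i : 0 < d -> \int[lam]_z ((z : 'rV[R]_n) ord0 i * dreg d z) = 0.
Proof.
move=> d0; have id := integrable_odd i d0.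
have md : measurable_fun [set: T] (fun z : 'rV[R]_n => z ord0 i * dreg d z).
  by apply/measurable_EFinP; exact: measurable_int id.
have : \int[lam]_z ((z : 'rV[R]_n) ord0 i * dreg d z) = - \int[lam]_z ((z : 'rV[R]_n) ord0 i * dreg d z).
  rewrite -{1}(Rintegral_reflect md) -mulN1r -RintegralZl_total//.
  apply: eq_Rintegral => z _; rewrite mxE mulN1r mulNr; congr (- (_ * _)).
  by rewrite /dreg -!sqr_enorm enormN.
move: (Rintegral _ _ _) => a; lra.
Qed.

(* Integration by parts against the regularized potential; the constant [f 0] is subtracted for free
   since its coefficient is an odd integrable function. *)
Let regularized_by_parts (f g : 'rV[R]_n -> R) i (d : R) : test_function setT f -> test_function setT g ->
  (forall x, is_derive x (basisv i) f (g x)) -> 0 < d ->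
  \int[lam]_z (g z * reg d z) = p * \int[lam]_z ((z : 'rV[R]_n) ord0 i * dreg d z * (f z - f 0)).
Proof.
move=> tf tg dg d0.
have [Mf hMf] := test_function_bounded tf; have [Mg hMg] := test_function_bounded tg.
have [Mz hMz] := test_function_bounded (test_function_mul tf (smooth_coord i)).
have mf := test_function_measurable tf; have mg := test_function_measurable tg.
pose F (z : 'rV[R]_n) := f z * reg d z.
pose dF (z : 'rV[R]_n) := g z * reg d z + f z * (- p * (z ord0 i * dreg d z)).
have dFE z : is_derive z (basisv i) F (dF z).
  apply: is_derive_eq (is_deriveM (dg z) (is_derive_reg z i d0)) _.
  by rewrite /dF addrC [reg d z *: _]mulrC.
have [K [cK _ f0]] := tf.2.
have /compact_bounded[r [_ hr]] := cK.
have regd z := reg_bound z d0; have dregd z := dreg_bound z d0.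
set c1 := (d `^ (p / 2))^-1 in regd; set c2 := (d `^ (p / 2 + 1))^-1 in dregd.
have Mg0 : 0 <= Mg by exact: le_trans (normr_ge0 _) (hMg 0).
have mF : measurable_fun [set: T] F by apply: measurable_funM.
have FM x : `|F x| <= Mf * c1 by rewrite normrM ler_pM// ger0_norm.
have F0 x : r + 1 < `|x| -> F x = 0.
  move=> xr; rewrite /F f0 ?mul0r// => Kx.
  have := hr (r + 1); rewrite ltrDl => /(_ ltr01 x Kx); rewrite /= leNgt; exact/negP/negPn.
have dFM x : `|dF x| <= Mg * c1 + `|p| * (Mz * c2).
  apply: le_trans (ler_normD _ _) _; apply: lerD.
    by rewrite normrM ler_pM// ger0_norm.
  rewrite mulrCA normrM normrN ler_wpM2l// mulrA normrM ler_pM//.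
  by rewrite ger0_norm.
have e1 : `|basisv i : 'rV[R]_n| <= 1.
  by have := ler_norm_enorm (basisv i : 'rV[R]_n); rewrite enorm_basisv.
have [idF dF0] := Rintegral_derive0 mF FM F0 dFE dFM e1.
have io := integrable_odd i d0.
have mo : measurable_fun [set: T] (fun z : 'rV[R]_n => z ord0 i * dreg d z).
  by apply/measurable_EFinP; exact: measurable_int io.
have igr : lam.-integrable [set: T] (EFin \o (fun z => g z * reg d z)).
  have := @integrable_bounded_mul _ T R lam setT measurableT g (reg d) c1 (measurable_reg d).
  move=> /(_ _ (test_function_integrable tg)) h.
  by under eq_fun do rewrite mulrC; apply: h => z; rewrite ger0_norm.
have ifo : lam.-integrable [set: T] (EFin \o (fun z : 'rV[R]_n => f z * (z ord0 i * dreg d z))).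
  exact: integrable_bounded_mul mf hMf io.
have ifo0 : lam.-integrable [set: T] (EFin \o (fun z : 'rV[R]_n => f 0 * (z ord0 i * dreg d z))).
  by under [X in _.-integrable _ X]eq_fun do rewrite /= EFinM; exact: integrableZl.
have E : \int[lam]_z ((z : 'rV[R]_n) ord0 i * dreg d z * (f z - f 0)) = \int[lam]_z (f z * ((z : 'rV[R]_n) ord0 i * dreg d z)).
  transitivity (\int[lam]_z (f z * ((z : 'rV[R]_n) ord0 i * dreg d z) - f 0 * (z ord0 i * dreg d z))).
    by apply: eq_Rintegral => z _; rewrite -mulrBl mulrC.
  by rewrite (RintegralB measurableT ifo ifo0) RintegralZl_total// odd_integral0// mulr0 subr0.
have ipo : lam.-integrable [set: T] (EFin \o (fun z : 'rV[R]_n => - p * (f z * (z ord0 i * dreg d z)))).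
  by under [X in _.-integrable _ X]eq_fun do rewrite /= EFinM; exact: integrableZl.
have : \int[lam]_z (g z * reg d z + - p * (f z * ((z : 'rV[R]_n) ord0 i * dreg d z))) = 0.
  by rewrite -dF0; apply: eq_Rintegral => z _; rewrite /dF [in RHS]mulrCA.
rewrite (RintegralD measurableT igr ipo) RintegralZl_total; last exact: measurable_funM.
by rewrite E mulNr => /eqP; rewrite subr_eq0 => /eqP.
Qed.

(** The parameter d = 1/(k+1) tends to 0 in the regularized identity. The increment f(z) - f(0)
    supplies the factor min(1, |z|) that makes [fkernel] a dominating function uniformly in d. *)
Lemma riesz_kernel_by_parts (f g : 'rV[R]_n -> R) i : test_function setT f -> test_function setT g ->
  (forall x, is_derive x (basisv i) f (g x)) ->
  lam.-integrable [set: T] (EFin \o (fun z => g z * potential z)) /\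
  \int[lam]_z (riesz_kernel alpha i z * (f z - f 0)) = p^-1 * \int[lam]_z (g z * potential z).
Proof.
move=> tf tg dg; have p0 := potential_exponent_gt0.
have mf := test_function_measurable tf; have mg := test_function_measurable tg.
have [Mg hMg] := test_function_bounded tg.
have Mg0 : 0 <= Mg by exact: le_trans (normr_ge0 _) (hMg 0).
have [L [_ [_ [L0 _ _ _ hL]]]] := Lip_c_bounds n1 (Cinfty_c_Lip_c (test_function_Cinfty_c (basisv i) tf)).
have fL z : `|f z - f 0| <= L * Num.min 1 (enorm z).
  by have := hL i 0 z; rewrite add0r !mxE !eqxx !mulr1.
have iM : lam.-integrable [set: T] (EFin \o (fun z => Mg * fkernel alpha z + `|g z|)).
  have ik : lam.-integrable [set: T] (EFin \o (fun z => Mg * fkernel alpha z)).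
    under [X in _.-integrable _ X]eq_fun do rewrite /= EFinM.
    by apply: integrableZl => //; exact: integrable_fkernel.
  exact: (integrableD measurableT ik (integrable_norm (test_function_integrable tg))).
have gpot z : `|g z * potential z| <= Mg * fkernel alpha z + `|g z|.
  rewrite normrM (ger0_norm (potential_ge0 z)).
  apply: le_trans (ler_wpM2l (normr_ge0 _) (potential_le z)) _.
  by rewrite mulrDr mulr1 lerD2r ler_wpM2r// fkernel_ge0.
have mn0 : measurable_fun [set: T] (fun z : T => \1_(~` [set (0 : 'rV[R]_n)]) z : R).
  apply: measurable_indic; apply: measurableC.
  by apply: measurable_closed_borelRn; apply: compact_closed; [exact: norm_hausdorff|exact: compact_set1].
have n0E (z : 'rV[R]_n) : z != 0 -> \1_(~` [set (0 : 'rV[R]_n)]) z = 1 :> R.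
  by move=> z0; rewrite indicE mem_set//= => h; move/eqP: z0.
have n00 : \1_(~` [set (0 : 'rV[R]_n)]) (0 : 'rV[R]_n) = 0 :> R.
  by rewrite indicE memNset//= => h; exact: h.
have mpot := measurable_potential.
have aeE (u v : 'rV[R]_n -> R) : measurable_fun [set: T] u -> measurable_fun [set: T] v ->
    (forall z, z != 0 -> u z = v z) -> \int[lam]_z u z = \int[lam]_z v z.
  move=> mu mv uv; congr fine; apply: ae_eq_integral => //; try exact/measurable_EFinP.
  by apply: (ae_imply _ ae_neq0) => z /uv -> _.
split.
  apply: le_integrable iM => //; first by apply/measurable_EFinP; exact: measurable_funM.
  by move=> z _ /=; rewrite lee_fin [leRHS]ger0_norm ?gpot// addr_ge0// mulr_ge0 ?fkernel_ge0.
(* At the origin the regularizations blow up whereas [potential 0] is 0 by convention. Removing this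
   null point gives convergence and domination everywhere. *)
pose u k z := \1_(~` [set (0 : 'rV[R]_n)]) z * (g z * reg k.+1%:R^-1 z).
have mu k : measurable_fun [set: T] (u k) by apply: measurable_funM => //; exact: measurable_funM.
have cu z : u k z @[k --> \oo] --> g z * potential z.
  have [->|z0] := eqVneq z 0.
    rewrite /u n00 /potential enorm0 powR0 ?gt_eqF// invr0 mulr0.
    by under eq_fun do rewrite mul0r; exact: cvg_cst.
  rewrite /u n0E//; under eq_fun do rewrite mul1r.
  by apply: cvgM; [exact: cvg_cst|exact: cvg_reg].
have uM k z : `|u k z| <= Mg * fkernel alpha z + `|g z|.
  have [->|z0] := eqVneq z 0.
    by rewrite /u n00 mul0r normr0 addr_ge0// mulr_ge0// fkernel_ge0.
  rewrite /u n0E// mul1r; apply: le_trans (gpot z); rewrite !normrM ler_wpM2l//.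
  by rewrite (ger0_norm (potential_ge0 z)) ger0_norm// reg_le.
have [_ c1] := @Rintegral_dominated_cvg _ T R lam u (fun z => g z * potential z) _ mu cu iM uM.
have iL : lam.-integrable [set: T] (EFin \o (fun z => L * fkernel alpha z)).
  under [X in _.-integrable _ X]eq_fun do rewrite /= EFinM.
  by apply: integrableZl => //; exact: integrable_fkernel.
pose v k (z : 'rV[R]_n) := z ord0 i * dreg k.+1%:R^-1 z * (f z - f 0).
have mv k : measurable_fun [set: T] (v k).
  apply: measurable_funM; last exact: measurable_funB.
  by apply: measurable_funM => //; exact: measurable_coord.
have cv z : v k z @[k --> \oo] --> riesz_kernel alpha i z * (f z - f 0).
  by apply: cvgM; [exact: cvg_dreg|exact: cvg_cst].
have vM k z : `|v k z| <= L * fkernel alpha z.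
  by rewrite /v normrM fkernelE mulrA mulrC ler_pM//; exact: dreg_le.
have [_ c2] := @Rintegral_dominated_cvg _ T R lam v (fun z => riesz_kernel alpha i z * (f z - f 0)) _ mv cv iL vM.
have uv k : \int[lam]_z u k z = p * \int[lam]_z v k z.
  rewrite -(@regularized_by_parts f g)//.
  apply: aeE; [by apply: measurable_funM => //; exact: measurable_funM|exact: measurable_funM|].
  by move=> z z0; rewrite /u n0E// mul1r.
have c3 : p * \int[lam]_z v k z @[k --> \oo] --> p * \int[lam]_z (riesz_kernel alpha i z * (f z - f 0)).
  by apply: cvgM => //; exact: cvg_cst.
suff -> : \int[lam]_z (g z * potential z) = p * \int[lam]_z (riesz_kernel alpha i z * (f z - f 0)).
  by rewrite mulKf// gt_eqF.
have E : (fun k => \int[lam]_z u k z) = (fun k => p * \int[lam]_z v k z) by apply/funext.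
rewrite E in c1; exact: cvg_unique c1 c3.
Qed.

End riesz_potential.

Section finite_measure_sum.
Context d (T : measurableType d) (R : realType).
Variables m1 m2 : {finite_measure set T -> \bar R}.

Definition finite_add : set T -> \bar R := measure_add m1 m2.

HB.instance Definition _ := Measure.on finite_add.

Let finite_add_fin : fin_num_fun finite_add.
Proof.
move=> A mA; rewrite /finite_add [X in X \is a fin_num](_ : _ = (m1 A + m2 A)%E).
  by rewrite fin_numD !fin_num_measure.
exact: measure_addE.
Qed.

HB.instance Definition _ := @Measure_isFinite.Build _ _ _ finite_add finite_add_fin.

End finite_measure_sum.

(** * The total variation as a finite measure *)

Section vmeasure_representation.
Context {R : realType} {n : nat}.
Local Notation T := (borelRn R n).

Lemma finite_dominating (I : eqType) (s : seq I) (m : I -> {finite_measure set T -> \bar R}) :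
  exists mu : {finite_measure set T -> \bar R}, forall A, measurable A -> mu A = 0%E ->
    forall i, i \in s -> m i A = 0%E.
Proof.
elim: s => [|i s [mu hmu]].
  by exists (@dirac _ T (0 : 'rV[R]_n) R : {finite_measure set T -> \bar R}).
exists (finite_add (m i) mu) => A mA.
have E : finite_add (m i) mu A = (m i A + mu A)%E by exact: measure_addE.
move=> /eqP; rewrite [X in X == _]E padde_eq0// => /andP[/eqP h1 /eqP h2] j.
by rewrite inE => /predU1P[->//|]; exact: hmu.
Qed.

(** A finite measure dominating all components gives Radon-Nikodym densities, and the total
    variation then has density |g|. Fubini against |D chi_E| becomes possible. *)
Lemma vmeasure_total_variation (D : vmeasure R n) :
  exists tau : {finite_measure set T -> \bar R}, forall A : set T, measurable A ->
    vtotal_variation D A = tau A.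
Proof.
have /choice[m1 /choice[m2 mE]] : forall i, exists m1 m2 : {finite_measure set T -> \bar R},
    forall A, measurable A -> D i A = (m1 A - m2 A)%E by move=> i; exact: charge_decomposition.
have [mu1 h1] := finite_dominating (enum 'I_n) m1.
have [mu2 h2] := finite_dominating (enum 'I_n) m2.
pose mu : {finite_measure set T -> \bar R} := finite_add mu1 mu2.
have muE A : mu A = (mu1 A + mu2 A)%E by exact: measure_addE.
have dom i : D i `<< mu.
  move=> A nA B mB BA; have := nA B mB BA; rewrite [X in X = _ -> _]muE => /eqP.
  rewrite padde_eq0// => /andP[/eqP B1 /eqP B2].
  by rewrite mE// (h1 B mB B1) ?mem_enum// (h2 B mB B2) ?mem_enum// sube0.
pose g x : 'rV[R]_n := \row_i fine (Radon_Nikodym (D i) mu x).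
have gE i : (fun x => (g x ord0 i)%:E) = Radon_Nikodym (D i) mu.
  by apply/funext => x; rewrite mxE fineK// Radon_Nikodym_fin_num.
have ig i : mu.-integrable [set: T] (fun x => (g x ord0 i)%:E).
  by rewrite gE; exact: Radon_Nikodym_integrable.
have DE i (A : set T) : measurable A -> D i A = (\int[mu]_(x in A) (g x ord0 i)%:E)%E.
  by move=> mA; rewrite (Radon_Nikodym_integral (dom i) mA) -gE.
exists (density (integrable_enorm ig) (fun x => enorm_ge0 (g x))) => A mA.
exact: (total_variation_density ig DE).
Qed.

End vmeasure_representation.

(** * Fubini between a measure and the Riesz potential *)

Section potential_products.
Context {R : realType} {n : nat}.
Local Notation T := (borelRn R n).
Local Notation lam := (lebesgue_borelRn R n).
Variable alpha : R.
Hypotheses (n1 : (1 <= n)%N) (a01 : 0 < alpha < 1).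
Variables (m : {sigma_finite_measure set T -> \bar R}) (b u : 'rV[R]_n -> R) (M : R) (A : set T).
Hypotheses (ib : m.-integrable [set: T] (EFin \o b)) (mu : measurable_fun [set: T] u).
Hypotheses (uM : forall x, `|u x| <= M) (mA : measurable A) (Afin : (lam A < +oo)%E).
Hypothesis uA : forall x, ~ A x -> u x = 0.

Let mb : measurable_fun [set: T] b.
Proof. by apply/measurable_EFinP; exact: measurable_int ib. Qed.

Let M0 : 0 <= M. Proof. exact: le_trans (normr_ge0 _) (uM 0). Qed.

Let mI : measurable_fun [set: T] (\1_A : T -> R).
Proof. exact: measurable_indic. Qed.

Let mpair (y : T) : measurable_fun [set: T] (fun z : T => (y, z)).
Proof. exact: measurable_fun_pair. Qed.

Let iI : lam.-integrable [set: T] (EFin \o (\1_A : T -> R)).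
Proof. exact: integrable_indic_lty. Qed.

Let ifk : lam.-integrable [set: T] (EFin \o fkernel alpha).
Proof. exact: integrable_fkernel. Qed.

Let mprod : measurable_fun [set: T * T]
  (fun q : T * T => b q.1 * (u ((q.1 : 'rV[R]_n) + q.2) * potential alpha q.2)).
Proof.
apply: measurable_funM; first exact: measurableT_comp mb measurable_fst.
apply: measurable_funM; first exact: measurable_translate_pair.
apply: (measurableT_comp (@measurable_potential R n alpha)); exact: measurable_snd.
Qed.

Lemma integrable_potential_translate : (m \x lam)%E.-integrable [set: T * T]
  (EFin \o (fun q : T * T => b q.1 * (u ((q.1 : 'rV[R]_n) + q.2) * potential alpha q.2))).
Proof.
(* A bound for the potential of |u| uniform in the base point: the singular part is [fkernel], and
   the constant part 1 is cut off by the support [A] of [u]. *)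
pose C := M * (\int[lam]_z fkernel alpha z + \int[lam]_x \1_A x).
apply/integrable12ltyP; first by apply/measurable_EFinP; exact: mprod.
have inner y : (\int[lam]_z `|(b y * (u (y + z) * potential alpha z))%:E| <= (`|b y| * C)%:E)%E.
  have iJ : lam.-integrable [set: T] (EFin \o (fun z => \1_A (z + y) : R)) := integrable_translate y iI.
  have idom : lam.-integrable [set: T] (EFin \o (fun z => `|b y| * M * (fkernel alpha z + \1_A (z + y)))).
    under [X in _.-integrable _ X]eq_fun do rewrite /= EFinM.
    by apply: integrableZl => //; exact: (integrableD measurableT ifk iJ).
  have -> : (`|b y| * C)%:E = (\int[lam]_z (`|b y| * M * (fkernel alpha z + \1_A (z + y)))%:E)%E.
    rewrite -EFin_Rintegral// RintegralZl//; last exact: (integrableD measurableT ifk iJ).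
    by rewrite (RintegralD measurableT ifk iJ) (Rintegral_translate y mI) mulrA.
  apply: ge0_le_integral => //.
  - apply/measurable_EFinP; apply: measurableT_comp => //.
    exact: (measurableT_comp mprod (mpair y)).
  - exact: measurable_int idom.
  move=> z _; rewrite lee_fin !normrM -mulrA ler_wpM2l//.
  rewrite (ger0_norm (potential_ge0 _ _)) addrC.
  have [xA|nA] := pselect (A (z + y)); last first.
    by rewrite uA// normr0 mul0r mulr_ge0// addr_ge0 ?fkernel_ge0// indicE.
  rewrite indicE mem_set//; apply: ler_pM; rewrite ?potential_ge0//.
  exact: potential_le.
have ibC : m.-integrable [set: T] (EFin \o (fun y => C * `|b y|)).
  under [X in _.-integrable _ X]eq_fun do rewrite /= EFinM.
  by apply: integrableZl => //; exact: (integrable_norm ib).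
have := integrable_lty measurableT ibC; apply: le_lt_trans.
apply: ge0_le_integral => //.
- by move=> y _; exact: integral_ge0.
- apply: (@measurable_fun_fubini_tonelli_F _ _ T T R lam (fun q : T * T => `|(b q.1 * (u ((q.1 : 'rV[R]_n) + q.2) * potential alpha q.2))%:E|%E)) => //.
  by apply/measurable_EFinP; exact: measurableT_comp.
- exact: measurable_int ibC.
- by move=> y _; rewrite /= mulrC; exact: inner.
Qed.

Let mprod2 : measurable_fun [set: T * T]
  (fun q : T * T => b q.1 * (u q.2 * potential alpha ((q.2 : 'rV[R]_n) - q.1))).
Proof.
apply: measurable_funM; first exact: measurableT_comp mb measurable_fst.
apply: measurable_funM; first exact: measurableT_comp mu measurable_snd.
apply: (measurableT_comp (@measurable_potential R n alpha)); apply: measurable_subv.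
  exact: measurable_snd.
exact: measurable_fst.
Qed.

Lemma integrable_potential_product : (m \x lam)%E.-integrable [set: T * T]
  (EFin \o (fun q : T * T => b q.1 * (u q.2 * potential alpha ((q.2 : 'rV[R]_n) - q.1)))).
Proof.
apply/integrable12ltyP; first by apply/measurable_EFinP; exact: mprod2.
have /integrable12ltyP h : measurable_fun [set: T * T] (EFin \o (fun q : T * T => b q.1 * (u ((q.1 : 'rV[R]_n) + q.2) * potential alpha q.2))).
  by apply/measurable_EFinP; exact: mprod.
have := (h m lam).1 integrable_potential_translate.
apply: le_lt_trans; rewrite le_eqVlt; apply/orP; left; apply/eqP.
apply: eq_integral => y _ /=.
have mf : measurable_fun [set: T] (fun x => `|b y * (u x * potential alpha (x - y))|%:E).
  apply/measurable_EFinP; apply: measurableT_comp => //.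
  exact: (measurableT_comp mprod2 (mpair y)).
rewrite -[LHS](integral_translate mf y); apply: eq_integral => z _.
by rewrite addrK (addrC z).
Qed.

Lemma potential_exchange :
  \int[lam]_z (\int[m]_y (b y * (u (y + z) * potential alpha z))) =
  \int[lam]_x (u x * \int[m]_y (b y * potential alpha (x - y))).
Proof.
rewrite -(Rfubini integrable_potential_translate)/=.
transitivity (\int[lam]_x \int[m]_y (b y * (u x * potential alpha (x - y)))).
  rewrite -(Rfubini integrable_potential_product)/=; apply: eq_Rintegral => y _.
  have mf : measurable_fun [set: T] (fun x => b y * (u x * potential alpha (x - y))).
    exact: (measurableT_comp mprod2 (mpair y)).
  by rewrite -[RHS](Rintegral_translate y mf); apply: eq_Rintegral => z _; rewrite addrK (addrC z).
apply: eq_Rintegral => x _; rewrite -RintegralZl_total.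
  by apply: eq_Rintegral => y _; rewrite mulrCA.
apply: measurable_funM => //; apply: (measurableT_comp (@measurable_potential R n alpha)).
exact: measurable_subv.
Qed.

End potential_products.

(** * Identification of the fractional gradient with the potential *)

Section perimeter_representation.
Context {R : realType} {n : nat}.
Local Notation T := (borelRn R n).
Local Notation lam := (lebesgue_borelRn R n).
Local Notation Leb := (lebesgueRn R n).
Variables (alpha : R) (E F : set 'rV[R]_n).
Hypotheses (n1 : (1 <= n)%N) (a01 : 0 < alpha < 1).
Hypotheses (mF : measurable (F : set T)) (EF : {ae lam, forall x, E x <-> F x}).
Hypotheses (Ffin : (lam F < +oo)%E) (Pfin : (perimeter E < +oo)%E).
Variables (DE : vmeasure R n) (tau : {finite_measure set T -> \bar R}) (b : 'rV[R]_n -> R) (i : 'I_n).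
Hypothesis hDE : variation_measure E DE.
Hypothesis ib : tau.-integrable [set: T] (EFin \o b).
Hypothesis bE : forall A : set T, measurable A -> DE i A = (\int[tau]_(x in A) (b x)%:E)%E.
Local Notation chi := (\1_F : 'rV[R]_n -> R).
Local Notation p := (n%:R + alpha - 1).

Let ichi : lam.-integrable [set: T] (EFin \o chi).
Proof. exact: integrable_indic_lty. Qed.

Let mchi : measurable_fun [set: T] chi.
Proof. exact: (@measurable_indic _ T). Qed.

Let mb : measurable_fun [set: T] b.
Proof. by apply/measurable_EFinP; exact: measurable_int ib. Qed.

Let test_integral psi g : test_function setT psi -> test_function setT g ->
  (forall x, is_derive x (basisv i) psi (g x)) ->
  \int[lam]_x (chi x * g x) = - \int[tau]_x (b x * psi x).
Proof.
move=> tpsi tg dg; have mg := test_function_measurable tg.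
have [M hM] := test_function_bounded tpsi; have mpsi := test_function_measurable tpsi.
have := hDE (test_function_Cinfty_c (basisv i) tpsi).
under eq_Rintegral => x _ do rewrite (divergence_scale_basis x tpsi dg).
rewrite (Rintegral_lebesgueRn_setE EF); last exact: measurable_funM.
move=> ->; congr (- _).
rewrite vmeasure_integral_scale_basis (charge_integral_density ib bE mpsi hM).
by apply: eq_Rintegral => x _; rewrite mulrC.
Qed.

Let test_support psi : test_function setT psi -> exists M (A : set T),
  [/\ measurable A, (lam A < +oo)%E, forall x, `|psi x| <= M & forall x, ~ A x -> psi x = 0].
Proof.
move=> tpsi; have [M hM] := test_function_bounded tpsi.
have [L [_ [A [_ [mA Aoo _] [_ A0] _ _]]]] := Lip_c_bounds n1 (Cinfty_c_Lip_c (test_function_Cinfty_c (basisv i) tpsi)).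
exists M, A; split => // x /A0 /rowP /(_ i).
by rewrite !mxE !eqxx mulr1.
Qed.

Definition normal_potential (x : 'rV[R]_n) : R := \int[tau]_y (b y * potential alpha (x - y)).

(** The fractional divergence of psi e_i is mu/p times the convolution of d_i psi with the
    potential. At fixed z the distributional gradient of chi_E absorbs the derivative, and Fubini
    moves the potential onto |D chi_E|; the two minus signs cancel. *)
Let test_identity psi : test_function setT psi ->
  \int[lam]_x (psi x * nonlocal_grad alpha F i x) =
  mu_frac n alpha / p * \int[lam]_x (psi x * normal_potential x).
Proof.
move=> tpsi; have [g tg dg] := test_function_derive i tpsi.
have Wfin := finite_perimeter_frac_perimeter n1 a01 mF EF Ffin Pfin.
have cpsi := test_function_Cinfty_c (basisv i) tpsi.
have Lpsi := Cinfty_c_Lip_c cpsi.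
have := frac_div_by_parts n1 a01 openT mF EF Wfin Lpsi.
have -> : \int[lam]_x dotv (psi x *: basisv i) (frac_grad_density alpha F setT x) =
    \int[lam]_x (psi x * nonlocal_grad alpha F i x).
  by apply: eq_Rintegral => x _; rewrite dotv_scale_basis mxE indicE in_setT mul1r.
move=> /eqP; rewrite eq_sym eqr_oppLR => /eqP ->.
have tsh x := test_function_translate x tpsi; have tgsh x := test_function_translate x tg.
have dsh x y : is_derive y (basisv i) (fun z => psi (z + x)) (g (y + x)) by exact: is_derive_translate.
have divE x : frac_div alpha (fun x => psi x *: basisv i) x =
    mu_frac n alpha / p * \int[lam]_z (g (x + z) * potential alpha z).
  rewrite (frac_divE n1 a01 Lpsi) -mulrA; congr (_ * _).
  rewrite (bigD1 i)//= big1 ?addr0; last first.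
    move=> j ji; under eq_Rintegral do rewrite !mxE (negbTE ji) andbF !mulr0 subrr mulr0.
    by rewrite Rintegral_cst// mul0r.
  have [_] := riesz_kernel_by_parts n1 a01 (tsh x) (tgsh x) (dsh x).
  rewrite add0r => h; transitivity (\int[lam]_z (riesz_kernel alpha i z * (psi (z + x) - psi x))).
    by apply: eq_Rintegral => z _; rewrite !mxE !eqxx !mulr1 (addrC x).
  by rewrite h; congr (_ * _); apply: eq_Rintegral => z _; rewrite (addrC x).
under eq_Rintegral do rewrite divE.
have [Mg [Ag [mAg Agfin gM gA]]] := test_support tg.
have [Mp [Ap [mAp Apfin pM pA]]] := test_support tpsi.
have mg := test_function_measurable tg; have mpsi := test_function_measurable tpsi.
have k1 := integrable_potential_translate n1 a01 ichi mg gM mAg Agfin gA.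
have mgp x : measurable_fun [set: T] (fun z => g (x + z) * potential alpha z).
  apply: measurable_funM; last exact: measurable_potential.
  by apply: (measurableT_comp mg); exact: measurable_addv.
have mwg : measurable_fun [set: T] (fun x => chi x * \int[lam]_z (g (x + z) * potential alpha z)).
  have := measurable_int _ (integrable_Rfubini1 k1) => /measurable_EFinP.
  by apply: eq_measurable_fun => x _ /=; rewrite RintegralZl_total.
have mcw : measurable_fun [set: T] (fun x => chi x * (mu_frac n alpha / p * \int[lam]_z (g (x + z) * potential alpha z))).
  by under eq_fun do rewrite mulrCA; exact: measurable_funM.
rewrite (Rintegral_lebesgueRn_setE EF mcw).
transitivity (- (mu_frac n alpha / p * \int[lam]_x (chi x * \int[lam]_z (g (x + z) * potential alpha z)))).
  by rewrite -RintegralZl_total//; congr (- _); apply: eq_Rintegral => x _; rewrite mulrCA.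
rewrite -mulrN; congr (_ * _).
rewrite -(potential_exchange n1 a01 ib mpsi pM mAp Apfin pA).
transitivity (- \int[lam]_z \int[lam]_x (chi x * (g (x + z) * potential alpha z))).
  rewrite -(Rfubini k1)/=; congr (- _); apply: eq_Rintegral => x _.
  by rewrite RintegralZl_total.
have k2 := integrable_potential_translate n1 a01 ib mpsi pM mAp Apfin pA.
have m2 : measurable_fun [set: T] (fun z => \int[tau]_y (b y * (psi (y + z) * potential alpha z))).
  by have := measurable_int _ (integrable_Rfubini2 k2) => /measurable_EFinP.
have m1 : measurable_fun [set: T] (fun z => \int[lam]_x (chi x * (g (x + z) * potential alpha z))).
  by have := measurable_int _ (integrable_Rfubini2 k1) => /measurable_EFinP.
rewrite -mulN1r -RintegralZl_total//; apply: eq_Rintegral => z _.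
have mchig : measurable_fun [set: T] (fun x => chi x * g (x + z)).
  by apply: measurable_funM => //; exact: measurable_translate.
have mbpsi : measurable_fun [set: T] (fun x => b x * psi (x + z)).
  by apply: measurable_funM => //; exact: measurable_translate.
transitivity (-1 * (potential alpha z * \int[lam]_x (chi x * g (x + z)))).
  congr (_ * _); rewrite -RintegralZl_total//; apply: eq_Rintegral => x _.
  by rewrite [RHS]mulrC mulrA.
rewrite (test_integral (tsh z) (tgsh z) (dsh z)) mulrN mulN1r opprK -RintegralZl_total//.
by apply: eq_Rintegral => x _; rewrite [LHS]mulrC mulrA.
Qed.

Let ball_support (r : R) : 0 < r -> let B : set 'rV[R]_n := ball 0 r in
  [/\ measurable (B : set T), (lam B < +oo)%E & open B].
Proof.
move=> r0 /=; split; last exact: ball_open.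
  by apply: measurable_open_borelRn; exact: ball_open.
by rewrite [X in (X < _)%E]lebesgue_ball// ltry.
Qed.

Let ball_product_integrable (r : R) : 0 < r -> (tau \x lam)%E.-integrable [set: T * T]
  (EFin \o (fun q : T * T => b q.1 * (\1_(ball (0 : 'rV[R]_n) r) q.2 * potential alpha ((q.2 : 'rV[R]_n) - q.1)))).
Proof.
move=> r0; have [mB Bfin oB] := ball_support r0.
apply: (@integrable_potential_product R n alpha n1 a01 tau b \1_(ball (0 : 'rV[R]_n) r) 1 _ ib _ _ mB Bfin) => //.
- by move=> x; rewrite indicE; case: (_ \in _); rewrite ?normr1 ?normr0.
- by move=> x nB; rewrite indicE memNset.
Qed.

Lemma ae_integrable_normal_potential : {ae lam, forall x,
  tau.-integrable [set: T] (fun y => (b y * potential alpha (x - y))%:E)}.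
Proof.
have h : {ae lam, forall x, forall k : nat, tau.-integrable [set: T]
    (fun y => (b y * (\1_(ball (0 : 'rV[R]_n) k.+1%:R) x * potential alpha (x - y)))%:E)}.
  apply/ae_foralln => k; exact: (ae_integrable2 (ball_product_integrable (ltr0Sn _ k))).
apply: (ae_imply _ h) => x hx.
have xk : ball (0 : 'rV[R]_n) (Num.truncn `|x|).+1%:R x.
  by rewrite -ball_normE/= sub0r normrN; exact: truncnS_gt.
have I1 : \1_(ball (0 : 'rV[R]_n) (Num.truncn `|x|).+1%:R) x = 1 :> R by rewrite indicE mem_set.
by have := hx (Num.truncn `|x|); apply: eq_integrable => // y _; rewrite I1 mul1r.
Qed.

(** The difference [f] of the two sides vanishes against all test functions, so L1 duality gives it
    norm 0 on each cube. Localization is imposed by [normal_potential], for which only local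
    integrability has been established. *)
Lemma ae_nonlocal_grad_potential :
  {ae lam, forall x, nonlocal_grad alpha F i x = mu_frac n alpha / p * normal_potential x}.
Proof.
pose f x := nonlocal_grad alpha F i x - mu_frac n alpha / p * normal_potential x.
have Wfin := finite_perimeter_frac_perimeter n1 a01 mF EF Ffin Pfin.
have iG : lam.-integrable [set: T] (EFin \o nonlocal_grad alpha F i).
  have := integrable_frac_grad_density openT mF EF Wfin i.
  by apply: eq_integrable => // x _ /=; rewrite mxE indicE in_setT mul1r.
have h : {ae lam, forall x, forall k : nat, \1_(ball (0 : 'rV[R]_n) k.+1%:R) x * f x = 0}.
  apply/ae_foralln => k; pose B : set 'rV[R]_n := ball 0 k.+1%:R.
  have [mB Bfin oB] := ball_support (ltr0Sn R k).
  have mIB : measurable_fun [set: T] (\1_B : 'rV[R]_n -> R) by exact: (@measurable_indic _ T).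
  have IB x : `|\1_B x : R| <= 1 by rewrite indicE; case: (_ \in _); rewrite ?normr1 ?normr0.
  have iH : lam.-integrable [set: T] (EFin \o (fun x => \1_B x * normal_potential x)).
    have := integrable_Rfubini2 (ball_product_integrable (ltr0Sn R k)).
    apply: eq_integrable => // x _ /=; congr EFin; rewrite -RintegralZl_total.
      by apply: eq_Rintegral => y _; rewrite mulrCA.
    apply: measurable_funM => //; apply: (measurableT_comp (@measurable_potential R n alpha)).
    exact: measurable_subv.
  have iBG : lam.-integrable [set: T] (EFin \o (fun x => \1_B x * nonlocal_grad alpha F i x)).
    exact: integrable_bounded_mul mIB IB iG.
  have icH : lam.-integrable [set: T] (EFin \o (fun x => mu_frac n alpha / p * (\1_B x * normal_potential x))).
    by under [X in _.-integrable _ X]eq_fun do rewrite /= EFinM; exact: integrableZl.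
  have iBf : lam.-integrable [set: T] (EFin \o (fun x => \1_B x * f x)).
    have := integrableB measurableT iBG icH; apply: eq_integrable => // x _ /=.
    by rewrite -EFinB; congr EFin; rewrite /f mulrBr; congr (_ - _); rewrite mulrCA.
  have : \int[lam]_x `|\1_B x * f x| <= 0.
    apply: (Rintegral_norm_le_dual oB iBf).
      by move=> x nB; rewrite indicE memNset// mul0r.
    move=> psi tpsi psi1.
    have tpsiT : test_function setT psi.
      by case: tpsi => s [K [cK _ K0]]; split => //; exists K.
    have psiB x : psi x * \1_B x = psi x.
      have [Bx|nB] := pselect (B x); first by rewrite indicE mem_set// mulr1.
      case: tpsi => _ [K [_ KB K0]]; rewrite K0 ?mul0r// => /KB.
      by [].
    have mpsi := test_function_measurable tpsi.
    have ip (u : 'rV[R]_n -> R) : lam.-integrable [set: T] (EFin \o (fun x => \1_B x * u x)) ->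
        lam.-integrable [set: T] (EFin \o (fun x => psi x * u x)).
      move=> iu; have := integrable_bounded_mul measurableT mpsi psi1 iu.
      by apply: eq_integrable => // x _ /=; rewrite mulrA psiB.
    have ipG := ip _ iBG; have ipH := ip _ iH.
    have ipcH : lam.-integrable [set: T] (EFin \o (fun x => mu_frac n alpha / p * (psi x * normal_potential x))).
      by under [X in _.-integrable _ X]eq_fun do rewrite /= EFinM; exact: integrableZl.
    have -> : \int[lam]_x (psi x * (\1_B x * f x)) =
       \int[lam]_x (psi x * nonlocal_grad alpha F i x - mu_frac n alpha / p * (psi x * normal_potential x)).
      by apply: eq_Rintegral => x _; rewrite [LHS]mulrA psiB /f mulrBr; congr (_ - _); rewrite mulrCA.
    rewrite (RintegralB measurableT ipG ipcH) (RintegralZl _ measurableT ipH).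
    by rewrite (test_identity tpsiT) subrr.
  move=> le0; have mBf := measurable_int _ iBf.
  have /(ae_eq_integral_abs lam measurableT mBf).1 : (\int[lam]_x `|(EFin \o (fun x => (\1_B x * f x)%R)) x| = 0)%E.
    apply/eqP; rewrite eq_le integral_ge0 ?andbT//.
    have := integrable_norm iBf => iN.
    by rewrite -[X in (X <= _)%E](EFin_Rintegral measurableT iN) lee_fin.
  by apply: ae_imply => x /(_ I) /= [].
apply: (ae_imply _ h) => x hx.
have xk : ball (0 : 'rV[R]_n) (Num.truncn `|x|).+1%:R x.
  by rewrite -ball_normE/= sub0r normrN; exact: truncnS_gt.
have := hx (Num.truncn `|x|); rewrite indicE mem_set// mul1r => /eqP.
by rewrite subr_eq0 => /eqP.
Qed.

End perimeter_representation.

Lemma finite_perimeter_gradient {R : realType} {n : nat} (E : set 'rV[R]_n) : (1 <= n)%N ->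
  measurable (E : set (lebRn R n)) ->
  (lebesgueRn R n E < +oo)%E -> (perimeter E < +oo)%E ->
  forall alpha : R, 0 < alpha < 1 ->
    W_alpha_1 alpha \1_E /\
    (forall (DE : vmeasure R n) (nuE : 'rV[R]_n -> 'rV[R]_n),
       variation_measure E DE -> polar_density DE nuE ->
       {ae lebesgueRn R n, forall x,
          frac_grad_cvg alpha E x /\
          forall i : 'I_n,
            (vtotal_variation DE).-integrable setT
              (fun y : borelRn R n =>
                 (nuE y ord0 i / enorm (y - x) `^ (n%:R + alpha - 1))%:E) /\
            (frac_grad alpha E x ord0 i)%:E =
            ((mu_frac n alpha / (n%:R + alpha - 1))%:E *
             \int[vtotal_variation DE]_y
               (nuE y ord0 i / enorm (y - x) `^ (n%:R + alpha - 1))%:E)%E}).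
Proof.
move=> n1 mE Efin Pfin alpha a01.
have [F mF EF] := @completed_ae_borel _ (borelRn R n) R (lebesgue_borelRn R n) E mE.
have Ffin : (lebesgue_borelRn R n F < +oo)%E.
  apply: le_lt_trans Efin; rewrite le_eqVlt; apply/orP; left; apply/eqP.
  have := @ae_integral_lebesgueRn R n (EFin \o \1_E) (EFin \o \1_F) _ _.
  rewrite integral_indic// setIT.
  rewrite [X in _ -> _ -> _ = X]integral_indic// setIT => -> //.
    by apply/measurable_EFinP; exact: (@measurable_indic _ (borelRn R n)).
  apply: (ae_imply _ EF) => x Ex /=; rewrite !indicE; congr ((_ : bool)%:R%:E).
  by apply: asbool_equiv_eq.
split; first exact: (finite_perimeter_W_alpha_1 n1 a01 mF EF Ffin Pfin).
move=> DE nuE hDE pol; apply/ae_lebesgueRn.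
have Wfin := finite_perimeter_frac_perimeter n1 a01 mF EF Ffin Pfin.
(* All integrals against [vtotal_variation DE] are read as integrals against the measure [tau], for
   which the polar density provides the components of [DE]. *)
have [tau tauE] := vmeasure_total_variation DE.
have ib i : tau.-integrable setT (fun x : borelRn R n => (nuE x ord0 i)%:E).
  by rewrite -(eq_setfun_integrable _ _ tauE); exact: (pol i).1.
have bE i (A : set (borelRn R n)) : measurable A -> DE i A = (\int[tau]_(x in A) (nuE x ord0 i)%:E)%E.
  by move=> mA; rewrite (pol i).2//; exact: eq_setfun_integral.
have h1 : {ae lebesgue_borelRn R n, forall x, forall i,
    tau.-integrable setT (fun y : borelRn R n => (nuE y ord0 i * potential alpha (x - y))%:E)}.
  apply: filter_forall => i; exact: (ae_integrable_normal_potential n1 a01 (ib i)).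
have h2 : {ae lebesgue_borelRn R n, forall x, forall i,
    nonlocal_grad alpha F i x = mu_frac n alpha / (n%:R + alpha - 1) *
      normal_potential alpha tau (fun y => nuE y ord0 i) x}.
  apply: filter_forall => i.
  exact: (ae_nonlocal_grad_potential n1 a01 mF EF Ffin Pfin hDE (ib i) (bE i)).
have h3 := ae_frac_grad_cvg openT mF EF Wfin.
apply: (ae_imply2 _ (ae_imply2 (fun x a b => conj a b) h1 h2) (ae_imply2 (fun x a b => conj a b) EF h3)).
move=> x [i1 e1] [Ex cx]; split; first exact: cx.
move=> i.
have potE (y : 'rV[R]_n) : nuE y ord0 i / enorm (y - x) `^ (n%:R + alpha - 1) = nuE y ord0 i * potential alpha (x - y).
  by rewrite /potential enormB.
under eq_fun do rewrite potE.
rewrite (eq_setfun_integrable _ _ tauE) (eq_setfun_integral _ _ tauE).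
split; first exact: i1.
rewrite (frac_gradE alpha mF EF Ex) e1 EFinM; congr (_ * _)%E.
exact: (@EFin_Rintegral _ (borelRn R n) R tau setT measurableT _ (i1 i)).
Qed.

Theorem proposition4p8 (R : realType) (n : nat) (n_ge1 : (1 <= n)%N) :
  (forall (alpha : R) (Omega E : set 'rV[R]_n),
     0 < alpha < 1 -> open Omega ->
     measurable (E : set (lebRn R n)) ->
     (frac_perimeter alpha E Omega < +oo)%E ->
     [/\ (caccioppoli_perimeter alpha E Omega < +oo)%E,
         (caccioppoli_perimeter alpha E Omega <=
            (mu_frac n alpha)%:E * frac_perimeter alpha E Omega)%E,
         {ae lebesgueRn R n, forall x, Omega x -> frac_grad_cvg alpha E x} /\
         (forall i : 'I_n, (lebesgueRn R n).-integrable Omega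
            (fun x : lebRn R n => (frac_grad alpha E x ord0 i)%:E)),
         (forall phi : 'rV[R]_n -> 'rV[R]_n, Lip_c Omega phi ->
            \int[lebesgueRn R n]_(x in E) frac_div alpha phi x =
            - \int[lebesgueRn R n]_(x in Omega)
                dotv (phi x) (frac_grad alpha E x))
       & (exists D : vmeasure R n, frac_variation_measure alpha E Omega D) /\
         (forall D : vmeasure R n, frac_variation_measure alpha E Omega D ->
            polar_density D (vnormal Omega D) /\
            forall (i : 'I_n) (A : set (borelRn R n)), measurable A ->
              D i A = (\int[lebesgueRn R n]_(x in A `&` Omega)
                         (frac_grad alpha E x ord0 i)%:E)%E)])
  /\
  (forall E : set 'rV[R]_n,
     measurable (E : set (lebRn R n)) ->
     (lebesgueRn R n E < +oo)%E -> (perimeter E < +oo)%E ->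
     forall alpha : R, 0 < alpha < 1 ->
       W_alpha_1 alpha \1_E /\
       (forall (DE : vmeasure R n) (nuE : 'rV[R]_n -> 'rV[R]_n),
          variation_measure E DE -> polar_density DE nuE ->
          {ae lebesgueRn R n, forall x,
             frac_grad_cvg alpha E x /\
             forall i : 'I_n,
               (vtotal_variation DE).-integrable setT
                 (fun y : borelRn R n =>
                    (nuE y ord0 i / enorm (y - x) `^ (n%:R + alpha - 1))%:E) /\
               (frac_grad alpha E x ord0 i)%:E =
               ((mu_frac n alpha / (n%:R + alpha - 1))%:E *
                \int[vtotal_variation DE]_y
                  (nuE y ord0 i / enorm (y - x) `^ (n%:R + alpha - 1))%:E)%E})).
Proof.
split.
  by move=> alpha Omega E a01 oO mE; exact: finite_frac_perimeter.
by move=> E mE Efin Pfin; exact: finite_perimeter_gradient.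
Qed.
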